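(* Let $\mathcal R$ be a countable, ergodic, measure preserving equivalence relation on a standard probability space $(X,\mu)$. Denote $\Delta=\{(x,x):x\in X\}$ and let $p^i:X\times X\to X$ be the projection onto the $i$-th coordinate, $i\in\{1,2\}$. Suppose that there is no sequence $\{\nu_n\}_{n\ge1}$ of Borel probability measures on $X\times X$ such that $\nu_n(\Delta)=0$ and $p^i_*(\nu_n)=\mu$ for all $i\in\{1,2\}$ and all $n$, and such that (a) $\lim_{n\to\infty}\int_{X\times X}f_1(x)f_2(y)\,d\nu_n(x,y)=\int_Xf_1f_2\,d\mu$ for all $f_1,f_2\in L^\infty(X,\mu)$, and (b) $\lim_{n\to\infty}\|(\theta\times\theta)_*\nu_n-\nu_n\|=0$ for all $\theta\in[\mathcal R]$. Then $\mathcal R$ is rigid.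
   Context: For measures $\mu,\nu$ on $Y$, $\|\mu-\nu\|=\sup|\int f\,d\mu-\int f\,d\nu|$ over bounded complex Borel functions $f$ with $\|f\|_\infty\le1$. Push-forward: $p_*\mu(A)=\mu(p^{-1}(A))$. A countable measure preserving equivalence relation $\mathcal R$ on a standard probability space $(X,\mu)$ (standard Borel space with non-atomic Borel probability measure) is a Borel equivalence relation $\mathcal R\subset X\times X$ with countable classes which is induced by a measure preserving Borel action of a countable group. $\mathcal R$ is ergodic if every $\mathcal R$-invariant Borel set is null or co-null. The full group $[\mathcal R]$ is the group of Borel automorphisms $\theta$ of $X$ preserving $\mu$ with $(x,\theta(x))\in\mathcal R$ for a.e. $x$. Von Neumann algebra $L(\mathcal R)$: endow $\mathcal R$ with the measure $\nu(A)=\int_X|\{y:(x,y)\in A\}|\,d\mu(x)$; on $L^2(\mathcal R,\nu)$ let $(u_\theta g)(x,y)=g(\theta^{-1}(x),y)$ for $\theta\in[\mathcal R]$ and $(L_fg)(x,y)=f(x)g(x,y)$ for $f\in L^\infty(X,\mu)$. $L(\mathcal R)$ is the strong operator closure of the linear span of $\{L_fu_\theta\}$, with trace $\tau(y)=\langle y1_\Delta,1_\Delta\rangle$; $f\mapsto L_f$ identifies $L^\infty(X,\mu)$ with a subalgebra of $L(\mathcal R)$. Rigid inclusions: let $M$ be a separable finite von Neumann algebra with faithful normal (normalized) trace $\tau$ and $B\subset M$ a von Neumann subalgebra. A Hilbert $M$-bimodule is a Hilbert space with commuting (normal, unital) left and right Hilbert $M$-module structures. A vector $\xi$ is tracial if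 $\langle x\xi,\xi\rangle=\langle\xi x,\xi\rangle=\tau(x)$ for all $x\in M$, and $B$-central if $b\xi=\xi b$ for all $b\in B$. A pointed Hilbert $M$-bimodule $(\mathcal H,\xi)$ is a Hilbert $M$-bimodule with a unit vector $\xi$. The inclusion $(B\subset M)$ is rigid if for every $\varepsilon>0$ there are a finite $F\subset M$ and $\delta>0$ such that whenever $(\mathcal H,\xi)$ is a pointed Hilbert $M$-bimodule with $\xi$ tracial and $\|x\xi-\xi x\|\le\delta$ for all $x\in F$, there is a $B$-central vector $\eta\in\mathcal H$ with $\|\eta-\xi\|\le\varepsilon$. A countable ergodic measure preserving equivalence relation $\mathcal R$ is rigid if the inclusion $(L^\infty(X,\mu)\subset L(\mathcal R))$ is rigid. *)

(* Defs.v *)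
From HB Require Import structures.
From mathcomp Require Import all_boot all_order all_algebra.
From mathcomp Require Import all_classical all_reals all_analysis.
From mathcomp Require Import measurable_realfun ring lra complex sesquilinear.
Set Implicit Arguments.
Unset Strict Implicit.
Unset Printing Implicit Defensive.
Import Order.TTheory GRing.Theory Num.Theory numFieldNormedType.Exports.
Import ComplexField.Normc.
Local Open Scope classical_set_scope.
Local Open Scope complex_scope.
Local Open Scope quotient_scope.
Local Open Scope ring_scope.

Local Notation re := (@complex.Re _).
Local Notation im := (@complex.Im _).

Section complex_arith.
Context {R : realType}.
Implicit Types a z : R[i].

Lemma reM a z : re (a * z) = re a * re z - im a * im z.
Proof. by case: a z => [a b] [c e]. Qed.

Lemma imM a z : im (a * z) = re a * im z + im a * re z.
Proof. by case: a z => [a b] [c e]. Qed.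

Lemma reD a z : re (a + z) = re a + re z.
Proof. by case: a z => [a b] [c e]. Qed.

Lemma imD a z : im (a + z) = im a + im z.
Proof. by case: a z => [a b] [c e]. Qed.

Lemma reC z : re z^* = re z. Proof. by case: z. Qed.

Lemma imC z : im z^* = - im z. Proof. by case: z. Qed.

Lemma normc2 z : normc z ^+ 2 = re z ^+ 2 + im z ^+ 2.
Proof. by case: z => a b /=; rewrite sqr_sqrtr// addr_ge0// sqr_ge0. Qed.

End complex_arith.

Section complex_functions.
Context d (T : measurableType d) (R : realType).
Implicit Types f g : T -> R[i].

Definition cmeasurable f :=
  measurable_fun setT (re \o f) /\ measurable_fun setT (im \o f).

(* [fine] sends infinite integrals to 0, as in [Rintegral]; only functions that
   are integrable for [m] are integrated below. *)
Definition cintegral (m : set T -> \bar R) f : R[i] :=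
  fine (\int[m]_x (re (f x))%:E) +i* fine (\int[m]_x (im (f x))%:E).

Definition tv_dist (m1 m2 : set T -> \bar R) : \bar R :=
  ereal_sup [set (normc (cintegral m1 f - cintegral m2 f))%:E |
    f in [set f | cmeasurable f /\ forall x, normc (f x) <= 1]].

Lemma cmeasurableM f g : cmeasurable f -> cmeasurable g ->
  cmeasurable (fun x => f x * g x).
Proof.
move=> [f1 f2] [g1 g2]; split.
- rewrite [_ \o _](_ : _ = fun x => re (f x) * re (g x) - im (f x) * im (g x)).
    by apply: measurable_funB; apply: measurable_funM.
  by apply/funext => x /=; rewrite reM.
- rewrite [_ \o _](_ : _ = fun x => re (f x) * im (g x) + im (f x) * re (g x)).
    by apply: measurable_funD; apply: measurable_funM.
  by apply/funext => x /=; rewrite imM.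
Qed.

Lemma cmeasurableD f g : cmeasurable f -> cmeasurable g ->
  cmeasurable (fun x => f x + g x).
Proof.
move=> [f1 f2] [g1 g2]; split.
- rewrite [_ \o _](_ : _ = fun x => re (f x) + re (g x)).
    exact: measurable_funD.
  by apply/funext => x /=; rewrite reD.
- rewrite [_ \o _](_ : _ = fun x => im (f x) + im (g x)).
    exact: measurable_funD.
  by apply/funext => x /=; rewrite imD.
Qed.

Lemma cmeasurable_cst (a : R[i]) : cmeasurable (fun=> a).
Proof. by split; apply: measurable_cst. Qed.

Lemma cmeasurable_conj f : cmeasurable f -> cmeasurable (fun x => (f x)^*).
Proof.
move=> [f1 f2]; split.
- by rewrite [_ \o _](_ : _ = re \o f)//; apply/funext => x /=; rewrite reC.
- rewrite [_ \o _](_ : _ = \- (im \o f)); first exact: measurableT_comp.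
  by apply/funext => x /=; rewrite imC.
Qed.

Lemma measurable_normc2 f : cmeasurable f ->
  measurable_fun setT (fun x => (normc (f x) ^+ 2)%:E).
Proof.
move=> [f1 f2]; apply/measurable_EFinP.
under eq_fun do rewrite normc2.
by apply: measurable_funD; apply: measurable_funX.
Qed.

End complex_functions.

Section L2.
Context d (T : measurableType d) (R : realType) (m : {measure set T -> \bar R}).
Implicit Types f g : T -> R[i].

Definition square_integrable f :=
  cmeasurable f /\ (\int[m]_x (normc (f x) ^+ 2)%:E < +oo)%E.

Definition sqint : {pred T -> R[i]} := mem [set f | square_integrable f].

Lemma square_integrable_le f g (C : R) : cmeasurable f ->
  square_integrable g ->
  {ae m, forall x, normc (f x) ^+ 2 <= C * normc (g x) ^+ 2} ->
  square_integrable f.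
Proof.
move=> mf [mg ig] fg; split=> //.
have -> : (\int[m]_x (normc (f x) ^+ 2)%:E = 
  \int[m]_x `|(normc (f x) ^+ 2)%:E|)%E.
  by apply: eq_integral => x _; rewrite gee0_abs// lee_fin sqr_ge0.
have H : m.-integrable setT (fun x => (C * normc (g x) ^+ 2)%:E).
  rewrite (_ : (fun x => _) = fun x => (C%:E * (normc (g x) ^+ 2)%:E)%E)//.
  apply: integrableZl => //; apply/integrableP; split.
    exact: measurable_normc2.
  by under eq_integral do rewrite gee0_abs ?lee_fin ?sqr_ge0//.
apply: (@le_lt_trans _ _ (\int[m]_x `|(C * normc (g x) ^+ 2)%:E|)%E); last first.
  by case/integrableP : H.
apply: ae_ge0_le_integral => //.
- by apply: measurableT_comp => //; exact: measurable_normc2.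
- by apply: measurableT_comp => //; case/integrableP : H.
- apply: filterS fg => x fg _.
  by rewrite gee0_abs ?lee_fin ?sqr_ge0// (le_trans fg)// ler_norm.
Qed.

Lemma square_integrableD f g : square_integrable f -> square_integrable g ->
  square_integrable (f + g).
Proof.
move=> [mf iF] [mg ig]; split; first exact: cmeasurableD.
have mE (h : T -> R[i]) : cmeasurable h ->
    measurable_fun setT (fun x => (2 * normc (h x) ^+ 2)%:E).
  move=> mh; rewrite (_ : (fun x => _) = fun x => (2%:E * (normc (h x) ^+ 2)%:E)%E)//.
  by apply: measurable_funeM; exact: measurable_normc2.
apply: (@le_lt_trans _ _ (\int[m]_x ((2 * normc (f x) ^+ 2)%:E +
    (2 * normc (g x) ^+ 2)%:E))%E).
  apply: ge0_le_integral => //.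
  - by move=> x _; rewrite lee_fin sqr_ge0.
  - by apply: measurable_normc2; exact: cmeasurableD.
  - exact: (emeasurable_funD (mE _ mf) (mE _ mg)).
  - move=> x _; rewrite -EFinD lee_fin !normc2 !fctE reD imD.
    have := sqr_ge0 (re (f x) - re (g x)).
    have := sqr_ge0 (im (f x) - im (g x)).
    nra.
rewrite ge0_integralD//=.
- under eq_integral do rewrite EFinM.
  under [X in (_ + X)%E]eq_integral do rewrite EFinM.
  rewrite !ge0_integralZl//.
  + by rewrite lte_add_pinfty// lte_mul_pinfty// ?lee_fin.
  + exact: measurable_normc2.
  + by move=> x _; rewrite lee_fin sqr_ge0.
  + exact: measurable_normc2.
  + by move=> x _; rewrite lee_fin sqr_ge0.
- by move=> x _; rewrite lee_fin mulr_ge0// sqr_ge0.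
- exact: mE.
- by move=> x _; rewrite lee_fin mulr_ge0// sqr_ge0.
- exact: mE.
Qed.

Lemma square_integrableZ (a : R[i]) f : square_integrable f ->
  square_integrable (a *: f).
Proof.
move=> f2; apply: (@square_integrable_le _ f (normc a ^+ 2)) => //.
- by apply: cmeasurableM; [exact: cmeasurable_cst|case: f2].
- by apply: aeW => x; rewrite fctE normcM exprMn.
Qed.

Lemma sqint_submod_closed : submod_closed sqint.
Proof.
split=> [|a f g /set_mem f2 /set_mem g2]; apply/mem_set.
- split; first exact: cmeasurable_cst.
  by under eq_integral do rewrite normc0 expr0n/=; rewrite integral0.
- by apply: square_integrableD => //; exact: square_integrableZ.
Qed.

HB.instance Definition _ := GRing.isSubmodClosed.Build _ _ sqint
  sqint_submod_closed.

Record L2fun := MkL2fun { L2fun_val :> T -> R[i]; L2funP : L2fun_val \in sqint }.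

HB.instance Definition _ := [isSub for L2fun_val].
HB.instance Definition _ := [Choice of L2fun by <:].
HB.instance Definition _ := [SubChoice_isSubLmodule of L2fun by <:].

Definition ae_zero : {pred L2fun} := mem [set f : L2fun | {ae m, forall x, f x = 0}].

Lemma ae_zero_zmod_closed : zmod_closed ae_zero.
Proof.
split=> [|f g /set_mem f0 /set_mem g0]; apply/mem_set.
- exact: aeW.
- by apply: filterS2 f0 g0 => x /= f0 g0; rewrite !fctE/= f0 g0 subr0.
Qed.

HB.instance Definition _ := GRing.isZmodClosed.Build _ ae_zero
  ae_zero_zmod_closed.

(* Complex-valued square integrable functions modulo equality almost everywhere. *)
Definition L2 := Quotient.quot ae_zero.
HB.instance Definition _ := GRing.Zmodule.on L2.
HB.instance Definition _ := Choice.on L2.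

Definition L2class (f : L2fun) : L2 := \pi_L2 f.
Definition L2repr (u : L2) : L2fun := repr u.

Lemma L2reprK u : L2class (L2repr u) = u. Proof. exact: reprK. Qed.

Lemma L2classP (f g : L2fun) :
  L2class f = L2class g <-> {ae m, forall x, f x = g x}.
Proof.
split=> [/eqP|fg].
- rewrite /L2class -Quotient.idealrBE => /set_mem /=; apply: filterS => x /=.
  by move/eqP; rewrite !fctE/= subr_eq0 => /eqP.
- apply/eqP; rewrite /L2class -Quotient.idealrBE; apply/mem_set.
  by apply: filterS fg => x /= fg; rewrite !fctE/= fg subrr.
Qed.

Lemma L2repr_ae (f : L2fun) : {ae m, forall x, L2repr (L2class f) x = f x}.
Proof. by apply/L2classP; rewrite L2reprK. Qed.

Lemma L2classD (f g : L2fun) : L2class (f + g) = L2class f + L2class g.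
Proof. by rewrite /L2class [RHS]piE. Qed.

Definition L2scale (a : R[i]) (u : L2) : L2 := L2class (a *: L2repr u).

Lemma L2classZ (a : R[i]) (f : L2fun) : L2class (a *: f) = L2scale a (L2class f).
Proof.
apply/L2classP; apply: filterS (L2repr_ae f) => x fx.
by rewrite /= !fctE fx.
Qed.

Let scaleA a b u : L2scale a (L2scale b u) = L2scale (a * b) u.
Proof. by rewrite -[u]L2reprK -!L2classZ scalerA. Qed.
Let scale1 : left_id 1 L2scale.
Proof. by move=> u; rewrite -[u]L2reprK -!L2classZ scale1r. Qed.
Let scaleDr : right_distributive L2scale +%R.
Proof.
by move=> a u v; rewrite -[u]L2reprK -[v]L2reprK -!(L2classD, L2classZ) scalerDr.
Qed.
Let scaleDl u : {morph L2scale^~ u : a b / a + b}.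
Proof. by move=> a b; rewrite -[u]L2reprK -!(L2classD, L2classZ) scalerDl. Qed.

HB.instance Definition _ := GRing.Zmodule_isLmodule.Build R[i] L2
  scaleA scale1 scaleDr scaleDl.

Definition cintegrable f :=
  m.-integrable setT (EFin \o re \o f) /\ m.-integrable setT (EFin \o im \o f).

Lemma cintegralD f g : cintegrable f -> cintegrable g ->
  cintegral m (f + g) = cintegral m f + cintegral m g.
Proof.
move=> [f1 f2] [g1 g2]; rewrite /cintegral; apply/eqP; rewrite eq_complex/=.
apply/andP; split; apply/eqP.
- under eq_integral do rewrite fctE reD; exact: RintegralD.
- under eq_integral do rewrite fctE imD; exact: RintegralD.
Qed.

Lemma cintegralZ (a : R[i]) f : cintegrable f ->
  cintegral m (a *: f) = a * cintegral m f.
Proof.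
move=> [f1 f2]; rewrite /cintegral.
have f1' c : m.-integrable setT (EFin \o (fun x => c * re (f x))).
  by apply: (integrableZl _ _ f1).
have f2' c : m.-integrable setT (EFin \o (fun x => c * im (f x))).
  by apply: (integrableZl _ _ f2).
case: a => a b; apply/eqP; rewrite eq_complex/=; apply/andP; split; apply/eqP.
- under eq_integral do rewrite fctE reM/=.
  have := RintegralB measurableT (f1' a) (f2' b); rewrite /Rintegral => ->.
  congr (_ - _); exact: RintegralZl.
- under eq_integral do rewrite fctE imM/=.
  have := RintegralD measurableT (f2' a) (f1' b); rewrite /Rintegral => ->.
  congr (_ + _); exact: RintegralZl.
Qed.

Lemma cintegral_conj f : cintegrable f ->
  cintegral m (fun x => (f x)^*) = (cintegral m f)^*.
Proof.
move=> [f1 f2]; rewrite /cintegral; apply/eqP; rewrite eq_complex/=.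
apply/andP; split; apply/eqP.
- by under eq_integral do rewrite reC.
- under eq_integral do rewrite imC -mulN1r.
  by rewrite -[RHS]mulN1r; exact: (RintegralZl (-1) measurableT f2).
Qed.

Lemma ae_eq_cintegral f g : cmeasurable f -> cmeasurable g ->
  {ae m, forall x, f x = g x} -> cintegral m f = cintegral m g.
Proof.
move=> [f1 f2] [g1 g2] fg; rewrite /cintegral; congr (fine _ +i* fine _);
  apply: ae_eq_integral => //.
- exact/measurable_EFinP.
- exact/measurable_EFinP.
- by apply: filterS fg => x -> _.
- exact/measurable_EFinP.
- exact/measurable_EFinP.
- by apply: filterS fg => x -> _.
Qed.

Lemma square_integrable_mul f g : square_integrable f -> square_integrable g ->
  cintegrable (fun x => f x * (g x)^*).
Proof.
move=> [mf iF] [mg ig].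
have [m1 m2] : cmeasurable (fun x => f x * (g x)^*).
  by apply: cmeasurableM => //; exact: cmeasurable_conj.
have intf h : square_integrable h ->
    m.-integrable setT (fun x => (normc (h x) ^+ 2)%:E).
  move=> [mh ih]; apply/integrableP; split; first exact: measurable_normc2.
  by under eq_integral do rewrite gee0_abs ?lee_fin ?sqr_ge0//.
have H : m.-integrable setT
    (fun x => (normc (f x) ^+ 2)%:E + (normc (g x) ^+ 2)%:E)%E.
  by apply: (integrableD measurableT); exact: intf.
split; apply: (le_integrable _ _ _ H) => //.
- exact/measurable_EFinP.
- move=> x _; rewrite /= lee_fin [leRHS]ger0_norm ?addr_ge0 ?sqr_ge0//.
  rewrite !normc2 reM reC imC ler_norml; apply/andP; split; 
  have := sqr_ge0 (re (f x) - re (g x));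
  have := sqr_ge0 (im (f x) - im (g x));
  have := sqr_ge0 (re (f x) + re (g x));
  have := sqr_ge0 (im (f x) + im (g x)); nra.
- exact/measurable_EFinP.
- move=> x _; rewrite /= lee_fin [leRHS]ger0_norm ?addr_ge0 ?sqr_ge0//.
  rewrite !normc2 imM reC imC ler_norml; apply/andP; split;
  have := sqr_ge0 (re (f x) - im (g x));
  have := sqr_ge0 (im (f x) - re (g x));
  have := sqr_ge0 (re (f x) + im (g x));
  have := sqr_ge0 (im (f x) + re (g x)); nra.
Qed.

Definition L2dot (u v : L2) : R[i] :=
  cintegral m (fun x => L2repr u x * (L2repr v x)^*).

Lemma L2fun_sqint (f : L2fun) : square_integrable f.
Proof. exact: (set_mem (L2funP f)). Qed.

Lemma L2dotE (f g : L2fun) :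
  L2dot (L2class f) (L2class g) = cintegral m (fun x => f x * (g x)^*).
Proof.
have mL (h k : L2fun) : cmeasurable (fun x => h x * (k x)^*).
  apply: cmeasurableM; [|apply: cmeasurable_conj]; exact: (L2fun_sqint _).1.
apply: ae_eq_cintegral => //.
by apply: filterS2 (L2repr_ae f) (L2repr_ae g) => x -> ->.
Qed.

Lemma L2dot_linearl v : linear_for *%R (L2dot^~ v).
Proof.
move=> a u w; rewrite -[u]L2reprK -[v]L2reprK -[w]L2reprK.
rewrite -[a *: _]L2classZ -L2classD !L2dotE.
rewrite -cintegralZ; last by apply: square_integrable_mul; exact: L2fun_sqint.
rewrite -cintegralD.
- by congr cintegral; apply/funext => x; rewrite !fctE/= mulrDl -mulrA.
- have H := square_integrable_mul
    (square_integrableZ a (L2fun_sqint (L2repr u))) (L2fun_sqint (L2repr v)).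
  rewrite (_ : _ *: _ = (fun x => (a *: (L2repr u : T -> R[i])) x * (L2repr v x)^*))//.
  by apply/funext => x; rewrite !fctE -[RHS]mulrA.
- by apply: square_integrable_mul; exact: L2fun_sqint.
Qed.

Lemma L2dot_herm u v : L2dot u v = (L2dot v u)^*.
Proof.
rewrite -cintegral_conj; last by apply: square_integrable_mul; exact: L2fun_sqint.
congr cintegral; apply/funext => x.
by case: (L2repr u x) (L2repr v x) => [a b] [c e] /=; congr (_ +i* _); ring.
Qed.

Lemma L2dot_linearr u : linear_for (Num.Def.conjC \; *%R) (L2dot u).
Proof.
move=> a v w; rewrite L2dot_herm L2dot_linearl (L2dot_herm u v) (L2dot_herm u w).
by rewrite rmorphD rmorphM.
Qed.

HB.instance Definition _ := @bilinear_isBilinear.Build R[i] L2 L2 R[i]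
  *%R (Num.Def.conjC \; *%R) L2dot (conj L2dot_linearl L2dot_linearr).

HB.instance Definition _ := @isHermitianSesquilinear.Build R[i] L2 false
  Num.Def.conjC L2dot (fun u v => etrans (L2dot_herm u v) (esym (mul1r _))).

Lemma L2dot_gt0 u : u != 0 -> 0 < L2dot u u.
Proof.
rewrite -[u]L2reprK; set f := L2repr u => fN0; rewrite L2dotE.
have [mf iF] := L2fun_sqint f.
rewrite (_ : cintegral _ _ = (fine (\int[m]_x (normc (f x) ^+ 2)%:E))%:C).
  rewrite ltcR fine_gt0// iF andbT lt0e integral_ge0 ?andbT; last first.
    by move=> x _; rewrite lee_fin sqr_ge0.
  apply: contra fN0 => /eqP i0; apply/eqP.
  rewrite -[0](_ : L2class 0 = 0) ?/L2class ?piE//; apply/L2classP.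
  have /ae_eq_integral_abs : measurable_fun setT (fun x => (normc (f x) ^+ 2)%:E).
    exact: measurable_normc2.
  move=> /(_ m measurableT)[+ _].
  under eq_integral do rewrite gee0_abs ?lee_fin ?sqr_ge0//.
  move=> /(_ i0); apply: filterS => x /(_ I)[] /eqP.
  by rewrite sqrf_eq0 => /eqP/eq0_normc.
rewrite /cintegral; apply/eqP; rewrite eq_complex/=; apply/andP; split; apply/eqP.
- by congr fine; apply: eq_integral => x _; rewrite normc2 reM reC imC mulrN opprK.
- under eq_integral do rewrite imM reC imC mulrN mulrC addNr.
  by rewrite integral0.
Qed.

HB.instance Definition _ := isDotProduct.Build R[i] L2 L2dot L2dot_gt0.
End L2.

(* The measurable space is Borel isomorphic to a Polish space. *)
Definition standard_borel (R : realType) d (X : measurableType d) :=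
  exists (P : completePseudoMetricType R) (f : X -> P),
    [/\ hausdorff_space P, exists2 D : set P, countable D & dense D,
        bijective f &
        forall A : set P, measurable (f @^-1` A) <-> <<s [set U : set P | open U] >> A].

Section equivalence_relations.
Context d (X : measurableType d) (R : realType).
Variables (mu : probability X R) (E : set (X * X)).

Definition nonatomic := forall A, measurable A -> (0 < mu A)%E ->
  exists2 B, B `<=` A & measurable B /\ (0 < mu B < mu A)%E.

Definition mp_action (G : groupType) (a : G -> X -> X) :=
  [/\ a 1%g = id,
      forall g h, a (g * h)%g = a g \o a h,
      forall g, measurable_fun setT (a g) &
      forall g A, measurable A -> mu (a g @^-1` A) = mu A].

(* Countable measure preserving equivalence relation. *)
Record cmp_relation : Prop := CmpRelation {
  cmp_measurable : measurable E ;
  cmp_refl : forall x, E (x, x) ;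
  cmp_sym : forall x y, E (x, y) -> E (y, x) ;
  cmp_trans : forall x y z, E (x, y) -> E (y, z) -> E (x, z) ;
  cmp_countable : forall x, countable [set y | E (x, y)] ;
  cmp_action : exists (G : groupType) (a : G -> X -> X),
    [/\ countable [set: G], mp_action a &
        forall x y, E (x, y) <-> exists g, y = a g x] }.

Definition ergodic := forall A, measurable A ->
  (forall x y, E (x, y) -> A x -> A y) -> mu A = 0%E \/ mu (~` A) = 0%E.

Record full_group := FullGroup {
  fg_fun :> X -> X ;
  fg_inv : X -> X ;
  fg_funK : cancel fg_fun fg_inv ;
  fg_invK : cancel fg_inv fg_fun ;
  fg_measurable : measurable_fun setT fg_fun ;
  fg_inv_measurable : measurable_fun setT fg_inv ;
  fg_preserving : forall A, measurable A -> mu (fg_fun @^-1` A) = mu A ;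
  fg_ae : {ae mu, forall x, E (x, fg_fun x)} }.

(* Representatives: almost everywhere equal functions act in the same way below. *)
Record Linfty := MkLinfty {
  Linfty_fun :> X -> R[i] ;
  Linfty_measurable : cmeasurable Linfty_fun ;
  Linfty_bounded : exists C : R, {ae mu, forall x, normc (Linfty_fun x) <= C} }.

End equivalence_relations.

Section diagonal_measurable.
Context (R : realType) d (X : measurableType d).
Hypothesis hX : standard_borel R X.

Lemma measurable_diagonal : measurable (@diagonal X).
Proof.
have [P [f [hP [D cD dD] bf mf]]] := hX.
have mO (U : set P) : open U -> measurable (f @^-1` U).
  by move=> oU; apply/mf; exact: sub_gen_smallest.
rewrite (_ : diagonal = \bigcap_n \bigcup_(p in D)
   ((f @^-1` (ball p n.+1%:R^-1)°) `*` (f @^-1` (ball p n.+1%:R^-1)°))).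
  apply: bigcapT_measurable => n.
  move/pfcard_geP : cD => [->|[g]]; first by rewrite bigcup_set0.
  rewrite -(image_eq g) bigcup_image; apply: bigcup_measurable => k _.
  by apply: measurableX; apply: mO; exact: open_interior.
have posn n : 0 < n.+1%:R^-1 :> R by [].
apply/seteqP; split=> [[x y]|[x y] H]; rewrite /diagonal /=; [move=> <- n _|].

- have : (ball (f x) n.+1%:R^-1)° !=set0.
    exists (f x); apply: nbhs_singleton; apply: nbhs_interior.
    exact: nbhsx_ballx.
  have bx : nbhs (f x) (ball (f x) (n.+1%:R^-1 / 2)).
    by apply: nbhsx_ballx; rewrite divr_gt0.
  have [|p [+ Dp]] := dD (ball (f x) (n.+1%:R^-1 / 2))° _ (@open_interior _ _).
    by exists (f x); apply: nbhs_singleton; exact: nbhs_interior.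
  move=> /interior_subset bp.
  exists p => //; suff bfx : (ball p n.+1%:R^-1)° (f x) by [].
  apply/nbhs_ballP; exists (n.+1%:R^-1 / 2) => /=; first by rewrite divr_gt0.
  move=> z bz; rewrite [n.+1%:R^-1]splitr.
  exact: (ball_triangle (ball_sym bp)).
- apply: (bij_inj bf); apply: hP => A B.
  move=> /nbhs_ballP[e/= e0 eA] /nbhs_ballP[r/= r0 rB].
  pose s := Num.min e r; have s0 : 0 < s by rewrite lt_min e0 r0.
  have s20 : 0 < s / 2 by rewrite divr_gt0.
  have s2s : s / 2 <= s by lra.
  have [n nlt] := ltr_add_invr s20; rewrite add0r in nlt.
  have [p Dp [/= /interior_subset px /interior_subset py]] := H n I.
  have h q w : ball q n.+1%:R^-1 w -> ball q (s / 2) w.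
    by apply: le_ball; exact: ltW.
  exists p; split.
  - apply: eA; apply: (@le_ball _ _ _ (s / 2)); last exact/ball_sym/h.
    by rewrite (le_trans s2s)// ge_min lexx.
  - apply: rB; apply: (@le_ball _ _ _ (s / 2)); last exact/ball_sym/h.
    by rewrite (le_trans s2s)// ge_min lexx orbT.
Qed.
End diagonal_measurable.

(* This is the measure on E, seen as a measure on X * X concentrated on E, so that
   [L2] of it is the space of square integrable functions on E.  The proofs taken
   as arguments are what makes it a measure. *)
Definition rel_measure d (X : measurableType d) (R : realType)
    (mu : probability X R) (E : set (X * X)) of
    standard_borel R X & cmp_relation mu E : set (X * X) -> \bar R :=
  fun A => (\int[mu]_x counting [set y | (A `&` E) (x, y)])%E.

Section relation_measure.
Context d (X : measurableType d) (R : realType).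
Variables (mu : probability X R) (E : set (X * X)).
Hypotheses (hX : standard_borel R X) (hE : cmp_relation mu E).

Lemma cmp_enum : exists e : nat -> X -> X,
  (forall n, measurable_fun setT (e n)) /\
  forall x y, E (x, y) <-> exists n, y = e n x.
Proof.
have [G [a [/pfcard_geP cG [_ _ ma _] aE]]] := cmp_action hE.
case: cG => [G0|[g]].
  by have : [set: G] 1%g by []; rewrite G0.
exists (a \o g); split=> [n|x y] /=; first exact: ma.
rewrite aE; split=> [[h ->]|[n ->]]; last by exists (g n).
have [n _ <-] : (g @` setT) h by rewrite image_eq.
by exists n.
Qed.

Lemma measurable_counting_xsection (A : set (X * X)) : measurable A -> A `<=` E ->
  measurable_fun setT (fun x => counting (xsection A x) : \bar R).
Proof.
move=> mA AE; have [e [me eE]] := cmp_enum.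
pose G n := A `&` [set z : X * X | e n z.1 = z.2].
have mG n : measurable (G n).
  apply: measurableI => //.
  rewrite (_ : [set z : X * X | _] =
    (fun z : X * X => (e n z.1, z.2)) @^-1` diagonal)//.
  have mf : measurable_fun setT (fun z : X * X => (e n z.1, z.2)).
    by apply: measurable_fun_pair => //; exact: measurableT_comp.
  by rewrite -[X in measurable X]setTI; apply: mf => //; exact: (measurable_diagonal hX).
have AG : A = \bigcup_n seqDU G n.
  rewrite -seqDU_bigcup_eq; apply/seteqP; split=> [[x y] Axy|z [n _ []//]].
  by have /eE[n yE] := AE _ Axy; exists n.
have mD n : measurable (seqDU G n) by exact: seqDU_measurable.
have tD := @trivIset_seqDU _ G.
rewrite (_ : (fun x => _) = fun x =>
    (\sum_(n <oo) (\1_[set x | seqDU G n (x, e n x)] x)%:E)%E).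
  apply: ge0_emeasurable_sum => [n x _ _|n _]; first by rewrite lee_fin.
  apply/measurable_EFinP/measurable_indicP.
  have mf : measurable_fun setT (fun x => (x, e n x)).
    exact: measurable_fun_pair.
  by rewrite -[X in measurable X]setTI; exact: mf.
apply/funext => x; rewrite {1}AG xsection_bigcup.
apply/esym/cvg_lim => //.
rewrite [X in X @ _ --> _](_ : _ =
    (fun n => (\sum_(0 <= i < n) counting (xsection (seqDU G i) x))%E)).
  apply: (@measure_sigma_additive _ _ _ (counting : {measure set X -> \bar R}) _
    _ (trivIset_xsection tD)) => n.
  exact: measurable_xsection.
apply/funext => n; apply: eq_bigr => i _.
have sub : xsection (seqDU G i) x `<=` [set e i x].
  by move=> y; rewrite xsectionE => -[[_ ->]].
rewrite indicE; case: (pselect (seqDU G i (x, e i x))) => [ix|Nix].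
- rewrite mem_set//= (_ : xsection _ _ = [set e i x]); last first.
    by apply/seteqP; split=> // y ->; rewrite xsectionE.
  by rewrite /counting asboolT// fset_set1 finmap.cardfs1.
- rewrite memNset//= (_ : xsection _ _ = set0) ?measure0//.
  apply/seteqP; split=> // y /[dup] /sub ->.
  by rewrite xsectionE => /Nix.
Qed.

Local Notation nu := (rel_measure hX hE).

Lemma rel_measureE A : nu A = (\int[mu]_x counting (xsection (A `&` E) x))%E.
Proof. by apply: eq_integral => x _; rewrite xsectionE. Qed.

Let rm0 : nu set0 = 0%E.
Proof.
by rewrite rel_measureE set0I; apply: integral0_eq => x _; rewrite xsection0 measure0.
Qed.

Let rm_ge0 A : (0 <= nu A)%E.
Proof. by apply: integral_ge0 => x _; exact: measure_ge0. Qed.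

Let rm_sigma_additive : semi_sigma_additive nu.
Proof.
move=> F mF tF mUF.
have mFE n : measurable (F n `&` E) by apply: measurableI => //; exact: cmp_measurable hE.
have tFE : trivIset setT (fun n => F n `&` E).
  exact: trivIset_setIr.
rewrite [X in _ --> X](_ : _ = \sum_(n <oo) nu (F n))%E.
  by apply: is_cvg_nneseries => n _ _; exact: rm_ge0.
under eq_eseriesr do rewrite rel_measureE.
rewrite -integral_nneseries//.
- rewrite rel_measureE; apply: eq_integral => x _; apply/esym/cvg_lim => //=.
  rewrite setI_bigcupl xsection_bigcup.
  apply: (@measure_sigma_additive _ _ _ (counting : {measure set X -> \bar R}) _ _ (trivIset_xsection tFE)) => ?.
  exact: measurable_xsection.
- by move=> n; apply: measurable_counting_xsection.
Qed.

HB.instance Definition _ := isMeasure.Build _ _ _ nu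
  rm0 rm_ge0 rm_sigma_additive.

Lemma rel_measure_ae (P : X -> Prop) :
  {ae mu, forall x, P x} -> {ae nu, forall z, P z.1}.
Proof.
move=> [N [mN N0 PN]]; exists (N `*` setT); split.
- exact: measurableX.
- rewrite rel_measureE -[RHS](@integral0 _ _ _ mu setT).
  have mNE : measurable ((N `*` setT) `&` E).
    by apply: measurableI; [exact: measurableX|exact: cmp_measurable hE].
  apply: ae_eq_integral => //.
    by apply: measurable_counting_xsection.
  exists N; split=> // x /= /not_implyP[_ Nx]; apply/not_notP => NNx; apply: Nx.
  rewrite (_ : xsection _ _ = set0) ?measure0//.
  by apply/seteqP; split=> // y; rewrite xsectionE => -[[]].
- by move=> [x y] /= Pxy; split=> //; exact: PN.
Qed.

Lemma rel_measure_diagonal : nu diagonal = 1%E.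
Proof.
rewrite rel_measureE (eq_integral (cst 1%E)) => [|x _].
  by rewrite integral_cst//= mul1e probability_setT.
rewrite (_ : xsection _ _ = [set x]).
  by rewrite /counting asboolT// fset_set1 finmap.cardfs1.
apply/seteqP; split=> y; rewrite xsectionE; first by move=> [xy _]; exact: esym xy.
by move=> ->; split=> //; exact: cmp_refl hE _.
Qed.

Lemma square_integrable_diagonal :
  square_integrable nu (fun z => (z.1 == z.2)%:R : R[i]).
Proof.
have D (b : bool) : (b%:R : R[i]) = (b%:R)%:C by case: b.
have mD : measurable (@diagonal X) by exact: (measurable_diagonal hX).
have DE : (fun z : X * X => (z.1 == z.2)%:R : R) = \1_(@diagonal X).
  by apply/funext => z; rewrite indicE; congr ((nat_of_bool _)%:R); apply/idP/idP;
    [move=> /eqP/mem_set|move=> /set_mem/eqP].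
split.
- split.
  + rewrite (_ : _ \o _ = (fun z => (z.1 == z.2)%:R)).
      by rewrite DE; exact: measurable_indic.
    by apply/funext => z /=; rewrite D.
  + rewrite (_ : _ \o _ = cst 0); first exact: measurable_cst.
    by apply/funext => z /=; rewrite D.
- rewrite (eq_integral (fun z => (\1_(@diagonal X) z)%:E)) => [|z _].
    by rewrite integral_indic// setIT; have := rel_measure_diagonal => /= ->; rewrite ltry.
  by rewrite -DE D normc2/= expr0n addr0; case: (_ == _) => /=; rewrite ?expr1n ?expr0n.
Qed.

Section translation.
Variable theta : full_group mu E.

Lemma fg_inv_preserving A : measurable A -> mu (fg_inv theta @^-1` A) = mu A.
Proof.
move=> mA; rewrite -[LHS](fg_preserving theta).
  by congr (mu _); apply/seteqP; split=> x /=; rewrite fg_funK.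
by rewrite -[X in measurable X]setTI; exact: fg_inv_measurable.
Qed.

Definition translate (z : X * X) := (fg_inv theta z.1, z.2).

Lemma measurable_translate : measurable_fun setT translate.
Proof.
by apply: measurable_fun_pair => //; apply: measurableT_comp => //;
  exact: fg_inv_measurable.
Qed.

Lemma rel_measure_translate A : measurable A ->
  pushforward nu translate A = nu A.
Proof.
move=> mA; rewrite /pushforward !rel_measureE.
have mAE B : measurable B -> measurable (B `&` E).
  by move=> mB; apply: measurableI => //; exact: cmp_measurable hE.
have mtA : measurable (translate @^-1` A).
  by rewrite -[X in measurable X]setTI; exact: measurable_translate.
pose h x : \bar R := counting (xsection (A `&` E) x).
have mh : measurable_fun setT h.
  by apply: measurable_counting_xsection => //; exact: mAE.
have mi := fg_inv_measurable theta.
transitivity (\int[mu]_x (h (fg_inv theta x)))%E.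
  apply: ae_eq_integral => //.
  - by apply: measurable_counting_xsection => //; exact: mAE.
  - exact: measurableT_comp.
  have [N [mN N0 EN]] := fg_ae theta.
  exists (fg_inv theta @^-1` N); split=> //.
  - by rewrite -[X in measurable X]setTI; exact: mi.
  - exact: (etrans (fg_inv_preserving mN) N0).
  move=> x /= /not_implyP[_ Nx]; apply: EN => /=.
  rewrite fg_invK => Ex; apply: Nx; congr counting.
  apply/seteqP; split=> y; rewrite !xsectionE => -[? ?]; split=> //.
  - exact: (cmp_trans hE Ex).
  - exact: (cmp_trans hE (cmp_sym hE Ex)).
have := ge0_integral_pushforward mi mu measurableT mh.
rewrite preimage_setT => <-; last by move=> x _; exact: measure_ge0.
by apply: eq_measure_integral => B mB _; exact: fg_inv_preserving.
Qed.

Lemma square_integrable_translate (g : X * X -> R[i]) :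
  square_integrable nu g -> square_integrable nu (g \o translate).
Proof.
move=> [[g1 g2] ig]; have mt := measurable_translate; split.
  split.
  - by rewrite (_ : _ \o _ = (re \o g) \o translate)//; exact: measurableT_comp.
  - by rewrite (_ : _ \o _ = (im \o g) \o translate)//; exact: measurableT_comp.
have mg := measurable_normc2 (conj g1 g2).
have := ge0_integral_pushforward mt nu measurableT mg.
rewrite preimage_setT => <-; last by move=> x _; rewrite lee_fin sqr_ge0.
rewrite (eq_measure_integral nu)// => B mB _; exact: rel_measure_translate.
Qed.

End translation.

Lemma square_integrable_mulL (f : Linfty mu) (g : X * X -> R[i]) :
  square_integrable nu g -> square_integrable nu (fun z => f z.1 * g z).
Proof.
move=> g2; have [mf [C fC]] := (Linfty_measurable f, Linfty_bounded f).
have mf1 : cmeasurable (fun z : X * X => f z.1).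
  case: mf => f1 f2; split.
  - by rewrite (_ : _ \o _ = (re \o f) \o fst)//; exact: measurableT_comp.
  - by rewrite (_ : _ \o _ = (im \o f) \o fst)//; exact: measurableT_comp.
apply: (square_integrable_le (C := C ^+ 2) _ g2).
  by apply: cmeasurableM => //; case: g2.
apply: filterS (rel_measure_ae fC) => z fzC.
have n0 (a : R[i]) : 0 <= normc a by case: a => ? ? /=; exact: sqrtr_ge0.
by rewrite normcM exprMn ler_wpM2r ?sqr_ge0// lerXn2r// nnegrE// (le_trans _ fzC).
Qed.

(* L_f : g |-> ((x, y) |-> f x * g (x, y)) *)
Definition L2mul (f : Linfty mu) (u : L2 nu) : L2 nu :=
  L2class (MkL2fun (mem_set (square_integrable_mulL f (L2fun_sqint (L2repr u))))).

(* u_theta : g |-> ((x, y) |-> g (theta^-1 x, y)) *)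
Definition L2translate (theta : full_group mu E) (u : L2 nu) : L2 nu :=
  L2class (MkL2fun (mem_set
    (square_integrable_translate theta (L2fun_sqint (L2repr u))))).

(* The vector 1_Delta. *)
Definition L2diag : L2 nu :=
  L2class (MkL2fun (mem_set square_integrable_diagonal)).

End relation_measure.

Arguments rel_measure {d X R mu E} hX hE A.
Arguments L2mul {d X R mu E} hX hE f u.
Arguments L2translate {d X R mu E} hX hE theta u.
Arguments L2diag {d X R mu E} hX hE.

Section operators.
Context (R : realType) (H : lmodType R[i]) (dot : {dot H for Num.Def.conjC}).
Implicit Types (x y : H -> H) (M D : set (H -> H)).

Definition hnorm (u : H) : R := Num.sqrt (re (dot u u)).

Definition hcomplete := forall u : nat -> H,
  (forall e : R, 0 < e -> exists N, forall i j,
    (N <= i)%N -> (N <= j)%N -> hnorm (u i - u j) < e) ->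
  exists l : H, forall e : R, 0 < e -> exists N, forall i,
    (N <= i)%N -> hnorm (u i - l) < e.

Definition bounded_op : set (H -> H) :=
  [set x | linear x /\ exists C : R, forall u, hnorm (x u) <= C * hnorm u].

(* y is the adjoint of x. *)
Definition adjoint x y := forall u v, dot (x u) v = dot u (y v).

(* Over R[i], 0 <= z means that z is real and nonnegative. *)
Definition op_le x y := forall u, 0 <= dot (y u - x u) u.

Definition op_sup M D x :=
  [/\ M x, forall y, D y -> op_le y x &
      forall z, M z -> (forall y, D y -> op_le y z) -> op_le x z].

Definition op_directed D := D !=set0 /\
  forall x y, D x -> D y -> exists z, [/\ D z, op_le x z & op_le y z].

Definition op_span M : set (H -> H) :=
  [set x | exists (n : nat) (a : 'I_n -> R[i]) (y : 'I_n -> H -> H),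
    (forall i, M (y i)) /\ forall u, x u = \sum_(i < n) a i *: y i u].

Definition strong_closure M : set (H -> H) :=
  [set x | bounded_op x /\ forall (s : seq H) (e : R), 0 < e ->
    exists2 y, M y & {in s, forall u, hnorm (x u - y u) < e}].

End operators.

Record hilbertSpace (R : realType) := HilbertSpace {
  hs_sort :> lmodType R[i] ;
  hs_dot : {dot hs_sort for Num.Def.conjC} ;
  hs_complete : hcomplete hs_dot }.

(* M is meant to be a von Neumann algebra of operators on H, and the structure maps
   l and r, which give x xi := l x xi and xi x := r x xi, matter on M only. *)
Section bimodules.
Context (R : realType) (H : lmodType R[i]) (dot : {dot H for Num.Def.conjC}).
Variables (M : set (H -> H)) (K : hilbertSpace R).
Implicit Types (l r : (H -> H) -> K -> K).

(* Normality: suprema of bounded increasing nets of positive elements are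
   preserved. *)
Definition normal_map l := forall D x,
  (forall y, D y -> M y /\ op_le dot 0 y) -> op_directed dot D ->
  op_sup dot M D x -> op_sup (hs_dot K) (bounded_op (hs_dot K)) (l @` D) (l x).

Definition hilbert_module_map l :=
  [/\ forall x, M x -> bounded_op (hs_dot K) (l x),
      forall (a : R[i]) x y, M x -> M y ->
        l (a *: x + y) = a *: l x + l y,
      l idfun = idfun,
      forall x y, M x -> M y -> adjoint dot x y -> adjoint (hs_dot K) (l x) (l y) &
      normal_map l].

Definition left_module l := hilbert_module_map l /\
  forall x y, M x -> M y -> l (x \o y) = l x \o l y.

Definition right_module r := hilbert_module_map r /\
  forall x y, M x -> M y -> r (x \o y) = r y \o r x.

Definition bimodule l r := [/\ left_module l, right_module r &
  forall x y, M x -> M y -> l x \o r y = r y \o l x].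

Definition tracial (tau : (H -> H) -> R[i]) l r (xi : K) := forall x, M x ->
  hs_dot K (l x xi) xi = tau x /\ hs_dot K (r x xi) xi = tau x.

Definition central (B : set (H -> H)) l r (eta : K) :=
  forall b, B b -> l b eta = r b eta.

End bimodules.

Definition rigid_inclusion (R : realType) (H : lmodType R[i])
    (dot : {dot H for Num.Def.conjC}) (M B : set (H -> H))
    (tau : (H -> H) -> R[i]) :=
  forall e : R, 0 < e ->
  exists (F : set (H -> H)) (delta : R),
    [/\ finite_set F, F `<=` M, 0 < delta &
      forall (K : hilbertSpace R) (l r : (H -> H) -> K -> K) (xi : K),
        bimodule dot M l r -> hnorm (hs_dot K) xi = 1 -> tracial M tau l r xi ->
        (forall x, F x -> hnorm (hs_dot K) (l x xi - r x xi) <= delta) ->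
        exists2 eta : K, central B l r eta & hnorm (hs_dot K) (eta - xi) <= e].

Section relation_algebra.
Context d (X : measurableType d) (R : realType).
Variables (mu : probability X R) (E : set (X * X)).
Hypotheses (hX : standard_borel R X) (hE : cmp_relation mu E).

(* The von Neumann algebra L(E). *)
Definition rel_algebra : set (L2 (rel_measure hX hE) -> L2 (rel_measure hX hE)) :=
  strong_closure (@L2dot _ _ _ (rel_measure hX hE))
    (op_span [set x | exists (f : Linfty mu) (theta : full_group mu E),
      x = L2mul hX hE f \o L2translate hX hE theta]).

Definition Linfty_algebra :
    set (L2 (rel_measure hX hE) -> L2 (rel_measure hX hE)) :=
  [set L2mul hX hE f | f in [set: Linfty mu]].

Definition rel_trace (y : L2 (rel_measure hX hE) -> L2 (rel_measure hX hE)) : R[i] :=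
  L2dot (y (L2diag hX hE)) (L2diag hX hE).

Definition rigid_relation := rigid_inclusion
  (@L2dot _ _ _ (rel_measure hX hE)) rel_algebra Linfty_algebra rel_trace.

End relation_algebra.

Arguments rigid_relation {d X R mu E} hX hE.

(* Main.v *)
(* If R is not rigid, then for some e > 0 there are bimodules with tracial unit vectors xi_n that
   almost commute with L_{1_B} and u_theta for more and more elements B of a countable generating
   family and theta of the acting group, and have no central vector within e of xi_n.
   The bimeasure (A, B) |-> <1_A xi_n 1_B, xi_n> extends to a probability nu_n on X x X with marginals
   mu, and almost commutation gives nu_n (B x ~B) -> 0 and almost invariance of nu_n under
   theta x theta.  Projecting xi_n onto the diagonal yields an L^oo-central vector at distance
   at most nu_n (~Delta)^(1/2), so nu_n (~Delta) >= e^2.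

   Restricting nu_n to ~Delta and normalizing keeps both asymptotic properties, but the common
   marginal rho_n <= mu / e^2 need not be mu.  Its weak limit along an ultrafilter is invariant, hence mu
   by ergodicity.  A greedy choice of averages of the restrictions makes the density f of the
   marginal L^2-close to 1; reweighting by 1 / max (1, f) in each variable and adding a small product
   measure, which does not charge the diagonal because mu is non-atomic, restores the marginals
   exactly.  The resulting sequence contradicts the hypothesis. *)
Require Import Defs.
From HB Require Import structures.
From mathcomp Require Import all_boot all_order all_algebra.
From mathcomp Require Import all_classical all_reals all_analysis.
From mathcomp Require Import measurable_realfun complex sesquilinear ring lra.
Set Implicit Arguments.
Unset Strict Implicit.
Unset Printing Implicit Defensive.
Import Order.TTheory GRing.Theory Num.Theory numFieldNormedType.Exports.
Import ComplexField.Normc.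
Local Open Scope classical_set_scope.
Local Open Scope complex_scope.
Local Open Scope ring_scope.

Local Notation re := (@complex.Re _).
Local Notation im := (@complex.Im _).
Local Notation pr m A := (fine (m A)).

(** Positivity in the bimodule gives only a function of rectangles that is additive in each variable
    separately. In a general product such a bimeasure need not extend to a measure; the standard
    Borel structure supplies the compactness that makes it countably additive. Ergodicity yields
    only weak convergence of the marginals to [mu]. This does not bound their distance in total
    variation, so no small correction exists at that stage. Convex averages turn weak convergence
    into norm convergence, as in the Banach-Saks theorem. They are harmless because near invariance
    and small mass of B x ~B are convex conditions. A failure of rigidity controls finitely many
    operators at a time, so the sequence is controlled on countably many generators only. The
    passage to all bounded functions and to the whole full group rests on marginals that are exactly
    [mu]: the error of a truncation is then measured by [mu], uniformly in n. *)

Lemma measure_tail d (T : measurableType d) (R : realType) (m : {measure set T -> \bar R})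
    (F : nat -> set T) (e : R) : (m setT < +oo)%E -> (forall n, measurable (F n)) -> 0 < e ->
  exists n, (m (\bigcup_k F k `\` \bigcup_(k < n) F k) <= e%:E)%E.
Proof.
move=> mfin mF e0; pose G n := \bigcup_k F k `\` \bigcup_(k < n) F k.
have mG n : measurable (G n).
  by apply: measurableD; [exact: bigcup_measurable|exact: bigcup_measurable].
have nG : nonincreasing_seq G.
  move=> i j ij; apply/subsetPset; apply: setDS => z [k /= ki Fz].
  by exists k => //=; exact: leq_trans ij.
have m0 : (m (G 0%N) < +oo)%E by apply: le_lt_trans mfin; rewrite le_measure ?inE.
have := @nonincreasing_cvg_mu _ _ _ m G m0 mG; rewrite (_ : \bigcap_n _ = set0); last first.
  apply/seteqP; split=> // z H; have [[k _ Fkz] _] := H 0%N I.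
  by have [_ []] := H k.+1 I; exists k => /=.
rewrite measure0 => /(_ measurable0 nG) /fine_cvgP[[N _ hN] /cvgr0Pnorm_le/(_ _ e0)[n _ hn]].
exists (maxn N n).
have := hn (maxn N n) (leq_maxr _ _); rewrite /= ger0_norm ?fine_ge0// => h.
by rewrite -[leLHS]fineK ?lee_fin// hN//= leq_maxl.
Qed.

(** * Real-valued calculus of probabilities *)

Section probability_values.
Context d (T : measurableType d) (R : realType) (m : probability T R).

Lemma pr_ge0 A : 0 <= pr m A. Proof. by rewrite fine_ge0. Qed.

Lemma prT : pr m setT = 1. Proof. by rewrite probability_setT. Qed.

Lemma pr0 : pr m set0 = 0. Proof. by rewrite measure0. Qed.

Lemma prE A : measurable A -> m A = (pr m A)%:E.
Proof. by move=> mA; rewrite fineK// fin_num_measure. Qed.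

Lemma prU A B : measurable A -> measurable B -> A `&` B = set0 ->
  pr m (A `|` B) = pr m A + pr m B.
Proof. by move=> mA mB AB; rewrite measureU// fineD ?fin_num_measure. Qed.

Lemma pr_le A B : measurable A -> measurable B -> A `<=` B -> pr m A <= pr m B.
Proof.
by move=> mA mB AB; apply: fine_le; rewrite ?fin_num_measure// le_measure ?inE.
Qed.

Lemma pr_le1 A : measurable A -> pr m A <= 1.
Proof. by move=> mA; rewrite -prT pr_le. Qed.

Lemma prID A B : measurable A -> measurable B -> pr m A = pr m (A `&` B) + pr m (A `\` B).
Proof.
move=> mA mB; rewrite -prU//; [by rewrite setUIDK|exact: measurableI|exact: measurableD|].
by rewrite setDE setIACA setICr setI0.
Qed.

Lemma prC A : measurable A -> pr m (~` A) = 1 - pr m A.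
Proof. by move=> mA; rewrite -prT (prID measurableT mA) setTI setTD addrC addKr. Qed.

Lemma prU_le A B : measurable A -> measurable B -> pr m (A `|` B) <= pr m A + pr m B.
Proof.
move=> mA mB; rewrite -fineD ?fin_num_measure//; apply: fine_le.
- by rewrite fin_num_measure//; exact: measurableU.
- by rewrite fin_numD !fin_num_measure.
- exact: measureU2.
Qed.

Lemma prD A B : measurable A -> measurable B -> B `<=` A -> pr m (A `\` B) = pr m A - pr m B.
Proof. by move=> mA mB BA; rewrite (prID mA mB) (setIidr BA) addrC addKr. Qed.

Lemma pr_tail (F : nat -> set T) (e : R) : (forall n, measurable (F n)) -> 0 < e ->
  exists n, pr m (\bigcup_k F k `\` \bigcup_(k < n) F k) <= e.
Proof.
move=> mF e0; have mfin : (m setT < +oo)%E by rewrite ltey_eq fin_num_measure.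
have [n Hn] := measure_tail mfin mF e0; exists n.
rewrite -lee_fin -prE//; apply: measurableD; exact: bigcup_measurable.
Qed.

Lemma measure_bigcup_null (F : nat -> set T) : (forall k, measurable (F k)) ->
  (forall k, m (F k) = 0%E) -> m (\bigcup_k F k) = 0%E.
Proof.
move=> mF F0; apply/eqP; rewrite eq_le measure_ge0 andbT.
apply: (@le_trans _ _ (\sum_(k <oo) m (F k))%E).
  by apply: measure_sigma_subadditive => //; exact: bigcup_measurable.
by rewrite eseries0.
Qed.

End probability_values.

(** * Finitely additive set functions dominated by probabilities *)

Section dominated_content.
Context d (T : measurableType d) (R : realType) (m1 m2 : probability T R).
Variables (P : set T -> R) (C : R).
Hypothesis P_ge0 : forall A, measurable A -> 0 <= P A.
Hypothesis PU : forall A B, measurable A -> measurable B -> A `&` B = set0 ->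
  P (A `|` B) = P A + P B.
Hypothesis P_dom : forall A, measurable A -> P A <= C * (pr m1 A + pr m2 A).
Hypothesis PT : P setT = 1.

(** [P] is known to be non-negative on measurable sets only, whereas a measure must be so on every
    set; hence the truncation at 0. *)
Let Pe A : \bar R := (Num.max 0 (P A))%:E.

Let PeE A : measurable A -> Pe A = (P A)%:E.
Proof. by move=> mA; rewrite /Pe max_r// P_ge0. Qed.

Let P0 : P set0 = 0.
Proof.
by have := PU measurable0 measurable0 (setI0 set0); rewrite setU0 => /eqP; rewrite -subr_eq0 opprD addrA subrr sub0r oppr_eq0 => /eqP.
Qed.

Let Pe0 : Pe set0 = 0%E. Proof. by rewrite PeE// P0. Qed.
Let Pe_ge0 A : (0 <= Pe A)%E. Proof. by rewrite lee_fin le_max lexx. Qed.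

Let Pe_additive : semi_sigma_additive Pe.
Proof.
move=> F mF tF mUF.
have mU n : measurable (\bigcup_(k < n) F k) by exact: bigcup_measurable.
have sumE n : (\sum_(0 <= i < n) Pe (F i))%E = (P (\bigcup_(k < n) F k))%:E.
  elim: n => [|n IH]; first by rewrite big_nil bigcup_mkord big_ord0 P0.
  rewrite big_nat_recr//= IH (PeE (mF n)) -EFinD -PU//; last first.
    apply/seteqP; split=> // z [[k /= kn Fk] Fn].
    move/trivIsetP : tF => /(_ k n I I); rewrite (ltn_eqF kn) => /(_ isT).
    by move=> /seteqP[/(_ z)] H _; apply: H.
  congr (P _)%:E; rewrite !bigcup_mkord big_ord_recr//.
rewrite (_ : (fun n => _) = EFin \o (fun n => P (\bigcup_(k < n) F k))); last first.
  by apply/funext => n; rewrite sumE.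
rewrite PeE//; apply: cvg_EFin; first by near=> n.
apply/cvgrPdist_le => /= e e0.
(* [C] is not assumed positive; [D] is positive and at least [C], so it can be divided by. *)
pose D := `|C| + 1; have D0 : 0 < D by rewrite ltr_wpDl.
have e2 : 0 < e / (D * 2) by rewrite divr_gt0// mulr_gt0.
have [n1 H1] := pr_tail m1 mF e2; have [n2 H2] := pr_tail m2 mF e2.
near=> n.
have mTl : measurable (\bigcup_k F k `\` \bigcup_(k < n) F k) by exact: measurableD.
have -> : P (\bigcup_k F k) - P (\bigcup_(k < n) F k) = P (\bigcup_k F k `\` \bigcup_(k < n) F k).
  rewrite -[X in P X - _](@setDUK _ (\bigcup_(k < n) F k)); last by move=> z [k _ Fz]; exists k.
  rewrite PU//; first by rewrite addrC addKr.
  by rewrite setDE setICA setICr setI0.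
rewrite ger0_norm ?P_ge0//; apply: (le_trans (P_dom mTl)).
have tl (m : probability T R) k : (k <= n)%N -> pr m (\bigcup_k F k `\` \bigcup_(k < n) F k) <=
    pr m (\bigcup_k F k `\` \bigcup_(i < k) F i).
  move=> kn; apply: pr_le => //; first exact: measurableD.
  by apply: setDS => z [i /= ik Fz]; exists i => //=; exact: leq_trans kn.
have h1 : pr m1 (\bigcup_k F k `\` \bigcup_(k < n) F k) <= e / (D * 2).
  by apply: le_trans H1; apply: tl; near: n; exact: nbhs_infty_ge.
have h2 : pr m2 (\bigcup_k F k `\` \bigcup_(k < n) F k) <= e / (D * 2).
  by apply: le_trans H2; apply: tl; near: n; exact: nbhs_infty_ge.
apply: (@le_trans _ _ (D * (e / (D * 2) + e / (D * 2)))).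
  apply: (@le_trans _ _ (D * (pr m1 (\bigcup_k F k `\` \bigcup_(k < n) F k) + pr m2 (\bigcup_k F k `\` \bigcup_(k < n) F k)))).
    rewrite ler_wpM2r ?addr_ge0 ?pr_ge0// /D (le_trans (ler_norm _))// lerDl//.
  by rewrite ler_wpM2l ?(ltW D0)// lerD.
rewrite le_eqVlt; apply/orP; left; apply/eqP; field.
by rewrite gt_eqF.
Unshelve. all: end_near. Qed.

HB.instance Definition _ := isMeasure.Build _ _ _ Pe Pe0 Pe_ge0 Pe_additive.
Let PeT : Pe setT = 1%E. Proof. by rewrite PeE// PT. Qed.
HB.instance Definition _ := Measure_isProbability.Build _ _ _ Pe PeT.

(** Domination replaces countable additivity: the tail of a disjoint union is small for [m1] and
    [m2], hence for [P]. Ultralimits, restrictions, averages and marginal deficits all become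
    probabilities in this way; two dominating measures are allowed because some of these mix two. *)
Lemma dominated_probability : exists rho : probability T R,
  forall A, measurable A -> pr rho A = P A.
Proof. by exists Pe => A mA; exact: (congr1 fine (PeE mA)). Qed.

End dominated_content.

(** * Binary expansions of functions; complex moduli *)

Lemma geometric_le0 (R : realType) (x D : R) : (forall n, x <= 2^-1 ^+ n * D) -> x <= 0.
Proof.
move=> h; rewrite leNgt; apply/negP => x0.
have D0 : 0 <= D / x.
  by have := h 0%N; rewrite expr0 mul1r => xD; rewrite divr_ge0 ?ltW// (lt_le_trans x0).
have := archi_boundP D0; set n := Num.bound _ => Dn.
have := h n; rewrite exprVn mulrC ler_pdivlMr ?exprn_gt0//; apply/negP; rewrite -ltNge.
rewrite -ltr_pdivrMl// mulrC; apply: (lt_le_trans Dn).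
by rewrite -natrX ler_nat ltnW// ltn_expl.
Qed.

(** [A] carries the first binary digit of [h] and [h1] the shifted remaining expansion. Iterating
    this carries statements from sets to bounded functions with an error that halves at each
    step. *)
Lemma binary_digit (R : realType) d (T : measurableType d) (h : T -> R) :
  measurable_fun setT h -> (forall x, 0 <= h x <= 1) ->
  exists (A : set T) (h1 : T -> R), [/\ measurable A, measurable_fun setT h1,
    forall x, 0 <= h1 x <= 1 & h = fun x => 2^-1 * (\1_A x + h1 x)].
Proof.
move=> mh h01; pose A := [set x | 2^-1 <= h x].
have mA : measurable A.
  by rewrite -[A]setTI; apply: measurable_fun_le => //; exact: measurable_cst.
exists A, (fun x => 2 * h x - \1_A x); split=> //.
- by apply: measurable_funB; [exact: measurable_funM|exact: measurable_indic].
- move=> x; have /andP[a0 a1] := h01 x; rewrite indicE; have [Ax|NAx] := pselect (A x).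
    by rewrite mem_set//; move: Ax; rewrite /A/= => a2; apply/andP; split; lra.
  rewrite memNset//; move/negP: NAx; rewrite /A/= -ltNge => a2.
  by apply/andP; split; lra.
- by apply/funext => x; rewrite addrC subrK mulKf.
Qed.

Section complex_modulus.
Context (R : realType).

Lemma normc_ge0 (z : R[i]) : 0 <= normc z.
Proof. by case: z => ? ?; exact: sqrtr_ge0. Qed.

Lemma normc_le (z : R[i]) : normc z <= `|re z| + `|im z|.
Proof.
rewrite -(@ler_pXn2r _ 2)// ?nnegrE ?addr_ge0 ?normc_ge0// normc2 sqrrD.
rewrite !real_normK ?num_real// addrAC lerDl mulrn_wge0// mulr_ge0//.
Qed.

Lemma re_le_normc (z : R[i]) : `|re z| <= normc z.
Proof.
by rewrite -(@ler_pXn2r _ 2)// ?nnegrE ?normc_ge0// normc2 real_normK ?num_real// lerDl sqr_ge0.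
Qed.

Lemma im_le_normc (z : R[i]) : `|im z| <= normc z.
Proof.
by rewrite -(@ler_pXn2r _ 2)// ?nnegrE ?normc_ge0// normc2 real_normK ?num_real// lerDr sqr_ge0.
Qed.

End complex_modulus.

Lemma cmeasurable_comp (R : realType) d d' (X : measurableType d) (T : measurableType d')
    (phi : T -> X) (f : X -> R[i]) :
  measurable_fun setT phi -> cmeasurable f -> cmeasurable (fun z => f (phi z)).
Proof.
move=> mphi [f1 f2]; split.
- by rewrite (_ : _ \o _ = (re \o f) \o phi)//; exact: measurableT_comp.
- by rewrite (_ : _ \o _ = (im \o f) \o phi)//; exact: measurableT_comp.
Qed.

Definition pair_map (X : Type) (t : X -> X) (z : X * X) : X * X := (t z.1, t z.2).

Lemma measurable_pair_map d (X : measurableType d) (t : X -> X) : measurable_fun setT t ->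
  measurable_fun setT (pair_map t).
Proof.
by move=> mt; apply: measurable_fun_pair; exact: measurableT_comp.
Qed.

Lemma measurable_pair_preimage d (X : measurableType d) (t : X -> X) (S : set (X * X)) : measurable_fun setT t ->
  measurable S -> measurable (pair_map t @^-1` S).
Proof.
by move=> mt mS; rewrite -[X in measurable X]setTI; exact: measurable_pair_map.
Qed.

Lemma preimageD (T1 T2 : Type) (f : T1 -> T2) (A B : set T2) :
  f @^-1` (A `\` B) = f @^-1` A `\` f @^-1` B.
Proof. by []. Qed.

(** * Regularity and tightness on Polish spaces *)

Section polish_regularity.
Context (R : realType) d (X : measurableType d) (mu : probability X R).
Context (P : completePseudoMetricType R) (f : X -> P).
Hypothesis mO : forall U : set P, open U -> measurable (f @^-1` U).

Lemma preimage_closed_measurable (F : set P) : closed F -> measurable (f @^-1` F).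
Proof.
move=> cF; by rewrite -[F]setCK -preimage_setC; apply: measurableC; exact: (mO (closed_openC cF)).
Qed.

(** Inner and outer approximation are required together, which makes the condition symmetric under
    complements and the regular sets a sigma-algebra. *)
Definition regular_set (S : set P) := measurable (f @^-1` S) /\
  forall e : R, 0 < e -> exists U F : set P, [/\ open U, closed F, F `<=` S, S `<=` U &
    (mu (f @^-1` (U `\` F)) <= e%:E)%E].

Lemma regular_setC S : regular_set S -> regular_set (~` S).
Proof.
move=> [mS h]; split; first by rewrite -preimage_setC; exact: measurableC.
move=> e /h[U [F [oU cF FS SU UF]]]; exists (~` F), (~` U); split.
- exact: closed_openC.
- exact: open_closedC.
- exact: subsetC.
- exact: subsetC.
- by rewrite setDE setCK setIC -setDE.
Qed.

(** The closures stay inside [U]: a point of the closure has some y of [G n] within 1/(n+1), and so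
    lies in the ball about y, which is contained in [U]. *)
Lemma open_closed_cover (U : set P) : open U ->
  exists F : nat -> set P, [/\ forall n, closed (F n), nondecreasing_seq F & U = \bigcup_n F n].
Proof.
move=> oU; pose G n := [set x : P | ball x (n.+1%:R^-1 : R) `<=` U].
exists (fun n => closure (G n)); split.
- by move=> n; exact: closed_closure.
- move=> m n mn; apply/subsetPset; apply: closure_subset => x; apply: subset_trans.
  by apply: le_ball; rewrite lef_pV2 ?posrE// ler_nat.
- apply/seteqP; split=> x.
    move=> Ux; have /nbhs_ballP[e/= e0 eU] : nbhs x U by exact: open_nbhs_nbhs.
    have [n nlt] := ltr_add_invr e0; rewrite add0r in nlt.
    exists n => //; apply: subset_closure => /=; apply: subset_trans eU.
    by apply: le_ball; exact: ltW.
  move=> [n _ /(_ (ball x (n.+1%:R^-1)))[|y [/= yU xy]]].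
    exact: nbhsx_ballx.
  by apply: yU; exact: ball_sym.
Qed.

Lemma mu_bigcup_ge (F : nat -> set X) (e : R) : (forall n, measurable (F n)) ->
  nondecreasing_seq F -> 0 < e -> exists n, (mu (\bigcup_k F k `\` F n) <= e%:E)%E.
Proof.
move=> mF ndF e0; have mfin : (mu setT < +oo)%E by rewrite ltey_eq fin_num_measure.
have mU : measurable (\bigcup_k F k) by exact: bigcup_measurable.
have [n Hn] := measure_tail mfin mF e0; exists n; apply: le_trans Hn.
rewrite le_measure ?inE//; try apply: measurableD => //; first exact: bigcup_measurable.
apply: setDS => z [k /= kn Fkz]; have /subsetPset := ndF _ _ (ltnW kn); exact.
Qed.

Lemma regular_open U : open U -> regular_set U.
Proof.
move=> oU; split; first exact: mO.
move=> e e0; have [F [cF ndF UE]] := open_closed_cover oU.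
have [n|||n Hn] := @mu_bigcup_ge (fun n => f @^-1` F n) e.
- exact: preimage_closed_measurable.
- by move=> m n mn; apply/subsetPset => x; have /subsetPset := ndF _ _ mn; exact.
- exact: e0.
exists U, (F n); split => //.
  by rewrite UE; exact: bigcup_sup.
by rewrite preimageD UE preimage_bigcup.
Qed.

Lemma regular_bigcup (S : nat -> set P) : (forall n, regular_set (S n)) ->
  regular_set (\bigcup_n S n).
Proof.
move=> rS; split.
  by rewrite preimage_bigcup; apply: bigcup_measurable => k _; exact: (rS k).1.
move=> e e0.
(* Half of [e] is spread geometrically over the approximations; the other half pays for keeping
   finitely many of the closed sets, since a countable union of closed sets need not be closed. *)
pose de n : R := e / 2 / (2 ^ n.+1)%:R.
have de0 n : 0 < de n by rewrite /de !divr_gt0// ltr0n expn_gt0.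
have /choice[U /choice[F UF]] n := (rS n).2 _ (de0 n).
have oU n : open (U n) by case: (UF n).
have cF n : closed (F n) by case: (UF n).
have mU n : measurable (f @^-1` U n) by exact: mO.
have mF n : measurable (f @^-1` F n) by exact: preimage_closed_measurable.
pose G n := \bigcup_(k < n) F k.
have mG n : measurable (f @^-1` G n).
  by rewrite preimage_bigcup; apply: bigcup_measurable.
have GE : \bigcup_n (f @^-1` G n) = f @^-1` (\bigcup_n F n).
  apply/seteqP; split=> x; first by move=> [n _ [k _ Fk]]; exists k.
  by move=> [k _ Fk]; exists k.+1 => //; exists k => //=.
have [n|||n Hn] := @mu_bigcup_ge (fun n => f @^-1` G n) (e / 2).
- exact: mG.
- move=> m n mn; apply/subsetPset => x [k /= km Fk]; exists k => //=.
  exact: leq_trans mn.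
- by rewrite divr_gt0.
exists (\bigcup_n U n), (G n); split.
- exact: bigcup_open.
- exact: (closed_bigcup (finite_II n) (fun k _ => cF k)).
- by move=> x [k _ Fk]; exists k => //; case: (UF k) => _ _ + _ _; exact.
- by move=> x [k _ Sk]; exists k => //; case: (UF k) => _ _ _ + _; exact.
have mUF m : measurable (f @^-1` (U m `\` F m)).
  by rewrite preimageD; exact: measurableD.
have mbF : measurable (f @^-1` (\bigcup_n F n)).
  by rewrite preimage_bigcup; exact: bigcup_measurable.
have mb : measurable (\bigcup_k (f @^-1` (U k `\` F k))) by exact: bigcup_measurable.
have mD : measurable (f @^-1` (\bigcup_n F n) `\` f @^-1` G n) by exact: measurableD.
apply: (@le_trans _ _ (mu ((\bigcup_k (f @^-1` (U k `\` F k))) `|`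
    (f @^-1` (\bigcup_n F n) `\` f @^-1` G n)))).
  rewrite le_measure ?inE//.
  - rewrite preimageD preimage_bigcup; apply: measurableD => //.
    exact: bigcup_measurable.
  - exact: measurableU.
  - move=> x [[k _ Uk] NG]; have [bF|NbF] := pselect ((\bigcup_n F n) (f x)).
      by right.
    by left; exists k => //; split=> // Fk; apply: NbF; exists k.
apply: (@le_trans _ _ (mu (\bigcup_k (f @^-1` (U k `\` F k))) +
    mu (f @^-1` (\bigcup_n F n) `\` f @^-1` G n))%E).
  exact: measureU2.
rewrite [e in (_ <= e%:E)%E]splitr EFinD; apply: leeD; last first.
  by move: Hn; rewrite GE.
apply: (@le_trans _ _ (\sum_(k <oo) mu (f @^-1` (U k `\` F k)))%E).
  exact: measure_sigma_subadditive.
apply: le_trans (epsilon_trick0 xpredT _); last by rewrite divr_ge0// ltW.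
by apply: lee_nneseries => // k _; case: (UF k).
Qed.

Lemma regular_borel (S : set P) : <<s [set U : set P | open U] >> S -> regular_set S.
Proof.
apply: smallest_sub; last by move=> U; exact: regular_open.
split.
- by apply: regular_open; exact: open0.
- by move=> A rA; rewrite setTD; exact: regular_setC.
- exact: regular_bigcup.
Qed.

(** Ulam's argument: at each scale finitely many closed balls cover all but a geometrically small
    mass. The intersection over the scales is closed and totally bounded, hence compact by
    completeness. *)
Lemma tightness (D : set P) (e : R) : countable D -> dense D -> 0 < e ->
  exists C : set P, [/\ compact C, measurable (f @^-1` C) & (mu (f @^-1` (~` C)) <= e%:E)%E].
Proof.
move=> /pfcard_geP[D0|[g]] dD e0.
  have [|x []] := dD setT _ openT.
    by exists (f point).
  by rewrite D0.
have Dg n : D (g n) by exact: funS.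
pose B j k := closure (ball (g k) (j.+1%:R^-1 : R)).
have j0 (j : nat) : (0 < j.+1%:R^-1 :> R) by [].
have Bcov j x : exists k, B j k x.
  have [|p [/= xp Dp]] := dD (ball x j.+1%:R^-1)° _ (open_interior _).
    by exists x; apply: nbhs_singleton; apply: nbhs_interior; exact: nbhsx_ballx.
  have [k _ gk] : (g @` setT) p by rewrite image_eq.
  exists k; apply: subset_closure; rewrite gk; apply: ball_sym.
  exact: interior_subset xp.
have mB j k : measurable (f @^-1` B j k).
  by apply: preimage_closed_measurable; exact: closed_closure.
pose U j n := \bigcup_(k < n) B j k.
have cU j n : closed (U j n).
  exact: (closed_bigcup (finite_II n) (fun k _ => @closed_closure _ _)).
have mU j n : measurable (f @^-1` U j n) by exact: preimage_closed_measurable.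
have de0 j : 0 < e / (2 ^ j.+1)%:R by rewrite divr_gt0// ltr0n expn_gt0.
have /choice[N HN] j : exists n, (mu (f @^-1` (~` U j n)) <= (e / (2 ^ j.+1)%:R)%:E)%E.
  have [n|||n Hn] := @mu_bigcup_ge (fun n => f @^-1` U j n) (e / (2 ^ j.+1)%:R).
  - exact: mU.
  - by move=> m n mn; apply/subsetPset => x [k /= km Fk]; exists k => //=; exact: leq_trans mn.
  - exact: de0.
  exists n; move: Hn; rewrite (_ : \bigcup_k _ = setT) ?setTD//.
  apply/seteqP; split=> // x _; have [k Bk] := Bcov j (f x).
  by exists k.+1 => //; exists k => /=.
exists (\bigcap_j U j (N j)); split.
- have clC : closed (\bigcap_j U j (N j)) by apply: closed_bigI => j _; exact: cU.
  (* At each scale an ultrafilter containing the intersection picks one of the finitely many balls;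
     it is therefore Cauchy, and it converges to a point of the closed intersection. *)
  rewrite compact_ultra => F UF FC.
  have Fball j : exists k, F (B j k).
    have : F (U j (N j)) by apply: filterS FC => x; apply.
    elim: (N j) => [|n IH]; rewrite /U.
      by rewrite bigcup_mkord big_ord0 => /filter_not_empty.
    move=> FU; have [|Fn] := in_ultra_setVsetC (B j n) UF; first by exists n.
    apply: IH; apply: filterS2 FU Fn => x [k /=]; rewrite ltnS leq_eqVlt => /orP[/eqP->//|kn Bk _].
    by exists k.
  have /cauchy_cvg : cauchy F.
    apply/cauchy_exP => _/posnumP[r].
    have [j nlt] := ltr_add_invr [gt0 of r%:num / 2]; rewrite add0r in nlt.
    have [k Fk] := Fball j; exists (g k); apply: filterS Fk => x.
    move=> /(_ (ball x (r%:num / 2)))[|y [/= gy xy]]; first exact: nbhsx_ballx.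
    rewrite [r%:num]splitr; apply: (@ball_triangle _ _ y); last exact: ball_sym.
    by apply: le_ball gy; exact: ltW.
  move=> Fl; exists (lim F); split=> //.
  exact: (closed_cvg (u_ := id) _ clC FC _ Fl).
- by rewrite preimage_bigcap; exact: bigcap_measurable.
- rewrite -preimage_setC preimage_bigcap setC_bigcap.
  have mUC j : measurable (~` (f @^-1` U j (N j))) by exact: measurableC.
  apply: (@le_trans _ _ (\sum_(j <oo) mu (~` (f @^-1` U j (N j))))%E).
    by apply: measure_sigma_subadditive => //; exact: bigcup_measurable.
  apply: le_trans (epsilon_trick0 xpredT _); last exact: ltW.
  by apply: lee_nneseries => // k _; exact: HN.
Qed.

End polish_regularity.

(** * Countable generators and finite covers by rectangles *)

Section standard_borel.
Context (R : realType) d (X : measurableType d).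
Hypothesis hX : standard_borel R X.

(** Interiors of balls of radius 1/(j+1) about a dense sequence form a base. They generate the Borel
    sets because every open set is a countable union of them, and they separate points because the
    space is Hausdorff. *)
Lemma standard_borel_generator : exists B : nat -> set X,
  [/\ forall n, measurable (B n),
      measurable `<=` <<s range B >> &
      forall x y, (forall n, B n x <-> B n y) -> x = y].
Proof.
have [P [f [hP [D cD dD] bf mf]]] := hX.
have [g [Dg gD]] : exists g : nat -> P, (forall n, D (g n)) /\ D `<=` range g.
  move: cD => /pfcard_geP[D0|[g]].
    have [|x []] := dD setT _ openT; first by exists (f point).
    by rewrite D0.
  by exists g; split=> [n|]; [exact: funS|rewrite image_eq].
pose V (p : nat * nat) := (ball (g p.1) (p.2.+1%:R^-1 : R))°.
pose B n := if (unpickle n : option (nat * nat)%type) is Some p then f @^-1` V p else set0.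
have BV p : B (pickle p) = f @^-1` V p by rewrite /B pickleK.
have mO (U : set P) : open U -> measurable (f @^-1` U).
  by move=> oU; apply/mf; exact: sub_gen_smallest.
have base (U : set P) p : open U -> U p -> exists n, V n p /\ V n `<=` U.
  move=> oU Up; have /nbhs_ballP[e/= e0 eU] : nbhs p U by exact: open_nbhs_nbhs.
  have e20 : 0 < e / 2 by rewrite divr_gt0.
  have [j jlt] := ltr_add_invr e20; rewrite add0r in jlt.
  have j0 : (0 < j.+1%:R^-1 :> R) by [].
  have bp : nbhs p (ball p (j.+1%:R^-1 / 2)) by apply: nbhsx_ballx; rewrite divr_gt0.
  have [|q [/= /interior_subset pq Dq]] := dD (ball p (j.+1%:R^-1 / 2))° _ (open_interior _).
    by exists p; apply: nbhs_singleton; exact: nbhs_interior.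
  have [k _ gk] := gD _ Dq; exists (k, j); rewrite /V/= gk; split.
    rewrite /interior/=; apply/nbhs_ballP; exists (j.+1%:R^-1 / 2); first by rewrite /= divr_gt0.
    by move=> z pz; rewrite [_^-1]splitr; exact: ball_triangle (ball_sym pq) pz.
  move=> z /interior_subset qz; apply: eU.
  have jj : (j.+1%:R^-1 / 2 <= e / 2 :> R).
    by rewrite ler_pM2r ?invr_gt0// ltW// (lt_le_trans jlt)// ler_pdivrMr// ler_peMr// ?ltW// ltr1n.
  rewrite [e]splitr; apply: (@ball_triangle _ _ q); first exact: le_ball jj _ pq.
  by apply: le_ball qz; exact: ltW.
exists B; split.
- move=> n; rewrite /B; case: (unpickle _) => [p|] //.
  by apply: mO; exact: open_interior.
- move=> A mA; have sB : sigma_algebra setT <<s range B >> by exact: smallest_sigma_algebra.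
  suff H S : <<s [set U : set P | open U] >> S -> <<s range B >> (f @^-1` S).
    have -> : A = f @^-1` (f @` A).
      apply/seteqP; split=> [x Ax|x [y Ay /(bij_inj bf) <-]]//.
      by exists x.
    apply: H; apply/mf; rewrite (_ : f @^-1` _ = A)//.
    by apply/seteqP; split=> [x [y Ay /(bij_inj bf) <-]|x Ax]//; exists x.
  move: S; apply: smallest_sub.
    case: sB => s0 sC sU; split=> //=.
    + by move=> S /= sS; rewrite setTD -preimage_setC -setTD; exact: sC.
    + by move=> S sS /=; rewrite preimage_bigcup; exact: sU.
  move=> U /= oU.
  rewrite (_ : f @^-1` U = \bigcup_n (if `[< B n `<=` f @^-1` U >] then B n else set0)).
    case: sB => s0 sC sU; apply: sU => n; case: ifPn => // _.
    by apply: sub_sigma_algebra; exists n.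
  apply/seteqP; split=> [x Ux|x [n _]]; last by case: ifPn => // /asboolP; exact.
  have [p [Vp VU]] := base _ _ oU Ux.
  exists (pickle p) => //; rewrite BV ifT//; apply/asboolP => y; exact: VU.
- move=> x y xy; apply: (bij_inj bf); apply: hP => S T.
  move=> Sx Ty; have [|p [Vp VS]] := base S° (f x) (@open_interior _ _).
    by apply: nbhs_singleton; exact: nbhs_interior.
  exists (f y); split; last exact: nbhs_singleton.
  apply: interior_subset; apply: VS.
  by move/(_ (pickle p)): xy; rewrite BV => -[+ _]; exact.
Qed.

(** This compactness step is what makes bimeasures countably additive. The sides of the rectangles
    are enlarged to open sets by outer regularity; tightness gives a compact set of almost full
    measure, and finitely many of the open rectangles cover its square. *)
Lemma rectangle_cover (mu : probability X R) (A B : nat -> set X) (e : R) : 0 < e ->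
  (forall k, measurable (A k)) -> (forall k, measurable (B k)) ->
  (forall x y, exists k, A k x /\ B k y) ->
  exists (A' B' : nat -> set X) (C : set X) (N : nat),
    [/\ forall k, [/\ measurable (A' k), A k `<=` A' k &
          (mu (A' k `\` A k) <= (e / (2 ^ k.+1)%:R)%:E)%E],
        forall k, [/\ measurable (B' k), B k `<=` B' k &
          (mu (B' k `\` B k) <= (e / (2 ^ k.+1)%:R)%:E)%E],
        measurable C, (mu (~` C) <= e%:E)%E &
        forall x y, C x -> C y -> exists2 k, (k < N)%N & A' k x /\ B' k y].
Proof.
have [P [f [hP [D cD dD] bf mf]]] := hX.
move=> e0 mA mB AB.
have mO (U : set P) : open U -> measurable (f @^-1` U).
  by move=> oU; apply/mf; exact: sub_gen_smallest.
have fK (S : set X) : f @^-1` (f @` S) = S.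
  by apply/seteqP; split=> [x [y Ay /(bij_inj bf) <-]|x Ax]//; exists x.
have fS (S : set P) : f @` (f @^-1` S) = S.
  apply/seteqP; split=> [_ [y Ay <-]|x Ax]//; have [g fg gf] := bf.
  by exists (g x); rewrite /= gf.
have de0 k : 0 < e / (2 ^ k.+1)%:R by rewrite divr_gt0// ltr0n expn_gt0.
have outer (S : nat -> set X) : (forall k, measurable (S k)) ->
    exists U : nat -> set P, forall k, [/\ open (U k), S k `<=` f @^-1` U k &
      (mu (f @^-1` U k `\` S k) <= (e / (2 ^ k.+1)%:R)%:E)%E].
  move=> mS; suff /choice[U HU] : forall k, exists U : set P, [/\ open U, S k `<=` f @^-1` U &
      (mu (f @^-1` U `\` S k) <= (e / (2 ^ k.+1)%:R)%:E)%E] by exists U.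
  move=> k; have rS : regular_set mu f (f @` S k).
    by apply: regular_borel => //; apply/mf; rewrite fK.
  have [U [F [oU cF FS SU UF]]] := rS.2 _ (de0 k).
  exists U; split=> //; first by move=> x Sx; apply: SU; exists x.
  apply: le_trans UF; rewrite le_measure ?inE//.
  - by apply: measurableD => //; exact: mO.
  - rewrite preimageD; apply: measurableD; first exact: mO.
    exact: preimage_closed_measurable.
  - move=> x [Ux NSx]; split=> // /FS [y Sy /(bij_inj bf) yx].
    by apply: NSx; rewrite -yx.
have [U HU] := outer _ mA; have [V HV] := outer _ mB.
have [C [cC mC HC]] := tightness mu mO cD dD e0.
have openX (U1 V1 : set P) : open U1 -> open V1 -> open (U1 `*` V1).
  move=> oU oV; rewrite openE => -[x y] [Ux Vy]; exists (U1, V1) => //=.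
  by split; apply: open_nbhs_nbhs.
have : compact (C `*` C) by exact: compact_setX.
(* Near each point of the square, some rectangle of index below n contains the nearby points once n
   is large; compactness gives one such n for the whole square. *)
move=> /compact_near_coveringP/(_ nat \oo
  (fun n z => exists2 k, (k < n)%N & (U k `*` V k) z)) [].
  move=> [x y] _; have [g fg gf] := bf; have [k [Akx Bky]] := AB (g x) (g y).
  have Uxy : (U k `*` V k) (x, y).
    split=> /=.
    + by case: (HU k) => _ /(_ _ Akx)/=; rewrite gf.
    + by case: (HV k) => _ /(_ _ Bky)/=; rewrite gf.
  exists (U k `*` V k, [set n | (k < n)%N]).
    split=> /=; last by exists k.+1.
    by apply: open_nbhs_nbhs; split=> //; apply: openX; [case: (HU k)|case: (HV k)].
  by move=> [z n] [/= Uz kn]; exists k.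
move=> N _ /(_ N (leqnn _)) CN.
exists (fun k => f @^-1` U k), (fun k => f @^-1` V k), (f @^-1` C).
exists N; split=> //.
- by move=> k; case: (HU k) => oU *; split=> //; exact: mO.
- by move=> k; case: (HV k) => oV *; split=> //; exact: mO.
- move=> x y Cx Cy; have [|k /= kF [Ukx Vky]] := CN (f x, f y); first by [].
  by exists k.
Qed.

End standard_borel.

Lemma sum_geometric_half (R : realFieldType) (e : R) n : 
  \sum_(k < n) e / (2 ^ k.+1)%:R = e - e / (2 ^ n)%:R.
Proof.
elim: n => [|n IH]; first by rewrite big_ord0 expn0 divr1 subrr.
rewrite big_ord_recr/= IH expnS natrM.
have : (2 ^ n)%:R != 0 :> R by rewrite pnatr_eq0 expn_eq0.
by move=> h; field.
Qed.

(** * Extension of bimeasures to measures *)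

Section bimeasure.
Context (R : realType) d (X : measurableType d) (mu : probability X R).
Hypothesis hX : standard_borel R X.
Variable m : set X -> set X -> R.
Hypothesis m_ge0 : forall A B, measurable A -> measurable B -> 0 <= m A B.
Hypothesis m_splitl : forall A B U, measurable A -> measurable B -> measurable U ->
  m A B = m (A `&` U) B + m (A `\` U) B.
Hypothesis m_splitr : forall A B U, measurable A -> measurable B -> measurable U ->
  m A B = m A (B `&` U) + m A (B `\` U).
Hypothesis m_setTr : forall A, measurable A -> m A setT = fine (mu A).
Hypothesis m_setTl : forall B, measurable B -> m setT B = fine (mu B).

Let m0l B : measurable B -> m set0 B = 0.
Proof.
move=> mB; have := @m_splitl set0 B set0 measurable0 mB measurable0.
by rewrite set0I set0D; lra.
Qed.

Let m0r B : measurable B -> m B set0 = 0.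
Proof.
move=> mB; have := @m_splitr B set0 set0 mB measurable0 measurable0.
by rewrite set0I set0D; lra.
Qed.

Let m_lel A A' B : measurable A -> measurable A' -> measurable B -> A `<=` A' ->
  m A B <= m A' B.
Proof.
move=> mA mA' mB AA'; rewrite (m_splitl mA' mB mA) (_ : A' `&` A = A).
  by rewrite lerDl m_ge0//; exact: measurableD.
by rewrite setIC; exact: setIidl.
Qed.

Let m_ler A B B' : measurable A -> measurable B -> measurable B' -> B `<=` B' ->
  m A B <= m A B'.
Proof.
move=> mA mB mB' BB'; rewrite (m_splitr mA mB' mB) (_ : B' `&` B = B).
  by rewrite lerDl m_ge0//; exact: measurableD.
by rewrite setIC; exact: setIidl.
Qed.

Let mT : m setT setT = 1.
Proof. by rewrite m_setTr// probability_setT. Qed.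

(** The last rectangle is peeled off by splitting [C] along [A n], and [D] along [B n] over the part
    inside [A n]. The two other pieces are covered by the first n rectangles, and their
    contributions recombine because [m] is additive in each variable. *)
Let m_finite_cover n (A B : nat -> set X) (C D : set X) :
  (forall k, measurable (A k)) -> (forall k, measurable (B k)) ->
  measurable C -> measurable D ->
  (forall x y, C x -> D y -> exists2 k, (k < n)%N & A k x /\ B k y) ->
  m C D <= \sum_(k < n) m (C `&` A k) (D `&` B k).
Proof.
move=> mA mB; elim: n C D => [|n IH] C D mC mD CD.
  rewrite big_ord0; have [->|/set0P[x Cx]] := eqVneq C set0; first by rewrite m0l.
  have [->|/set0P[y Dy]] := eqVneq D set0; first by rewrite m0r.
  by have [] := CD _ _ Cx Dy.
rewrite big_ord_recr/=.
have mCI := measurableI _ _ mC (mA n); have mCD := measurableD mC (mA n).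
have mDI := measurableI _ _ mD (mB n); have mDD := measurableD mD (mB n).
rewrite (m_splitl mC mD (mA n)) (m_splitr mCI mD (mB n)).
have IH1 : m (C `&` A n) (D `\` B n) <=
    \sum_(k < n) m (C `&` A n `&` A k) ((D `\` B n) `&` B k).
  apply: IH => // x y [Cx Anx] [Dy NBny]; have [k + [Akx Bky]] := CD _ _ Cx Dy.
  by rewrite ltnS leq_eqVlt => /orP[/eqP kn|kn]; [move: Bky; rewrite kn|exists k].
have IH2 : m (C `\` A n) D <= \sum_(k < n) m ((C `\` A n) `&` A k) (D `&` B k).
  apply: IH => // x y [Cx NAnx] Dy; have [k + [Akx Bky]] := CD _ _ Cx Dy.
  by rewrite ltnS leq_eqVlt => /orP[/eqP kn|kn]; [move: Akx; rewrite kn|exists k].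
have : \sum_(k < n) m (C `&` A n `&` A k) ((D `\` B n) `&` B k) +
       \sum_(k < n) m ((C `\` A n) `&` A k) (D `&` B k) <=
       \sum_(k < n) m (C `&` A k) (D `&` B k).
  rewrite -big_split/=; apply: ler_sum => k _.
  have mCk := measurableI _ _ mC (mA k); have mDk := measurableI _ _ mD (mB k).
  rewrite (m_splitl mCk mDk (mA n)).
  rewrite setIAC (_ : (C `\` A n) `&` A k = (C `&` A k) `\` A n); last first.
    by rewrite !setDE setIAC.
  rewrite lerD2r; apply: m_ler; try exact: measurableI.
  by move=> y [[]].
by lra.
Qed.

(** [mu_ext] takes covers by arbitrary measurable sets. Charging each of them with the cheapest
    single rectangle around it amounts to covering by rectangles. *)
Let mt (S : set (X * X)) : \bar R := ereal_inf [set (m AB.1 AB.2)%:E |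
  AB in [set AB : set X * set X | [/\ measurable AB.1, measurable AB.2 & S `<=` AB.1 `*` AB.2]]].

Let mt_ge0 S : (0 <= mt S)%E.
Proof.
by apply: le_ereal_inf_tmp => _ [[A B] /= [mA mB _] <-]; rewrite lee_fin m_ge0.
Qed.

Let mt_le A B S : measurable A -> measurable B -> S `<=` A `*` B -> (mt S <= (m A B)%:E)%E.
Proof. by move=> mA mB SAB; apply: ereal_inf_lbound; exists (A, B). Qed.

Let mt0 : mt set0 = 0%E.
Proof.
by apply/eqP; rewrite eq_le mt_ge0 andbT -[0%E]/(0%:E) -(m0l measurable0) mt_le.
Qed.

Let mt_fin S : mt S \is a fin_num.
Proof.
rewrite ge0_fin_numE; last exact: mt_ge0.
by apply: (@le_lt_trans _ _ (m setT setT)%:E); [rewrite mt_le|rewrite ltry].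
Qed.

Let mt_approx S (e : R) : 0 < e -> exists AB : set X * set X,
  [/\ measurable AB.1, measurable AB.2, S `<=` AB.1 `*` AB.2 &
    m AB.1 AB.2 <= fine (mt S) + e].
Proof.
move=> e0; have [_ [AB [mA mB SAB] <-] H] := lb_ereal_inf_adherent e0 (mt_fin S).
exists AB; split=> //; apply: ltW; rewrite -lte_fin EFinD fineK//; exact: mt_fin.
Qed.

Let nus := mu_ext mt.

HB.instance Definition _ := isOuterMeasure.Build R (X * X)%type nus
  (mu_ext0 mt0 mt_ge0) (mu_ext_ge0 mt_ge0) (le_mu_ext mt)
  (mu_ext_sigma_subadditive mt_ge0).

Let nus_le A B : measurable A -> measurable B -> (nus (A `*` B) <= (m A B)%:E)%E.
Proof.
move=> mA mB; apply: (@le_trans _ _ (mt (A `*` B))); last exact: mt_le.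
apply: ereal_inf_lbound; exists (fun k => if k is 0%N then A `*` B else set0).
  split=> [[|k]//|z ABz]; last by exists 0%N.
  exact: measurableX.
rewrite nneseries_recl// eseries0 ?adde0// => -[//|k] _ _.
by rewrite mt0.
Qed.

(** The condition of Caratheodory reduces to one rectangle at a time: if [Q] splits every rectangle
    into two at no extra cost, then it splits every cover term by term. *)
Let cara_split (Q : set (X * X)) : measurable Q ->
  (forall A B, measurable A -> measurable B -> exists A1 B1 A2 B2,
    [/\ [/\ measurable A1, measurable B1, measurable A2 & measurable B2],
       A `*` B `&` Q `<=` A1 `*` B1, A `*` B `&` ~` Q `<=` A2 `*` B2 &
       m A1 B1 + m A2 B2 <= m A B]) -> caratheodory_measurable nus Q.
Proof.
move=> mQ HQ; apply: le_caratheodory_measurable => S.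
apply: le_ereal_inf_tmp => _ [F [mF SF] <-].
have step T : (mt (T `&` Q) + mt (T `&` ~` Q) <= mt T)%E.
  apply: le_ereal_inf_tmp => _ [[A B] /= [mA mB TAB] <-].
  have [A1 [B1 [A2 [B2 [[mA1 mB1 mA2 mB2] Q1 Q2 mm]]]]] := HQ _ _ mA mB.
  apply: (@le_trans _ _ ((m A1 B1)%:E + (m A2 B2)%:E)%E); last by rewrite -EFinD lee_fin.
  apply: leeD; apply: mt_le => //; apply: subset_trans; [| exact: Q1| | exact: Q2].
  - by apply: setSI.
  - by apply: setSI.
apply: (@le_trans _ _ (\sum_(k <oo) (mt (F k `&` Q) + mt (F k `&` ~` Q)))%E); last first.
  by apply: lee_nneseries => // k _; rewrite adde_ge0.
rewrite nneseriesD//; apply: leeD.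
  apply: ereal_inf_lbound; exists (fun k => F k `&` Q) => //; split.
    by move=> k; exact: measurableI.
  by rewrite -setI_bigcupl; exact: setSI.
apply: ereal_inf_lbound; exists (fun k => F k `&` ~` Q) => //; split.
  by move=> k; apply: measurableI => //; exact: measurableC.
by rewrite -setI_bigcupl; exact: setSI.
Qed.

Let cara_rect A B : measurable A -> measurable B -> caratheodory_measurable nus (A `*` B).
Proof.
move=> mA mB; rewrite (_ : A `*` B = (A `*` setT) `&` (setT `*` B)); last first.
  by apply/seteqP; split=> -[x y] /=; tauto.
apply: caratheodory_measurable_setI; apply: cara_split.
- exact: measurableX.
- move=> U V mU mV; exists (U `&` A), V, (U `\` A), V; split.
  + by split=> //; [exact: measurableI|exact: measurableD].
  + by move=> -[x y] /=; tauto.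
  + by move=> -[x y] /=; tauto.
  + by rewrite -m_splitl.
- exact: measurableX.
- move=> U V mU mV; exists U, (V `&` B), U, (V `\` B); split.
  + by split=> //; [exact: measurableI|exact: measurableD].
  + by move=> -[x y] /=; tauto.
  + by move=> -[x y] /=; tauto.
  + by rewrite -m_splitr.
Qed.

Let cara_measurable (Q : set (X * X)) : measurable Q -> caratheodory_measurable nus Q.
Proof.
rewrite measurable_prod_measurableType; apply: smallest_sub.
  split.
  - exact: caratheodory_measurable_set0.
  - by move=> A cA; rewrite setTD; exact: caratheodory_measurable_setC.
  - by move=> A cA; exact: caratheodory_measurable_bigcup.
by move=> _ [A mA [B mB <-]]; exact: cara_rect.
Qed.

(** The hard inequality. A cover of A x B, completed by two rectangles that fill the complement,
    covers the whole square, of mass 1. Finitely many slightly larger rectangles still cover a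
    square of mass close to 1, and finite subadditivity applies to these. *)
Let nus_ge A B : measurable A -> measurable B -> ((m A B)%:E <= nus (A `*` B))%E.
Proof.
move=> mA mB; apply: le_ereal_inf_tmp => _ [F [mF ABF] <-].
(* The five parts of [e]: two for the complement of [C] in the two coordinates, two for enlarging
   both sides of the rectangles, one for replacing each [F k] by a rectangle [Q k]. *)
apply/lee_addgt0Pr => e e0; pose h := e / 5; have h0 : 0 < h by rewrite /h; lra.
have dh k : 0 < h / (2 ^ k.+1)%:R by rewrite divr_gt0// ltr0n expn_gt0.
have /choice[Q HQ] k := mt_approx (F k) (dh k).
(* Indices 0 and 1 hold ~A x X and A x ~B, which make up the complement of A x B; the rectangles
   [Q k] are shifted by two. *)
pose A_ k := if k is k.+2 then (Q k).1 else if k is 1%N then A else ~` A.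
pose B_ k := if k is k.+2 then (Q k).2 else if k is 1%N then ~` B else setT.
have mA_ k : measurable (A_ k).
  by case: k => [|[|k]]//=; [exact: measurableC|case: (HQ k)].
have mB_ k : measurable (B_ k).
  by case: k => [|[|k]]//=; [exact: measurableC|case: (HQ k)].
have [|A' [B' [C [N [HA HB mC HC cov]]]]] := @rectangle_cover _ _ _ hX mu A_ B_ h h0 mA_ mB_.
  move=> x y; have [Ax|NAx] := pselect (A x); last by exists 0%N.
  have [By|NBy] := pselect (B y); last by exists 1%N.
  have [|k _ Fk] := ABF (x, y); first by [].
  by exists k.+2 => /=; case: (HQ k) => _ _ /(_ _ Fk)[].
have mA' k : measurable (A' k) by case: (HA k).
have mB' k : measurable (B' k) by case: (HB k).
have fin_mu S (r : R) : measurable S -> (mu S <= r%:E)%E -> fine (mu S) <= r.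
  by move=> mS; rewrite -lee_fin fineK ?fin_num_measure.
have mCC := measurableC mC.
have mCE : 1 - 2 * h <= m C C.
  have := m_splitl measurableT measurableT mC; rewrite setTI setTD mT.
  have := m_splitr mC measurableT mC; rewrite setTI setTD.
  have := m_lel mC measurableT mCC (@subsetT _ _).
  have := fin_mu _ _ mCC HC; rewrite m_setTl// !m_setTr//.
  by lra.
have step k : m (A' k) (B' k) <= m (A_ k) (B_ k) + 2 * (h / (2 ^ k.+1)%:R).
  case: (HA k) => _ AA' hA; case: (HB k) => _ BB' hB.
  have mAD := measurableD (mA' k) (mA_ k); have mBD := measurableD (mB' k) (mB_ k).
  have := fin_mu _ _ mAD hA; have := fin_mu _ _ mBD hB.
  have := m_splitl (mA' k) (mB' k) (mA_ k); have := m_splitr (mA_ k) (mB' k) (mB_ k).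
  have -> : A' k `&` A_ k = A_ k by rewrite setIC; exact: setIidl.
  have -> : B' k `&` B_ k = B_ k by rewrite setIC; exact: setIidl.
  have := m_ler mAD (mB' k) measurableT (@subsetT _ _).
  have := m_lel (mA_ k) measurableT mBD (@subsetT _ _).
  rewrite m_setTl// m_setTr//.
  by lra.
have H1 : 1 - 2 * h <= \sum_(k < N) (m (A_ k) (B_ k) + 2 * (h / (2 ^ k.+1)%:R)).
  apply: (le_trans mCE); apply: (le_trans (m_finite_cover mA' mB' mC mC cov)).
  apply: ler_sum => k _; apply: le_trans (step k).
  apply: (@le_trans _ _ (m (A' k) (C `&` B' k))).
    by apply: m_lel => //; try exact: measurableI; exact: subIsetr.
  by apply: m_ler => //; try exact: measurableI; exact: subIsetr.
rewrite big_split/= -mulr_sumr sum_geometric_half in H1.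
(* Two more non-negative terms are added so that exactly N rectangles [Q k] remain once the two
   filling ones are split off. *)
have H2 : \sum_(k < N) m (A_ k) (B_ k) <= \sum_(k < N.+2) m (A_ k) (B_ k).
  rewrite 2!big_ord_recr/= -addrA lerDl.
  by apply: addr_ge0; apply: m_ge0; [exact: (mA_ N)|exact: (mB_ N)|exact: (mA_ N.+1)|exact: (mB_ N.+1)].
have {}H2 : \sum_(k < N) m (A_ k) (B_ k) <=
    m (~` A) setT + (m A (~` B) + \sum_(i < N) m (Q i).1 (Q i).2).
  by move: H2; rewrite [leRHS]big_ord_recl [X in _ <= _ + X]big_ord_recl.
have H3 : \sum_(i < N) m (Q i).1 (Q i).2 <=
    \sum_(i < N) (fine (mt (F i)) + h / (2 ^ i.+1)%:R).
  by apply: ler_sum => k _ /=; case: (HQ k).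
rewrite big_split/= sum_geometric_half in H3.
have p0 : 0 <= h / (2 ^ N)%:R by rewrite divr_ge0// ltW.
have H4 : m A B <= \sum_(i < N) fine (mt (F i)) + e.
  have := m_splitl measurableT measurableT mA; rewrite setTI setTD mT.
  have := m_splitr mA measurableT mB; rewrite setTI setTD.
  rewrite (_ : e = 5 * h); last by rewrite /h; field.
  by move: H1 H2 H3 p0; lra.
apply: (@le_trans _ _ (\sum_(i < N) fine (mt (F i)) + e)%:E); first by rewrite lee_fin.
rewrite EFinD leeD2r// -sumEFin (eq_bigr (fun i : 'I_N => mt (F i))); last first.
  by move=> i _; rewrite fineK.
rewrite -(big_mkord xpredT (fun i => mt (F i))).
by apply: nneseries_lim_ge.
Qed.

Let nus_rect A B : measurable A -> measurable B -> nus (A `*` B) = (m A B)%:E.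
Proof. by move=> mA mB; apply/eqP; rewrite eq_le nus_le//= nus_ge. Qed.

Definition bimeasure_ext : set (X * X) -> \bar R := nus.

Let be0 : bimeasure_ext set0 = 0%E. Proof. exact: outer_measure0. Qed.
Let be_ge0 S : (0 <= bimeasure_ext S)%E. Proof. exact: outer_measure_ge0. Qed.
Let be_additive : semi_sigma_additive bimeasure_ext.
Proof.
move=> F mF tF mUF; apply: (@caratheodory_measure_sigma_additive R _ nus) => //.
  by move=> i; exact: cara_measurable.
exact: cara_measurable.
Qed.
HB.instance Definition _ := isMeasure.Build _ _ _ bimeasure_ext be0 be_ge0 be_additive.
Let beT : bimeasure_ext setT = 1%E.
Proof. by rewrite -setXTT /bimeasure_ext nus_rect// mT. Qed.
HB.instance Definition _ := Measure_isProbability.Build _ _ _ bimeasure_ext beT.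

Lemma bimeasure_extension : exists nu : probability (X * X)%type R,
  forall A B, measurable A -> measurable B -> nu (A `*` B) = (m A B)%:E.
Proof. by exists bimeasure_ext => A B mA mB; exact: nus_rect. Qed.

End bimeasure.

(** * Norm estimates in Hilbert spaces *)

Section hilbert_norm.
Context (R : realType) (H : lmodType R[i]) (dot : {dot H for Num.Def.conjC}).
Implicit Types u v w : H.
Local Notation rdot u v := (re (dot u v)).
Local Notation hn := (hnorm dot).

Lemma dotC u v : dot u v = (dot v u)^*.
Proof. by rewrite (hermC dot) expr0 mul1r. Qed.

Lemma rdotC u v : rdot u v = rdot v u.
Proof. by rewrite dotC; case: (dot v u). Qed.

Lemma reB (a b : R[i]) : re (a - b) = re a - re b.
Proof. by case: a b => [a a'] [b b']. Qed.

Lemma rdotDl u v w : rdot (u + v) w = rdot u w + rdot v w.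
Proof. by rewrite linearDl reD. Qed.

Lemma rdotBl u v w : rdot (u - v) w = rdot u w - rdot v w.
Proof. by rewrite linearBl reB. Qed.

Lemma rdotDr u v w : rdot u (v + w) = rdot u v + rdot u w.
Proof. by rewrite linearDr reD. Qed.

Lemma rdotBr u v w : rdot u (v - w) = rdot u v - rdot u w.
Proof. by rewrite linearBr reB. Qed.

Lemma rdotZl (a : R) u v : rdot (a%:C *: u) v = a * rdot u v.
Proof. by rewrite linearZl_LR reM/= mul0r subr0. Qed.

Lemma rdotZr (a : R) u v : rdot u (a%:C *: v) = a * rdot u v.
Proof. by rewrite rdotC rdotZl rdotC. Qed.

Lemma dotZZ (a : R[i]) u : dot (a *: u) (a *: u) = (ComplexField.Normc.normc a ^+ 2)%:C * dot u u.
Proof.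
rewrite linearZl_LR linearZr_LR/= mulrA; congr (_ * _).
by case: a => x y; rewrite normc2/=; apply/eqP; rewrite eq_complex/=; apply/andP; split; apply/eqP; ring.
Qed.

Lemma dot_real u : dot u u = (rdot u u)%:C.
Proof.
have := dotC u u; case: (dot u u) => a b /= -[] bb.
by congr (_ +i* _); lra.
Qed.

Lemma rdot_ge0 u : 0 <= rdot u u.
Proof. by rewrite -lecR -dot_real dnorm_ge0. Qed.

Lemma rdot_eq0 u : rdot u u = 0 -> u = 0.
Proof. by move=> h; apply/eqP; rewrite -(dnorm_eq0 dot) dot_real h. Qed.

Lemma hnorm_sq u : hn u ^+ 2 = rdot u u.
Proof. by rewrite sqr_sqrtr// rdot_ge0. Qed.

Lemma hnorm_ge0 u : 0 <= hn u. Proof. exact: sqrtr_ge0. Qed.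

Lemma hnorm0 : hn 0 = 0.
Proof. by rewrite /hnorm linear0l sqrtr0. Qed.

Lemma hnorm_eq0 u : hn u = 0 -> u = 0.
Proof. by move=> h; apply: rdot_eq0; rewrite -hnorm_sq h expr0n. Qed.

Lemma hnorm_opp u : hn (- u) = hn u.
Proof. by rewrite /hnorm linearNl linearNr opprK. Qed.

Lemma hnormBC u v : hn (u - v) = hn (v - u).
Proof. by rewrite -hnorm_opp opprB. Qed.

Lemma hnormZ (a : R) u : hn (a%:C *: u) = `|a| * hn u.
Proof.
rewrite /hnorm dotZZ reM/= mul0r subr0 sqrtrM ?sqr_ge0//.
by rewrite sqrtr_sqr/= expr0n addr0 sqrtr_sqr normr_id.
Qed.

Lemma cauchy_schwarz u v : `|rdot u v| <= hn u * hn v.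
Proof.
rewrite -(@ler_pXn2r _ 2)// ?nnegrE ?mulr_ge0 ?hnorm_ge0//.
rewrite exprMn !hnorm_sq real_normK ?num_real//.
have [v0|v0] := eqVneq (rdot v v) 0; first by move: v0 => /[dup] /rdot_eq0 -> ->; rewrite linear0r/= expr0n mulr0.
have vp : 0 < rdot v v by rewrite lt_neqAle eq_sym v0 rdot_ge0.
have := rdot_ge0 ((rdot v v)%:C *: u - (rdot u v)%:C *: v).
rewrite rdotBl !rdotZl !rdotBr !rdotZr (rdotC v u) => h.
suff : 0 <= rdot v v * (rdot u u * rdot v v - rdot u v ^+ 2).
  by rewrite pmulr_rge0// subr_ge0.
by apply: le_trans h _; rewrite le_eqVlt; apply/orP; left; apply/eqP; ring.
Qed.

Lemma hnorm_leD u v : hn (u + v) <= hn u + hn v.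
Proof.
rewrite -(@ler_pXn2r _ 2)// ?nnegrE ?addr_ge0 ?hnorm_ge0//.
rewrite sqrrD !hnorm_sq rdotDl !rdotDr (rdotC v u).
have := le_trans (ler_norm _) (cauchy_schwarz u v).
by rewrite mulr2n; lra.
Qed.

Lemma hnormB_ge u v : hn u - hn v <= hn (u - v).
Proof. by rewrite lerBlDr -{1}[u](subrK v) hnorm_leD. Qed.

Lemma hnorm_leB u v : hn (u - v) <= hn u + hn v.
Proof. by rewrite -(hnorm_opp v) hnorm_leD. Qed.

End hilbert_norm.

Definition pushforward_meas d1 d2 (X : measurableType d1) (Y : measurableType d2)
    (R : realType) (m : {measure set X -> \bar R}) (f : X -> Y)
    (mf : measurable_fun setT f) : {measure set Y -> \bar R}.
Proof. by refine (pushforward m f : {measure set Y -> \bar R}). Defined.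

Lemma measure_add_exists d (X : measurableType d) (R : realType)
    (m1 m2 : {measure set X -> \bar R}) :
  exists m : {measure set X -> \bar R}, forall A, m A = (m1 A + m2 A)%E.
Proof. by exists (measure_add m1 m2) => A; rewrite -measure_addE. Qed.

(** * Boolean expressions in rectangles and their density *)

Section rectangle_expressions.
Context d (X : measurableType d).

(** Syntax rather than sets, because an expression is read twice: as a subset of the square by
    [rset], and later as a projection on the Hilbert space by [rop]. The leaves store measurability
    since the projections obey their laws on measurable sets only. *)
Inductive rexpr : Type :=
| RRect (A B : set X) of measurable A & measurable B
| RAnd of rexpr & rexpr
| RNot of rexpr.

Fixpoint rset (e : rexpr) : set (X * X) :=
  match e with
  | RRect A B _ _ => A `*` B
  | RAnd e1 e2 => rset e1 `&` rset e2
  | RNot e1 => ~` rset e1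
  end.

Lemma measurable_rset e : measurable (rset e).
Proof.
elim: e => [A B mA mB|e1 m1 e2 m2|e1 m1] /=.
- exact: measurableX.
- exact: measurableI.
- exact: measurableC.
Qed.

Section pullback.
Variables (T : X -> X) (mT : measurable_fun setT T).

Lemma measurable_preimage (A : set X) : measurable A -> measurable (T @^-1` A).
Proof. by move=> mA; rewrite -[_ @^-1` _]setTI; exact: mT. Qed.

Fixpoint rpull (e : rexpr) : rexpr :=
  match e with
  | RRect A B mA mB => RRect (measurable_preimage mA) (measurable_preimage mB)
  | RAnd e1 e2 => RAnd (rpull e1) (rpull e2)
  | RNot e1 => RNot (rpull e1)
  end.

Lemma rset_pull e : rset (rpull e) = (fun z => (T z.1, T z.2)) @^-1` rset e.
Proof. by elim: e => //= [e1 -> e2 ->|e1 ->]. Qed.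
End pullback.

Local Notation symd := (fun S S' : set (X * X) => (S `\` S') `|` (S' `\` S)).

Lemma rset_dense (R : realType) (m : {measure set (X * X) -> \bar R}) (S : set (X * X)) :
  (m setT < +oo)%E -> measurable S -> forall e : R, 0 < e ->
  exists E, (m (symd S (rset E)) <= e%:E)%E.
Proof.
move=> mfin mS.
suff [] : measurable S /\ forall e : R, 0 < e -> exists E, (m (symd S (rset E)) <= e%:E)%E by [].
pose G (S : set (X * X)) := measurable S /\
  forall e : R, 0 < e -> exists E, (m (symd S (rset E)) <= e%:E)%E.
have mS' (Q Q' : set (X * X)) : measurable Q -> measurable Q' -> measurable (symd Q Q').
  by move=> mQ mQ'; apply: measurableU; exact: measurableD.
have G0 : G set0.
  split=> // e e0; exists (RRect measurable0 measurable0) => /=.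
  by rewrite set0X setD0 setU0 measure0 lee_fin ltW.
have GC Q : G Q -> G (~` Q).
  move=> [mQ hQ]; split; first exact: measurableC.
  move=> e /hQ[E hE]; exists (RNot E); apply: le_trans hE.
  rewrite le_measure ?inE//; first by apply: mS'; [exact: measurableC|exact: measurable_rset].
    by apply: mS' => //; exact: measurable_rset.
  by move=> z /= [[? /contrapT ?]|[? /contrapT ?]]; [right|left].
have GU (Q Q' : set (X * X)) : G Q -> G Q' -> G (Q `|` Q').
  move=> [mQ hQ] [mQ' hQ']; split; first exact: measurableU.
  move=> e e0; have e2 : 0 < e / 2 by rewrite divr_gt0.
  have [E hE] := hQ _ e2; have [E' hE'] := hQ' _ e2.
  exists (RNot (RAnd (RNot E) (RNot E'))).
  have mE := measurable_rset E; have mE' := measurable_rset E'.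
  apply: (@le_trans _ _ (m (symd Q (rset E)) + m (symd Q' (rset E')))%E); last first.
    by rewrite [e in leRHS]splitr EFinD leeD.
  apply: (@le_trans _ _ (m (symd Q (rset E) `|` symd Q' (rset E')))); last first.
    by apply: measureU2; exact: mS'.
  rewrite le_measure ?inE//.
  - by apply: mS'; [exact: measurableU|exact: (measurable_rset (RNot (RAnd (RNot E) (RNot E'))))].
  - by apply: measurableU; apply: mS'.
  - move=> z /=; by have [|] := pselect (rset E z); have [|] := pselect (rset E' z); tauto.
suff h : measurable `<=` G by exact: h mS.
rewrite measurable_prod_measurableType.
apply: smallest_sub; last first.
  move=> _ [A mA [B mB <-]]; split; first exact: measurableX.
  move=> e e0; exists (RRect mA mB) => /=.
  by rewrite setDv setU0 measure0 lee_fin ltW.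
split => //; first by move=> Q /GC; rewrite setTD.
move=> F GF; pose U n := \bigcup_(k < n) F k.
have GUn n : G (U n).
  rewrite /U; elim: n => [|n IH]; first by rewrite bigcup_mkord big_ord0.
  by rewrite bigcup_mkord big_ord_recr/= -bigcup_mkord; apply: GU.
have mF k : measurable (F k) by case: (GF k).
have mU n : measurable (U n) by case: (GUn n).
have mUF : measurable (\bigcup_k F k) by exact: bigcup_measurable.
split=> // e e0; have e2 : 0 < e / 2 by rewrite divr_gt0.
have [n Hn] : exists n, (m (\bigcup_k F k `\` U n) <= (e / 2)%:E)%E. by exact: measure_tail.
have [E hE] := (GUn n).2 _ e2; exists E.
have mE := measurable_rset E.
apply: (@le_trans _ _ (m (\bigcup_k F k `\` U n) + m (symd (U n) (rset E)))%E); last first.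
  by rewrite [e in leRHS]splitr EFinD leeD.
apply: (@le_trans _ _ (m ((\bigcup_k F k `\` U n) `|` symd (U n) (rset E)))); last first.
  by apply: measureU2; [exact: measurableD|exact: mS'].
rewrite le_measure ?inE//; first exact: mS'.
  by apply: measurableU; [exact: measurableD|exact: mS'].
move=> z /= [[Fz NE]|[Ez NF]].
  by have [Uz|NUz] := pselect (U n z); [right; left|left].
by right; right; split=> // -[k _ Fz]; apply: NF; exists k.
Qed.

End rectangle_expressions.

(** * Joint spectral measure of two commuting families of projections *)

Section spectral_measure.
Context (R : realType) d (X : measurableType d) (mu : probability X R).
Hypothesis hX : standard_borel R X.
Variable K : hilbertSpace R.
Local Notation dot := (hs_dot K).
Local Notation rdot u v := (re (hs_dot K u v)).
Local Notation hn := (hnorm (hs_dot K)).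
Variables (p q : set X -> K -> K) (xi : K).

Definition subtractive (f : K -> K) := forall u v, f (u - v) = f u - f v.

Hypothesis p_sub : forall A, measurable A -> subtractive (p A).
Hypothesis q_sub : forall A, measurable A -> subtractive (q A).
Hypothesis p_adj : forall A u v, measurable A -> dot (p A u) v = dot u (p A v).
Hypothesis q_adj : forall A u v, measurable A -> dot (q A u) v = dot u (q A v).
Hypothesis pI : forall A B u, measurable A -> measurable B -> p (A `&` B) u = p A (p B u).
Hypothesis qI : forall A B u, measurable A -> measurable B -> q (A `&` B) u = q A (q B u).
Hypothesis pC : forall A u, measurable A -> p (~` A) u = u - p A u.
Hypothesis qC : forall A u, measurable A -> q (~` A) u = u - q A u.
Hypothesis pq : forall A B u, measurable A -> measurable B -> p A (q B u) = q B (p A u).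
Hypothesis p_xi : forall A, measurable A -> rdot (p A xi) xi = fine (mu A).
Hypothesis q_xi : forall A, measurable A -> rdot (q A xi) xi = fine (mu A).

Let p0 u : p set0 u = 0.
Proof.
have mT := @measurableT _ X; rewrite -(setICr setT) (pI _ mT (measurableC mT)).
by rewrite (pC _ mT) (p_sub mT) -(pI _ mT mT) setIid subrr.
Qed.
Let q0 u : q set0 u = 0.
Proof.
have mT := @measurableT _ X; rewrite -(setICr setT) (qI _ mT (measurableC mT)).
by rewrite (qC _ mT) (q_sub mT) -(qI _ mT mT) setIid subrr.
Qed.
Let pT u : p setT u = u.
Proof. by rewrite -setC0 pC// p0 subr0. Qed.
Let qT u : q setT u = u.
Proof. by rewrite -setC0 qC// q0 subr0. Qed.

Fixpoint rop (e : rexpr X) : K -> K :=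
  match e with
  | RRect A B _ _ => fun u => p A (q B u)
  | RAnd e1 e2 => fun u => rop e1 (rop e2 u)
  | RNot e1 => fun u => u - rop e1 u
  end.

Lemma rop_sub e : subtractive (rop e).
Proof.
elim: e => [A B mA mB|e1 h1 e2 h2|e1 h1] u v /=.
- by rewrite q_sub// p_sub.
- by rewrite h2 h1.
- by rewrite h1 !opprD !opprK addrACA.
Qed.

Let rop_comm_rect e A B u : measurable A -> measurable B ->
  rop e (p A (q B u)) = p A (q B (rop e u)).
Proof.
move=> mA mB; elim: e u => [A' B' mA' mB'|e1 h1 e2 h2|e1 h1] u /=.
- rewrite -(pq _ mA mB') -pI// -(pq _ mA' mB) -pI// setIC; congr (p _ _).
  by rewrite -!qI// setIC.
- by rewrite h2 h1.
- by rewrite h1 q_sub// p_sub.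
Qed.

Lemma rop_comm e e' u : rop e (rop e' u) = rop e' (rop e u).
Proof.
elim: e' u => [A B mA mB|e1 h1 e2 h2|e1 h1] u /=.
- exact: rop_comm_rect.
- by rewrite h1 h2.
- by rewrite rop_sub h1.
Qed.

Lemma rop_adj e u v : dot (rop e u) v = dot u (rop e v).
Proof.
elim: e u v => [A B mA mB|e1 h1 e2 h2|e1 h1] u v /=.
- by rewrite p_adj// q_adj// pq.
- by rewrite h1 h2 rop_comm.
- by rewrite linearBl linearBr/= h1.
Qed.

Lemma rop_idem e u : rop e (rop e u) = rop e u.
Proof.
elim: e u => [A B mA mB|e1 h1 e2 h2|e1 h1] u /=.
- by rewrite -(pq _ mA mB) -pI// setIid -qI// setIid.
- by rewrite (rop_comm e2) h2 h1.
- by rewrite rop_sub h1 subrr subr0.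
Qed.

Lemma rop_norm e u : hn (rop e u) ^+ 2 = rdot (rop e u) u.
Proof. by rewrite hnorm_sq -rop_adj rop_idem. Qed.

Lemma rop_contract e u : hn (rop e u) <= hn u.
Proof.
have [->|h] := eqVneq (hn (rop e u)) 0; first exact: hnorm_ge0.
have hp : 0 < hn (rop e u) by rewrite lt_neqAle eq_sym h hnorm_ge0.
rewrite -(ler_pM2l hp) -expr2 rop_norm.
exact: le_trans (ler_norm _) (cauchy_schwarz _ _ _).
Qed.

Let m A B := rdot (p A (q B xi)) xi.

Let m_rop A B (mA : measurable A) (mB : measurable B) : m A B = hn (rop (RRect mA mB) xi) ^+ 2.
Proof. by rewrite rop_norm. Qed.

Let m_splitl A B U : measurable A -> measurable B -> measurable U ->
  m A B = m (A `&` U) B + m (A `\` U) B.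
Proof.
move=> mA mB mU; rewrite /m setDE !pI//; last exact: measurableC.
by rewrite pC// p_sub// rdotBl addrC subrK.
Qed.

Let m_splitr A B U : measurable A -> measurable B -> measurable U ->
  m A B = m A (B `&` U) + m A (B `\` U).
Proof.
move=> mA mB mU; rewrite /m setDE !qI//; last exact: measurableC.
by rewrite qC// q_sub// p_sub// rdotBl addrC subrK.
Qed.

Lemma spectral_measure_exists : exists nu : probability (X * X)%type R,
  forall A B, measurable A -> measurable B -> nu (A `*` B) = (m A B)%:E.
Proof.
apply: (@bimeasure_extension R d X mu hX m).
- by move=> A B mA mB; rewrite (m_rop mA mB) sqr_ge0.
- exact: m_splitl.
- exact: m_splitr.
- by move=> A mA; rewrite /m qT p_xi.
- by move=> A mA; rewrite /m pT q_xi.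
Qed.

Variable nu : probability (X * X)%type R.
Hypothesis nu_rect : forall A B, measurable A -> measurable B ->
  nu (A `*` B) = (rdot (p A (q B xi)) xi)%:E.

Let prI S (e : rexpr X) : measurable S -> pr nu S = pr nu (S `&` rset e) + pr nu (S `&` ~` rset e).
Proof. by move=> mS; rewrite -setDE -prID//; exact: measurable_rset. Qed.

(** The induction carries an accumulator [e'] and a rectangle: a leaf of [e] is absorbed by the
    rectangle, and a conjunction moves its second factor into the accumulator. *)
Let rop_nu_aux e e' :
  (forall A B (mA : measurable A) (mB : measurable B),
    rdot (rop e' (rop (RRect mA mB) xi)) xi = pr nu (rset e' `&` A `*` B)) ->
  forall A B (mA : measurable A) (mB : measurable B),
    rdot (rop e (rop e' (rop (RRect mA mB) xi))) xi = pr nu (rset e `&` rset e' `&` A `*` B).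
Proof.
elim: e e' => [A0 B0 mA0 mB0|e1 h1 e2 h2|e1 h1] e' He' A B mA mB.
- have -> : rop (RRect mA0 mB0) (rop e' (rop (RRect mA mB) xi)) =
      rop e' (rop (RRect (measurableI _ _ mA0 mA) (measurableI _ _ mB0 mB)) xi).
    by rewrite rop_comm; congr (rop e' _) => /=; rewrite -(pq _ mA mB0) -pI// -qI.
  rewrite He' /=; congr (fine (nu _)); apply/seteqP; split=> -[x y] /=; tauto.
- rewrite (_ : rop _ _ = rop e1 (rop (RAnd e2 e') (rop (RRect mA mB) xi)))//.
  rewrite h1; last by move=> A1 B1 mA1 mB1; exact: (h2 e' He').
  by rewrite /= setIA.
- set v := rop e' (rop _ _); rewrite -[rop (RNot e1) v]/(v - rop e1 v) rdotBl /v (h1 _ He') He'.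
  have mQ : measurable (rset e' `&` A `*` B).
    by apply: measurableI; [exact: measurable_rset|exact: measurableX].
  by rewrite (prI e1 mQ) [_ `&` rset e1]setIC [_ `&` ~` rset e1]setIC !setIA addrC addKr.
Qed.

Lemma rop_nu e : rdot (rop e xi) xi = pr nu (rset e).
Proof.
pose eT := RRect (@measurableT _ X) (@measurableT _ X).
have eTE u : rop eT u = u by rewrite /= qT pT.
have := @rop_nu_aux e eT _ _ _ (@measurableT _ X) (@measurableT _ X).
rewrite -/eT !eTE => ->; first by rewrite /= setXTT !setIT.
move=> A B mA mB; rewrite eTE /= setXTT setTI.
by have := nu_rect mA mB => ->.
Qed.

(** On [xi] the projections behave like indicators in the L2 space of [nu]: the squared distance of
    two vectors is the measure of the symmetric difference, so convergence of sets becomes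
    convergence of vectors. *)
Lemma rop_diff e e' : hn (rop e xi - rop e' xi) ^+ 2 =
  pr nu (rset e) + pr nu (rset e') - 2 * pr nu (rset e `&` rset e').
Proof.
rewrite hnorm_sq rdotBl !rdotBr (rdotC (hs_dot K) (rop e' xi) (rop e xi)).
rewrite -!hnorm_sq !rop_norm !rop_nu.
rewrite (_ : rdot (rop e xi) (rop e' xi) = pr nu (rset (RAnd e e'))); first by rewrite /=; ring.
by rewrite -rop_nu -rop_adj /= rop_comm.
Qed.

Lemma rop_diffE e e' : hn (rop e xi - rop e' xi) ^+ 2 =
  pr nu (rset e `&` ~` rset e') + pr nu (~` rset e `&` rset e').
Proof.
rewrite rop_diff (@prI (rset e) e'); last exact: measurable_rset.
rewrite (@prI (rset e') e); last exact: measurable_rset.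
by rewrite (setIC (rset e')) (setIC (rset e')); ring.
Qed.

Lemma rop_diffU e e' : hn (rop e xi - rop e' xi) ^+ 2 =
  pr nu ((rset e `&` ~` rset e') `|` (~` rset e `&` rset e')).
Proof.
have mE := measurable_rset e; have mE' := measurable_rset e'.
have m1 : measurable (rset e `&` ~` rset e').
  by apply: measurableI => //; exact: measurableC.
have m2 : measurable (~` rset e `&` rset e').
  by apply: measurableI => //; exact: measurableC.
rewrite rop_diffE -fineD ?fin_num_measure// -measureU//.
by apply/seteqP; split=> // z [[? ?] []].
Qed.

Lemma rop_pull T (mT : measurable_fun setT T) (W : K -> K) : subtractive W ->
  (forall A u, measurable A -> W (p A u) = p (T @^-1` A) (W u)) ->
  (forall A u, measurable A -> W (q A u) = q (T @^-1` A) (W u)) ->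
  forall e u, W (rop e u) = rop (rpull mT e) (W u).
Proof.
move=> Ws Wp Wq; elim=> [A B mA mB|e1 h1 e2 h2|e1 h1] u /=.
- by rewrite Wp// Wq.
- by rewrite h1 h2.
- by rewrite Ws h1.
Qed.

Let fin_abs (S S' : set (X * X)) : measurable S -> measurable S' ->
  `|pr nu S - pr nu S'| <= pr nu ((S `\` S') `|` (S' `\` S)).
Proof.
move=> mS mS'.
have mD := measurableD mS mS'; have mD' := measurableD mS' mS.
have H1 := prID nu mS mS'; have H2 := prID nu mS' mS; rewrite [S' `&` S]setIC in H2.
have H3 : pr nu ((S `\` S') `|` (S' `\` S)) = pr nu (S `\` S') + pr nu (S' `\` S).
  by apply: prU => //; apply/seteqP; split=> // z [[? ?] []].
have := fine_ge0 (measure_ge0 nu (S `\` S')); have := fine_ge0 (measure_ge0 nu (S' `\` S)).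
by rewrite H3 ler_norml; lra.
Qed.

Lemma nu_almost_invariant T (mT : measurable_fun setT T) (W : K -> K) : subtractive W ->
  (forall u, hn (W u) = hn u) ->
  (forall A u, measurable A -> W (p A u) = p (T @^-1` A) (W u)) ->
  (forall A u, measurable A -> W (q A u) = q (T @^-1` A) (W u)) ->
  hn xi = 1 ->
  forall S, measurable S ->
  `|pr nu ((fun z => (T z.1, T z.2)) @^-1` S) - pr nu S| <= 2 * hn (xi - W xi).
Proof.
move=> Ws Wn Wp Wq xi1 S mS.
have mP Q := measurable_pair_preimage (S := Q) mT.
have base e : `|pr nu (pair_map T @^-1` rset e) - pr nu (rset e)| <= 2 * hn (xi - W xi).
  have := rset_pull mT e => /= <-.
  rewrite -!rop_nu -!rop_norm.
  have -> : hn (rop e xi) = hn (rop (rpull mT e) (W xi)) by rewrite -(rop_pull mT)// Wn.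
  set a := hn _; set b := hn _.
  have ab : `|a - b| <= hn (xi - W xi).
    apply: le_trans (rop_contract (rpull mT e) _); rewrite rop_sub ler_norml hnormB_ge.
    by rewrite lerNl opprB hnormBC hnormB_ge.
  have a0 : 0 <= a <= 1 by rewrite hnorm_ge0/= -xi1 rop_contract.
  have b0 : 0 <= b <= 1 by rewrite hnorm_ge0/= -xi1 -(Wn xi) rop_contract.
  rewrite subr_sqr mulrC normrM ler_pM// ger0_norm; lra.
apply/ler_addgt0Pr => e e0.
(* Approximating [S] for the sum of [nu] and its push-forward controls [S] and its preimage with a
   single expression. *)
have [m2 m2E] := measure_add_exists nu (pushforward_meas nu (measurable_pair_map mT)).
have mE (Q : set (X * X)) : (m2 Q = nu Q + nu (pair_map T @^-1` Q))%E by rewrite m2E.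
have mfin : (m2 setT < +oo)%E.
  by rewrite mE preimage_setT lte_add_pinfty// ltey_eq fin_num_measure.
have e2 : 0 < e / 2 by rewrite divr_gt0.
have [E HE] := rset_dense mfin mS e2.
have mE' := measurable_rset E.
have mD : measurable ((S `\` rset E) `|` (rset E `\` S)).
  by apply: measurableU; exact: measurableD.
have mPD := mP _ mD.
have := base E; have := fin_abs mS mE'; have := fin_abs (mP _ mS) (mP _ mE').
rewrite (_ : _ `\` _ `|` _ = pair_map T @^-1` ((S `\` rset E) `|` (rset E `\` S)))//.
have : pr nu ((S `\` rset E) `|` (rset E `\` S)) +
    pr nu (pair_map T @^-1` ((S `\` rset E) `|` (rset E `\` S))) <= e / 2.
  by rewrite -fineD ?fin_num_measure// -lee_fin fineK -?mE// mE fin_numD !fin_num_measure.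
have := fine_ge0 (measure_ge0 nu ((S `\` rset E) `|` (rset E `\` S))).
have := fine_ge0 (measure_ge0 nu (pair_map T @^-1` ((S `\` rset E) `|` (rset E `\` S)))).
by rewrite !ler_norml => *; lra.
Qed.

Lemma nu_commutator A : measurable A -> pr nu (A `*` ~` A) <= hn (p A xi - q A xi) ^+ 2.
Proof.
move=> mA; have := rop_diffE (RRect mA (@measurableT _ X)) (RRect (@measurableT _ X) mA).
rewrite /= qT pT => ->.
rewrite (_ : _ `&` ~` _ = A `*` ~` A); first by rewrite lerDl fine_ge0.
by apply/seteqP; split=> -[x y] /=; tauto.
Qed.

Section diagonal_vector.
Variable B : nat -> set X.
Hypothesis mB : forall n, measurable (B n).
Hypothesis sepB : forall x y, (forall n, B n x <-> B n y) -> x = y.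

(** The pairs not separated by the first n sets of [B]. They decrease to the diagonal, which itself
    need not be a finite Boolean combination of rectangles. *)
Fixpoint ediag n : rexpr X :=
  if n is n'.+1 then RAnd (RAnd (RNot (RRect (mB n') (measurableC (mB n'))))
                                (RNot (RRect (measurableC (mB n')) (mB n')))) (ediag n')
  else RRect (@measurableT _ X) (@measurableT _ X).

Lemma rset_ediag n x y : rset (ediag n) (x, y) <-> forall k, (k < n)%N -> B k x <-> B k y.
Proof.
elim: n => [|n IH]; first by split.
split=> /=.
  move=> [[/= h1 h2] /IH h3] k; rewrite ltnS leq_eqVlt => /orP[/eqP ->|]; last exact: h3.
  by split=> Bx; apply: contrapT => NB; [apply: h1|apply: h2].
move=> h; split; last by apply/IH => k kn; apply: h; exact: leqW.
by have [h1 h2] := h n (leqnn _); split=> /= -[? ?]; tauto.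
Qed.

Lemma rset_ediag_bigcap : \bigcap_n rset (ediag n) = diagonal.
Proof.
apply/seteqP; split=> [[x y] h|[x y]]; rewrite /diagonal/=.
  apply: sepB => n; have /rset_ediag := h n.+1 I; exact.
by move=> -> n _; apply/rset_ediag.
Qed.

Lemma rset_ediag_le i n : (i <= n)%N -> rset (ediag n) `<=` rset (ediag i).
Proof.
move=> mn [x y] /rset_ediag h; apply/rset_ediag => k km; apply: h.
exact: leq_trans km mn.
Qed.

Let ediag_cvg (e : R) : 0 < e ->
  exists N, forall n, (N <= n)%N -> pr nu (rset (ediag n) `\` diagonal) <= e.
Proof.
move=> e0; pose F n := ~` rset (ediag n).
have mF n : measurable (F n) by apply: measurableC; exact: measurable_rset.
have [N HN] := pr_tail nu mF e0; exists N => n Nn; apply: le_trans HN.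
have mD := measurable_diagonal hX.
apply: pr_le; first by apply: measurableD => //; exact: measurable_rset.
  by apply: measurableD; exact: bigcup_measurable.
move=> z [Ez Nz]; split.
  apply: contrapT => NF; apply: Nz; rewrite -rset_ediag_bigcap => k _.
  by apply: contrapT => Nk; apply: NF; exists k.
by move=> [k /= kN]; apply; apply: rset_ediag_le Ez; exact: leq_trans (ltnW kN) Nn.
Qed.

(** The vectors of [ediag n] form a Cauchy sequence because the measures of the sets decrease to
    that of the diagonal; [eta] is the limit. There p A and q A agree, as A x X and X x A have the
    same trace on the diagonal. The distance to [xi] is bounded by comparing with n = 0, where the
    vector is [xi] itself. *)
Lemma diagonal_vector_exists : hn xi = 1 -> exists eta : K,
  (forall A, measurable A -> p A eta = q A eta) /\
  hn (eta - xi) ^+ 2 <= pr nu (~` diagonal).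
Proof.
move=> xi1; have mDiag : measurable (@diagonal X) by exact: (measurable_diagonal hX).
pose x n := rop (ediag n) xi.
have edD n : diagonal `<=` rset (ediag n) by rewrite -rset_ediag_bigcap; exact: bigcap_inf.
have xle i n : (i <= n)%N -> hn (x i - x n) ^+ 2 = pr nu (rset (ediag i)) - pr nu (rset (ediag n)).
  move=> mn; rewrite rop_diff setIC setIidl; last exact: rset_ediag_le.
  ring.
have prDn n : pr nu diagonal <= pr nu (rset (ediag n)). by apply: pr_le => //; exact: measurable_rset.
have cauchy e : 0 < e -> exists N, forall i j, (N <= i)%N -> (N <= j)%N -> hn (x i - x j) < e.
  move=> e0; have e2 : 0 < e ^+ 2 / 2 by rewrite divr_gt0// exprn_gt0.
  have [N HN] := ediag_cvg e2; exists N => i j.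
  wlog ij : i j / (i <= j)%N.
    move=> H Ni Nj; have [ij|ji] := leqP i j; first exact: H.
    by rewrite hnormBC; apply: H => //; exact: ltnW.
  move=> Ni Nj; rewrite -(@ltr_pXn2r _ 2)// ?nnegrE ?hnorm_ge0// ?ltW//.
  rewrite xle//; have := HN _ Ni; have := prDn j; rewrite (@prD _ _ _ nu)//; last exact: measurable_rset.
  have : 0 < e ^+ 2 by rewrite exprn_gt0.
  by lra.
have [eta Heta] := hs_complete cauchy.
exists eta; split.
- move=> A mA; apply/eqP; rewrite -subr_eq0; apply/eqP/(@hnorm_eq0 _ _ (hs_dot K)).
  apply/eqP; rewrite eq_le hnorm_ge0 andbT; apply/ler_addgt0Pr => e e0; rewrite add0r.
  pose eA := RRect mA (@measurableT _ X); pose eA' := RRect (@measurableT _ X) mA.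
  have pE u : p A u = rop eA u by rewrite /= qT.
  have qE u : q A u = rop eA' u by rewrite /= pT.
  have e4 : 0 < e / 4 by rewrite divr_gt0.
  have [N1 HN1] := Heta _ e4.
  have e2 : 0 < (e / 2) ^+ 2 by rewrite exprn_gt0// divr_gt0.
  have [N2 HN2] := ediag_cvg e2.
  pose n := maxn N1 N2.
  have H1 : hn (x n - eta) < e / 4 by apply: HN1; exact: leq_maxl.
  have H2 : hn (p A (x n) - q A (x n)) <= e / 2.
    rewrite -(@ler_pXn2r _ 2)// ?nnegrE ?hnorm_ge0// ?divr_ge0 ?(ltW e0)//.
    rewrite pE qE.
    rewrite (rop_diffU (RAnd eA (ediag n)) (RAnd eA' (ediag n))).
    have := HN2 n (leq_maxr _ _); move=> HS; apply: (le_trans _ HS).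
    apply: pr_le.
    + apply: measurableU; apply: measurableI; try apply: measurableC; exact: measurable_rset.
    + by apply: measurableD => //; exact: measurable_rset.
    + move=> [y z] /= H; have Eyz : rset (ediag n) (y, z) by case: H => -[? ?]; tauto.
      by split=> // yz; rewrite /diagonal/= in yz; rewrite -yz in H; tauto.
  have -> : p A eta - q A eta = (p A (x n) - q A (x n)) + (p A (eta - x n) - q A (eta - x n)).
    rewrite (p_sub mA) (q_sub mA) -[LHS](subrK (p A (x n) - q A (x n))) addrC.
    by congr (_ + _); rewrite !opprD !opprK addrACA.
  have := hnorm_leD (hs_dot K) (p A (x n) - q A (x n)) (p A (eta - x n) - q A (eta - x n)).
  have := hnorm_leB (hs_dot K) (p A (eta - x n)) (q A (eta - x n)).
  have := rop_contract eA (eta - x n); have := rop_contract eA' (eta - x n).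
  rewrite -pE -qE; have := hnormBC (hs_dot K) eta (x n).
  by lra.
- rewrite prC//.
  rewrite -[leRHS]sqr_sqrtr; last by rewrite subr_ge0 (le_trans (prDn 0%N))// /= setXTT prT.
  rewrite ler_pXn2r// ?nnegrE ?hnorm_ge0 ?sqrtr_ge0//.
  apply/ler_addgt0Pr => e e0; have [N HN] := Heta _ e0.
  have H1 := HN N (leqnn _).
  have H2 : hn (x 0%N - x N) <= Num.sqrt (1 - pr nu diagonal).
    rewrite -[leLHS]ger0_norm ?hnorm_ge0// -sqrtr_sqr ler_wsqrtr// xle//= setXTT prT.
    by rewrite lerB.
  rewrite /x/= qT pT -/(x N) in H2.
  have -> : eta - xi = (eta - x N) - (xi - x N) by rewrite opprB addrA subrK.
  have := hnorm_leB (hs_dot K) (eta - x N) (xi - x N).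
  by move: H1 H2; rewrite hnormBC; lra.
Qed.
End diagonal_vector.

End spectral_measure.

(** * Integrals under images, and representatives in L2 *)

Section image_integral.
Context d1 d2 (X : measurableType d1) (Y : measurableType d2) (R : realType).
Variables (m : {measure set X -> \bar R}) (m' : {measure set Y -> \bar R}) (phi : X -> Y).
Hypotheses (mphi : measurable_fun setT phi)
  (mm' : forall A, measurable A -> m (phi @^-1` A) = m' A).

Lemma ge0_integral_image (f : Y -> \bar R) : measurable_fun setT f ->
  (forall y, (0 <= f y)%E) -> (\int[m']_y f y = \int[m]_x f (phi x))%E.
Proof.
move=> mf f0; have := ge0_integral_pushforward mphi m measurableT mf.
rewrite preimage_setT => <-; last by move=> x _; exact: f0.
by apply: eq_measure_integral => B mB _; rewrite -mm'.
Qed.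

Lemma integral_image (f : Y -> \bar R) : measurable_fun setT f ->
  (\int[m']_y f y = \int[m]_x f (phi x))%E.
Proof.
move=> mf; rewrite [LHS]integralE [RHS]integralE.
congr (_ - _)%E.
  rewrite (ge0_integral_image (measurable_funepos mf))//.
  by apply: eq_integral => x _; exact: (congr1 (@^~ x) (esym (funepos_comp f phi))).
rewrite (ge0_integral_image (measurable_funeneg mf))//.
by apply: eq_integral => x _; exact: (congr1 (@^~ x) (esym (funeneg_comp f phi))).
Qed.

End image_integral.

Lemma conjC_realC (R : realType) (x : R) : (x%:C)^* = x%:C :> R[i].
Proof. by apply/eqP; rewrite eq_complex/= oppr0 !eqxx. Qed.

Section L2_facts.
Context d (T : measurableType d) (R : realType) (m : {measure set T -> \bar R}).
Implicit Types u v : L2 m.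

Lemma L2_eqP u v : {ae m, forall x, L2repr u x = L2repr v x} -> u = v.
Proof. by move=> uv; rewrite -[u]L2reprK -[v]L2reprK; apply/L2classP. Qed.

Lemma L2repr_linear (a : R[i]) u v :
  {ae m, forall x, L2repr (a *: u + v) x = a * L2repr u x + L2repr v x}.
Proof.
have -> : a *: u + v = L2class (a *: L2repr u + L2repr v).
  by rewrite L2classD L2classZ !L2reprK.
exact: L2repr_ae.
Qed.

Lemma cmeasurable_repr u : cmeasurable (L2repr u).
Proof. exact: (L2fun_sqint _).1. Qed.

Lemma L2_dot_ae u v (f g : T -> R[i]) : cmeasurable f -> cmeasurable g ->
  {ae m, forall x, L2repr u x = f x} -> {ae m, forall x, L2repr v x = g x} ->
  L2dot u v = cintegral m (fun x => f x * (g x)^*).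
Proof.
move=> mf mg uf vg; apply: ae_eq_cintegral.
- by apply: cmeasurableM; [|apply: cmeasurable_conj]; exact: cmeasurable_repr.
- by apply: cmeasurableM => //; apply: cmeasurable_conj.
- by apply: filterS2 uf vg => x -> ->.
Qed.

Lemma L2_hnorm_sq u : hnorm (@L2dot _ _ _ m) u ^+ 2 =
  fine (\int[m]_x (normc (L2repr u x) ^+ 2)%:E).
Proof.
rewrite (hnorm_sq (@L2dot _ _ _ m)) /L2dot/cintegral/=; congr fine; apply: eq_integral => x _.
by rewrite normc2 reM reC imC mulrN opprK.
Qed.

End L2_facts.

(** * The operators L_f and u_theta of the algebra of the relation *)

Section relation_operators.
Context d (X : measurableType d) (R : realType).
Variables (mu : probability X R) (E : set (X * X)).
Hypotheses (hX : standard_borel R X) (hE : cmp_relation mu E).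
Local Notation nu := (rel_measure hX hE).
Local Notation M := (@rel_algebra _ _ _ mu E hX hE).
Local Notation dotN := (@L2dot _ _ _ nu).
Local Notation L := (L2mul hX hE).
Local Notation U := (L2translate hX hE).
Implicit Types (f g : Linfty mu) (u v : L2 nu).

Lemma L2mul_ae f u : {ae nu, forall z, L2repr (L f u) z = f z.1 * L2repr u z}.
Proof. exact: L2repr_ae. Qed.

Lemma L2translate_ae (theta : full_group mu E) u :
  {ae nu, forall z, L2repr (U theta u) z = L2repr u (translate theta z)}.
Proof. exact: L2repr_ae. Qed.

Lemma translate_ae (theta : full_group mu E) (P : X * X -> Prop) :
  {ae nu, forall z, P z} -> {ae nu, forall z, P (translate theta z)}.
Proof.
move=> [N [mN N0 PN]]; exists (translate theta @^-1` N); split.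
- by rewrite -[X in measurable X]setTI; exact: measurable_translate.
- by rewrite -N0; exact: (rel_measure_translate hX hE theta mN).
- by move=> z /= H; exact: PN.
Qed.

Lemma L2mul_linear f : linear (L f).
Proof.
move=> a u v; apply: L2_eqP.
near=> z.
rewrite (near (L2mul_ae f (a *: u + v)) z)// (near (L2repr_linear a u v) z)//.
rewrite (near (L2repr_linear a (L f u) (L f v)) z)// (near (L2mul_ae f u) z)//.
by rewrite (near (L2mul_ae f v) z)// mulrDr mulrCA.
Unshelve. all: end_near. Qed.

Lemma L2translate_linear theta : linear (U theta).
Proof.
move=> a u v; apply: L2_eqP.
near=> z.
rewrite (near (L2translate_ae theta (a *: u + v)) z)//.
rewrite (near (translate_ae theta (L2repr_linear a u v)) z)//.
rewrite (near (L2repr_linear a (U theta u) (U theta v)) z)//.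
by rewrite (near (L2translate_ae theta u) z)// (near (L2translate_ae theta v) z).
Unshelve. all: end_near. Qed.

Lemma L2mulM f g (h : Linfty mu) u : {ae mu, forall x, h x = f x * g x} -> L f (L g u) = L h u.
Proof.
move=> /(rel_measure_ae hX hE) hfg; apply: L2_eqP; near=> z.
rewrite (near (L2mul_ae f (L g u)) z)// (near (L2mul_ae g u) z)// (near (L2mul_ae h u) z)//.
by rewrite (near hfg z)// mulrA.
Unshelve. all: end_near. Qed.

Lemma L2mulD f g (h : Linfty mu) (a : R[i]) u : {ae mu, forall x, h x = a * f x + g x} ->
  L h u = a *: L f u + L g u.
Proof.
move=> /(rel_measure_ae hX hE) hfg; apply: L2_eqP; near=> z.
rewrite (near (L2repr_linear a (L f u) (L g u)) z)// (near (L2mul_ae f u) z)//.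
rewrite (near (L2mul_ae g u) z)// (near (L2mul_ae h u) z)//.
by rewrite (near hfg z)// mulrA -mulrDl.
Unshelve. all: end_near. Qed.

Lemma L2mul1 f u : {ae mu, forall x, f x = 1} -> L f u = u.
Proof.
move=> /(rel_measure_ae hX hE) f1; apply: L2_eqP; near=> z.
by rewrite (near (L2mul_ae f u) z)// (near f1 z)// mul1r.
Unshelve. all: end_near. Qed.

Lemma L2translateK (theta : full_group mu E) (theta' : full_group mu E) u :
  (forall x, fg_inv theta' x = theta x) -> U theta (U theta' u) = u.
Proof.
move=> tt'; apply: L2_eqP; near=> z.
rewrite (near (L2translate_ae theta (U theta' u)) z)//.
rewrite (near (translate_ae theta (L2translate_ae theta' u)) z)//.
by rewrite /translate/= tt' fg_invK; case: (z).
Unshelve. all: end_near. Qed.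

Lemma L2translate_mul (theta : full_group mu E) f g u : (forall x, g (theta x) = f x) ->
  U theta (L f u) = L g (U theta u).
Proof.
move=> gf; apply: L2_eqP; near=> z.
rewrite (near (L2translate_ae theta (L f u)) z)// (near (translate_ae theta (L2mul_ae f u)) z)//.
rewrite (near (L2mul_ae g (U theta u)) z)// (near (L2translate_ae theta u) z)//.
by rewrite /translate/= -gf fg_invK.
Unshelve. all: end_near. Qed.

Lemma L2mul_dot f u v : dotN (L f u) v = cintegral nu (fun z => f z.1 * L2repr u z * (L2repr v z)^*).
Proof.
apply: L2_dot_ae; [|exact: cmeasurable_repr|exact: L2mul_ae|exact: aeW].
by apply: cmeasurableM; [apply: cmeasurable_comp => //; exact: Linfty_measurable|exact: cmeasurable_repr].
Qed.

Lemma L2mul_adjoint f g : (forall x, g x = (f x)^*) -> adjoint dotN (L f) (L g).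
Proof.
move=> gf u v; rewrite -[LHS]/(L2dot (L f u) v) -[RHS]/(L2dot u (L g v)).
rewrite [RHS]L2dot_herm !L2mul_dot -cintegral_conj; last first.
  have := square_integrable_mul
    (square_integrable_mulL g (L2fun_sqint (L2repr v))) (L2fun_sqint (L2repr u)).
  exact.
congr cintegral; apply/funext => z; rewrite gf.
case: (f z.1) => a b; case: (L2repr u z) => c e; case: (L2repr v z) => a' b' /=.
by congr (_ +i* _); ring.
Qed.

Lemma L2translate_dot theta u v : dotN (U theta u) (U theta v) = dotN u v.
Proof.
rewrite (@L2_dot_ae _ _ _ _ _ _ (L2repr u \o translate theta) (L2repr v \o translate theta)); last 4 first.
- exact: (square_integrable_translate theta (L2fun_sqint (L2repr u))).1.
- exact: (square_integrable_translate theta (L2fun_sqint (L2repr v))).1.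
- exact: L2translate_ae.
- exact: L2translate_ae.
have [m1 m2] : cmeasurable (fun z => L2repr u z * (L2repr v z)^*).
  by apply: cmeasurableM; [|apply: cmeasurable_conj]; exact: cmeasurable_repr.
have mm := rel_measure_translate hX hE theta.
rewrite /L2dot /cintegral; congr (fine _ +i* fine _); apply/esym.
  exact: (integral_image (measurable_translate theta) mm (proj2 (measurable_EFinP _ _) m1)).
exact: (integral_image (measurable_translate theta) mm (proj2 (measurable_EFinP _ _) m2)).
Qed.

Lemma L2mul_bounded f : exists C : R, forall u, hnorm dotN (L f u) <= C * hnorm dotN u.
Proof.
have [C0 fC0] := Linfty_bounded f; pose C := Num.max C0 0.
have C0' : 0 <= C by rewrite le_max lexx orbT.
have fC : {ae mu, forall x, normc (f x) <= C}.
  by apply: filterS fC0 => x /le_trans; apply; rewrite le_max lexx.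
exists C => u; rewrite -(@ler_pXn2r _ 2)// ?nnegrE ?mulr_ge0 ?hnorm_ge0//.
rewrite exprMn !L2_hnorm_sq.
have mi (w : L2 nu) : measurable_fun setT (fun z => (normc (L2repr w z) ^+ 2)%:E).
  by apply: measurable_normc2; exact: cmeasurable_repr.
have iw (w : L2 nu) : (\int[nu]_z (normc (L2repr w z) ^+ 2)%:E)%E \is a fin_num.
  rewrite ge0_fin_numE; first exact: (L2fun_sqint (L2repr w)).2.
  by apply: integral_ge0 => z _; rewrite lee_fin sqr_ge0.
rewrite -lee_fin EFinM !fineK// -ge0_integralZl//; last 2 first.
- by move=> z _; rewrite lee_fin sqr_ge0.
- by rewrite lee_fin sqr_ge0.
apply: ae_ge0_le_integral => //.
- by move=> z _; rewrite lee_fin sqr_ge0.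
- by move=> z _; rewrite -EFinM lee_fin mulr_ge0// sqr_ge0.
- by apply: measurable_funeM; exact: mi.
near=> z => _; rewrite -EFinM lee_fin.
have -> : L2repr (L f u) z = f z.1 * L2repr u z by near: z; exact: L2mul_ae.
have H : normc (f z.1) <= C by near: z; exact: (rel_measure_ae hX hE fC).
by rewrite normcM exprMn ler_wpM2r ?sqr_ge0// lerXn2r// nnegrE normc_ge0.
Unshelve. all: end_near. Qed.

Lemma L2translate_hnorm theta u : hnorm dotN (U theta u) = hnorm dotN u.
Proof. by rewrite /hnorm; congr (Num.sqrt (re _)); exact: L2translate_dot. Qed.

Lemma fg_inv_ae (theta : full_group mu E) : {ae mu, forall x, E (x, fg_inv theta x)}.
Proof.
have [N [mN N0 EN]] := fg_ae theta.
exists (fg_inv theta @^-1` N); split.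
- by rewrite -[X in measurable X]setTI; exact: fg_inv_measurable.
- by rewrite -N0; exact: fg_inv_preserving.
- move=> x /= H; apply: EN => /= H'; apply: H.
  by apply: (cmp_sym hE); rewrite -{2}[x](fg_invK theta).
Qed.

Definition fg_inverse (theta : full_group mu E) : full_group mu E :=
  FullGroup (fg_invK theta) (fg_funK theta) (fg_inv_measurable theta)
    (fg_measurable theta) (@fg_inv_preserving _ _ _ _ _ theta) (fg_inv_ae theta).

Lemma fg_id_ae : {ae mu, forall x, E (x, id x)}.
Proof. by apply: aeW => x; exact: (cmp_refl hE). Qed.

Definition fg_id : full_group mu E :=
  FullGroup (fun=> erefl) (fun=> erefl) (@measurable_id _ _ _) (@measurable_id _ _ _)
    (fun _ _ => erefl) fg_id_ae.

Lemma L2translate_adjoint theta : adjoint dotN (U theta) (U (fg_inverse theta)).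
Proof.
move=> u v; rewrite -[LHS]/(L2dot (U theta u) v) -[RHS]/(L2dot u (U (fg_inverse theta) v)).
by rewrite -[in LHS](@L2translateK theta (fg_inverse theta) v)// L2translate_dot.
Qed.

Lemma Linfty_cst_bounded (a : R[i]) : exists C : R, {ae mu, forall x : X, normc ((fun=> a) x) <= C}.
Proof. by exists (normc a); exact: aeW. Qed.

Definition Linfty_cst (a : R[i]) : Linfty mu :=
  MkLinfty (@cmeasurable_cst _ X R a) (Linfty_cst_bounded a).

(** The composite is a single term of the span, so only boundedness remains. It is a hypothesis
    because it has a different source in each use: once theta is the identity, once f is the
    constant 1. *)
Lemma rel_algebra_gen f theta : (exists C : R, forall u, hnorm dotN (L f (U theta u)) <= C * hnorm dotN u) ->
  M (L f \o U theta).
Proof.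
move=> bd; split.
  split=> //; move=> a u v /=.
  by rewrite (L2translate_linear theta) L2mul_linear.
move=> s e e0; exists (L f \o U theta); last by move=> u _; rewrite subrr hnorm0.
exists 1%N, (fun=> 1), (fun=> L f \o U theta); split; first by move=> _; exists f, theta.
by move=> u; rewrite big_ord_recl big_ord0 scale1r addr0.
Qed.

Lemma rel_algebra_mul f : M (L f).
Proof.
have fid u : U fg_id u = u.
  apply: L2_eqP; near=> z.
  have -> : L2repr (U fg_id u) z = L2repr u (translate fg_id z) by near: z; exact: L2translate_ae.
  by case: (z).
rewrite (_ : L f = L f \o U fg_id); last by apply/funext => u /=; rewrite fid.
apply: rel_algebra_gen; have [C H] := L2mul_bounded f.
by exists C => u; rewrite fid.
Unshelve. all: end_near. Qed.

Lemma rel_algebra_translate theta : M (U theta).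
Proof.
have l1 u : L (Linfty_cst 1) u = u by apply: L2mul1; exact: aeW.
rewrite (_ : U theta = L (Linfty_cst 1) \o U theta); last by apply/funext => u /=; rewrite l1.
by apply: rel_algebra_gen; exists 1 => u; rewrite l1 L2translate_hnorm mul1r.
Qed.

Lemma cmeasurable_real (h : X -> R) : measurable_fun setT h -> cmeasurable (fun x => (h x)%:C).
Proof. by move=> mh; split=> //; exact: measurable_cst. Qed.

Lemma normc_real (a : R) : normc a%:C = `|a|.
Proof. by rewrite /= expr0n addr0 sqrtr_sqr. Qed.

Lemma Linfty_real_bounded (h : X -> R) (C : R) : (forall x, `|h x| <= C) ->
  exists C : R, {ae mu, forall x, normc ((fun x => (h x)%:C) x) <= C}.
Proof. by move=> hC; exists C; apply: aeW => x; rewrite normc_real. Qed.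

Definition Linfty_real (h : X -> R) (mh : measurable_fun setT h) (C : R)
  (hC : forall x, `|h x| <= C) : Linfty mu :=
  MkLinfty (cmeasurable_real mh) (Linfty_real_bounded hC).

Lemma indic_le1 (A : set X) x : `|\1_A x : R| <= 1.
Proof. by rewrite indicE ger0_norm// lern1 leq_b1. Qed.

(* Junk value 0 when A is not measurable. *)
Definition Linfty_indic (A : set X) : Linfty mu :=
  if pselect (measurable A) is left mA then Linfty_real (measurable_indic mA) (@indic_le1 A)
  else Linfty_cst 0.

Lemma Linfty_indicE A x : measurable A -> Linfty_indic A x = (\1_A x)%:C.
Proof. by rewrite /Linfty_indic; case: pselect. Qed.

(** The integrand is the indicator of the part of the diagonal above [A], whose fibre over x has one
    point if x is in [A] and none otherwise. *)
Lemma rel_trace_indic A : measurable A -> rel_trace (L (Linfty_indic A)) = (fine (mu A))%:C.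
Proof.
move=> mA; rewrite /rel_trace L2mul_dot.
have mD : measurable (@diagonal X) by exact: (measurable_diagonal hX).
rewrite (@ae_eq_cintegral _ _ _ nu _ (fun z => (\1_((A `*` setT) `&` diagonal) z)%:C)); last 3 first.
- by apply: cmeasurableM; [apply: cmeasurableM; [apply: cmeasurable_comp => //; exact: Linfty_measurable|]|apply: cmeasurable_conj]; exact: cmeasurable_repr.
- split; last exact: measurable_cst.
  by apply: measurable_indic; apply: measurableI => //; exact: measurableX.
- near=> z.
  have -> : L2repr (L2diag hX hE) z = (z.1 == z.2)%:R by near: z; exact: L2repr_ae.
  rewrite Linfty_indicE// !indicE.
  have -> : (z \in A `*` setT `&` diagonal) = (z.1 \in A) && (z.1 == z.2).
    apply/idP/idP; first by move=> /set_mem[[Az _] /eqP zz]; rewrite mem_set.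
    by move=> /andP[/set_mem Az /eqP zz]; apply/mem_set.
  have D (b : bool) : (b%:R : R[i]) = (b%:R : R)%:C by case: b.
  rewrite !D conjC_realC.
  case: (_ \in A); case: (_ == _);
    by apply/eqP; rewrite eq_complex/= ?(mulr1, mulr0, mul0r, subr0, addr0) !eqxx.
rewrite /cintegral/= integral0 integral_indic//; last first.
  by apply: measurableI => //; exact: measurableX.
transitivity ((fine (rel_measure hX hE (A `*` [set: X] `&` diagonal)))%:C); first by rewrite setIT.
rewrite rel_measureE.
congr ((fine _)%:C).
rewrite -[A in RHS]setIT -integral_indic//; apply: eq_integral => x _.
have [xA|xA] := boolP (x \in A); rewrite indicE.
  rewrite xA (_ : xsection _ _ = [set x]).
    by rewrite /counting asboolT// fset_set1 finmap.cardfs1.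
  apply/seteqP; split=> y; rewrite xsectionE; first by move=> [[_ xy] _]; exact: esym xy.
  by move=> ->; split; [split=> //; split=> //; exact: set_mem|exact: cmp_refl hE _].
rewrite (negbTE xA) (_ : xsection _ _ = set0) ?measure0//.
apply/seteqP; split=> // y; rewrite xsectionE => -[[[Ax _] _] _].
by move/negP : xA; apply; apply/mem_set.
Unshelve. all: end_near. Qed.

Lemma measurable_preimage_fg (t : full_group mu E) A : measurable A -> measurable (t @^-1` A).
Proof. by move=> mA; rewrite -[_ @^-1` _]setTI; exact: (fg_measurable t). Qed.

Lemma measurable_preimage_fgV (t : full_group mu E) A : measurable A -> measurable (fg_inv t @^-1` A).
Proof. by move=> mA; rewrite -[_ @^-1` _]setTI; exact: (fg_inv_measurable t). Qed.

End relation_operators.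

(** * From a pointed bimodule to a measure on the square *)

Section bimodule_measure.
Context d (X : measurableType d) (R : realType).
Variables (mu : probability X R) (E : set (X * X)).
Hypotheses (hX : standard_borel R X) (hE : cmp_relation mu E).
Local Notation nu := (rel_measure hX hE).
Local Notation M := (@rel_algebra _ _ _ mu E hX hE).
Local Notation dotN := (@L2dot _ _ _ nu).
Local Notation L := (L2mul hX hE).
Local Notation U := (L2translate hX hE).
Local Notation ind := (@Linfty_indic _ X R mu).
Variable K : hilbertSpace R.
Local Notation dot := (hs_dot K).
Local Notation hn := (hnorm (hs_dot K)).

Lemma linear_subtractive (V : lmodType R[i]) (f : V -> V) : linear f -> forall u v, f (u - v) = f u - f v.
Proof. by move=> fl u v; rewrite addrC -scaleN1r fl scaleN1r addrC. Qed.

Section one_sided.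
Variable t : (L2 nu -> L2 nu) -> K -> K.
Hypothesis ht : hilbert_module_map dotN M t.
Hypothesis t_sq : forall x, M x -> t (x \o x) = t x \o t x.

Lemma module_sub x : M x -> subtractive (t x).
Proof. by case: ht => h _ _ _ _ /h[] /linear_subtractive. Qed.

Lemma module_adj x y u v : M x -> M y -> adjoint dotN x y -> dot (t x u) v = dot u (t y v).
Proof. by case: ht => _ _ _ h _ Mx My xy; exact: h. Qed.

Lemma module_comb (a : R[i]) x y z : M x -> M y -> (forall u, z u = a *: x u + y u) ->
  forall v, t z v = a *: t x v + t y v.
Proof.
case: ht => _ h _ _ _ Mx My zE v; rewrite (_ : z = a *: x + y) ?h//.
by apply/funext => u; rewrite zE.
Qed.

Lemma module_id x : (forall u, x u = u) -> forall v, t x v = v.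
Proof. by case: ht => _ _ h _ _ xE v; rewrite (_ : x = idfun) ?h//; exact/funext. Qed.

(** With g the square root of 1 - h^2, the self-adjoint operators of h and g have squares that add
    up to 1, so the squared norm of the image of v under h is that of v minus that of its image
    under g. Only squares are multiplied, which suits the right action too, although it reverses
    products. *)
Lemma module_contract (h : Linfty mu) (v : K) :
  (forall x, exists2 a : R, h x = a%:C & `|a| <= 1) -> hn (t (L h) v) <= hn v.
Proof.
move=> h1; have [mh _] := Linfty_measurable h.
have hre x : h x = (re (h x))%:C by have [a -> _] := h1 x.
have hle x : `|re (h x)| <= 1 by have [a -> al] := h1 x.
pose g x := Num.sqrt (1 - re (h x) ^+ 2).
have h2 x : re (h x) ^+ 2 <= 1 by rewrite -real_normK ?num_real// exprn_ile1.
have mg : measurable_fun setT g.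
  apply: (@measurableT_comp _ _ _ _ _ _ (@Num.sqrt R)).
    by apply: continuous_measurable_fun; exact: sqrt_continuous.
  apply: measurable_funB; first exact: measurable_cst.
  exact: (measurable_funX 2 mh).
have gle x : `|g x| <= 1.
  rewrite ger0_norm ?sqrtr_ge0// -[leRHS]sqrtr1 ler_wsqrtr// gerBl sqr_ge0//.
pose G := Linfty_real mu mg gle.
have Mh := rel_algebra_mul hX hE h; have MG := rel_algebra_mul hX hE G.
have adjh : adjoint dotN (L h) (L h).
  by apply: L2mul_adjoint => x; rewrite hre conjC_realC.
have adjG : adjoint dotN (L G) (L G).
  by apply: L2mul_adjoint => x; rewrite conjC_realC.
have mh2 : measurable_fun setT (fun x => re (h x) ^+ 2) by exact: (measurable_funX 2 mh).
have h2le x : `|re (h x) ^+ 2| <= 1 by rewrite ger0_norm ?sqr_ge0.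
have mg2 : measurable_fun setT (fun x => g x ^+ 2) by exact: (measurable_funX 2 mg).
have g2le x : `|g x ^+ 2| <= 1.
  by rewrite ger0_norm ?sqr_ge0// sqr_sqrtr ?subr_ge0// gerBl sqr_ge0.
pose HH := Linfty_real mu mh2 h2le; pose GG := Linfty_real mu mg2 g2le.
have HHE : L HH = L h \o L h.
  apply/funext => u /=; apply/esym/L2mulM/aeW => x.
  by rewrite hre -rmorphM -expr2.
have GGE : L GG = L G \o L G.
  by apply/funext => u /=; apply/esym/L2mulM/aeW => x; rewrite -rmorphM -expr2.
have MHH := rel_algebra_mul hX hE HH; have MGG := rel_algebra_mul hX hE GG.
pose one := Linfty_cst mu 1; have M1 := rel_algebra_mul hX hE one.
have oneE u : L one u = u by apply: L2mul1; exact: aeW.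
have sumE w : t (L HH) w = w - t (L GG) w.
  have -> := @module_comb (-1) (L GG) (L one) (L HH) MGG M1 _ w.
    by rewrite (module_id oneE) scaleN1r addrC.
  move=> u; apply: L2mulD; apply: aeW => x /=.
  rewrite sqr_sqrtr ?subr_ge0// mulN1r rmorphB/= opprB subrK//.
have e1 : hn (t (L h) v) ^+ 2 = re (dot (t (L HH) v) v).
  by rewrite hnorm_sq -(module_adj _ _ Mh Mh adjh) HHE t_sq.
have e2 : hn (t (L G) v) ^+ 2 = re (dot (t (L GG) v) v).
  by rewrite hnorm_sq -(module_adj _ _ MG MG adjG) GGE t_sq.
rewrite -(@ler_pXn2r _ 2)// ?nnegrE ?hnorm_ge0// e1 sumE rdotBl -hnorm_sq -e2.
by rewrite gerBl sqr_ge0.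
Qed.
End one_sided.

Variables (l r : (L2 nu -> L2 nu) -> K -> K) (xi : K).
Hypotheses (hb : bimodule dotN M l r) (xi1 : hn xi = 1)
  (htr : tracial M (@rel_trace _ _ _ _ _ hX hE) l r xi).

Let hl : hilbert_module_map dotN M l. Proof. by case: hb => -[]. Qed.
Let hr : hilbert_module_map dotN M r. Proof. by case: hb => _ []. Qed.
Let lM x y u : M x -> M y -> l (x \o y) u = l x (l y u).
Proof. by case: hb => -[_ h] _ _ Mx My; rewrite h. Qed.
Let rM x y u : M x -> M y -> r (x \o y) u = r y (r x u).
Proof. by case: hb => _ [_ h] _ Mx My; rewrite h. Qed.
Let lr x y u : M x -> M y -> l x (r y u) = r y (l x u).
Proof. by case: hb => _ _ h Mx My; exact: (congr1 (@^~ u) (h _ _ Mx My)). Qed.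

Let ML f : M (L f). Proof. exact: rel_algebra_mul. Qed.
Let MU theta : M (U theta). Proof. exact: rel_algebra_translate. Qed.

Let p A := l (L (ind A)).
Let q A := r (L (ind A)).

Let p_sub A : measurable A -> subtractive (p A). Proof. by move=> _; exact: module_sub. Qed.
Let q_sub A : measurable A -> subtractive (q A). Proof. by move=> _; exact: module_sub. Qed.

Let ind_adj A : measurable A -> adjoint dotN (L (ind A)) (L (ind A)).
Proof. by move=> mA; apply: L2mul_adjoint => x; rewrite Linfty_indicE// conjC_realC. Qed.

Let p_adj A u v : measurable A -> dot (p A u) v = dot u (p A v).
Proof. by move=> mA; apply: module_adj => //; exact: ind_adj. Qed.
Let q_adj A u v : measurable A -> dot (q A u) v = dot u (q A v).
Proof. by move=> mA; apply: module_adj => //; exact: ind_adj. Qed.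

Let indI A B : measurable A -> measurable B -> L (ind (A `&` B)) = L (ind A) \o L (ind B).
Proof.
move=> mA mB; apply/funext => u /=; apply/esym/L2mulM/aeW => x.
by rewrite !Linfty_indicE//; [rewrite indicI rmorphM|exact: measurableI].
Qed.

Let pI A B u : measurable A -> measurable B -> p (A `&` B) u = p A (p B u).
Proof. by move=> mA mB; rewrite /p indI// lM. Qed.
Let qI A B u : measurable A -> measurable B -> q (A `&` B) u = q A (q B u).
Proof. by move=> mA mB; rewrite /q setIC indI// rM. Qed.

Let one_id u : L (Linfty_cst mu 1) u = u. Proof. by apply: L2mul1; exact: aeW. Qed.

Let indC A u : measurable A -> L (ind (~` A)) u = -1 *: L (ind A) u + L (Linfty_cst mu 1) u.
Proof.
move=> mA; apply: L2mulD; apply: aeW => x.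
rewrite !Linfty_indicE//; last exact: measurableC.
by rewrite mulN1r !indicE in_setC; case: (x \in A); rewrite ?oppr0 ?add0r ?addNr.
Qed.

Let pC A u : measurable A -> p (~` A) u = u - p A u.
Proof.
move=> mA; rewrite /p (module_comb hl (ML _) (ML _) (fun u => indC u mA)) (module_id hl one_id).
by rewrite scaleN1r addrC.
Qed.
Let qC A u : measurable A -> q (~` A) u = u - q A u.
Proof.
move=> mA; rewrite /q (module_comb hr (ML _) (ML _) (fun u => indC u mA)) (module_id hr one_id).
by rewrite scaleN1r addrC.
Qed.

Let pq A B u : measurable A -> measurable B -> p A (q B u) = q B (p A u).
Proof. by move=> mA mB; exact: lr. Qed.

Let p_xi A : measurable A -> re (dot (p A xi) xi) = fine (mu A).
Proof. by move=> mA; rewrite (htr (ML _)).1 rel_trace_indic. Qed.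
Let q_xi A : measurable A -> re (dot (q A xi) xi) = fine (mu A).
Proof. by move=> mA; rewrite (htr (ML _)).2 rel_trace_indic. Qed.

(** Conjugation of a vector by u_theta, from the left by the inverse. It is isometric, moves [xi] by
    the norm of its commutator with u_theta, and carries p A and q A to those of the preimage of A,
    as [nu_almost_invariant] requires. *)
Let W theta u := l (U (fg_inverse hE theta)) (r (U theta) u).

Let lUK (theta theta' : full_group mu E) u : (forall x, fg_inv theta' x = theta x) -> l (U theta) (l (U theta') u) = u.
Proof.
move=> tt; rewrite -lM//; apply: (module_id hl) => w /=; exact: L2translateK.
Qed.

Let l_iso theta u : hn (l (U theta) u) = hn u.
Proof.
congr (Num.sqrt (re _)).
rewrite (module_adj hl _ _ (MU theta) (MU (fg_inverse hE theta)) (@L2translate_adjoint _ _ _ _ _ hX hE theta)).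
by rewrite lUK.
Qed.

Let r_iso theta u : hn (r (U theta) u) = hn u.
Proof.
congr (Num.sqrt (re _)).
rewrite (module_adj hr _ _ (MU theta) (MU (fg_inverse hE theta)) (@L2translate_adjoint _ _ _ _ _ hX hE theta)).
rewrite -rM// (module_id hr)// => w /=; exact: L2translateK.
Qed.

Let W_sub theta : subtractive (W theta).
Proof. by move=> u v; rewrite /W (module_sub hr)// (module_sub hl). Qed.

Let W_iso theta u : hn (W theta u) = hn u.
Proof. by rewrite /W l_iso r_iso. Qed.

Let U_ind (theta : full_group mu E) A : measurable A ->
  L (ind A) \o U theta = U theta \o L (ind (theta @^-1` A)).
Proof.
move=> mA; apply/funext => u /=; apply/esym/L2translate_mul => x.
by rewrite !Linfty_indicE//; exact: measurable_preimage_fg.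
Qed.

Let Uinv_ind (theta : full_group mu E) A : measurable A ->
  U (fg_inverse hE theta) \o L (ind A) = L (ind (theta @^-1` A)) \o U (fg_inverse hE theta).
Proof.
move=> mA; apply/funext => u /=; apply/L2translate_mul => x.
rewrite !Linfty_indicE//; last exact: measurable_preimage_fg.
by rewrite !indicE /=; congr ((_ : bool)%:R%:C); apply/idP/idP => /set_mem;
  rewrite /= ?fg_invK => H; apply/mem_set; rewrite /= ?fg_invK.
Qed.

Let Wp theta A u : measurable A -> W theta (p A u) = p (theta @^-1` A) (W theta u).
Proof. by move=> mA; rewrite /W/p -lr// -!lM// Uinv_ind. Qed.

Let Wq theta A u : measurable A -> W theta (q A u) = q (theta @^-1` A) (W theta u).
Proof. by move=> mA; rewrite /W/q -rM// U_ind// rM// lr. Qed.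

Let W_xi theta : hn (xi - W theta xi) = hn (l (U theta) xi - r (U theta) xi).
Proof. by rewrite -(l_iso theta) (module_sub hl)// /W lUK. Qed.

Section central_vector.
Variable eta : K.
Hypothesis pq_eta : forall A, measurable A -> p A eta = q A eta.

Let dl (f : Linfty mu) := l (L f) eta - r (L f) eta.

Let dl_comb (a : R[i]) (f g h : Linfty mu) : {ae mu, forall x, h x = a * f x + g x} ->
  dl h = a *: dl f + dl g.
Proof.
move=> hfg; have H (u : L2 nu) := L2mulD u hfg.
rewrite /dl (module_comb hl (ML f) (ML g) H) (module_comb hr (ML f) (ML g) H).
by rewrite scalerBr opprD addrACA.
Qed.

Let dl_ind A : measurable A -> dl (ind A) = 0.
Proof. by move=> mA; rewrite /dl -/(p A eta) -/(q A eta) pq_eta// subrr. Qed.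

Let unit_abs (h : X -> R) : (forall x, 0 <= h x <= 1) -> forall x, `|h x| <= 1.
Proof. by move=> h01 x; have /andP[h0 h1] := h01 x; rewrite ger0_norm. Qed.

(** Each step removes one binary digit: the indicator of the digit set commutes with [eta], so the
    commutator of [h] is half of that of the remaining expansion. [module_contract] bounds any such
    commutator by twice the norm of [eta]. *)
Let dl_unit n (h : X -> R) (mh : measurable_fun setT h) (h01 : forall x, 0 <= h x <= 1)
    (hC : forall x, `|h x| <= 1) :
  hn (dl (Linfty_real mu mh hC)) <= 2^-1 ^+ n * (2 * hn eta).
Proof.
elim: n h mh h01 hC => [|n IH] h mh h01 hC.
  rewrite expr0 mul1r; apply: le_trans (hnorm_leB _ _ _) _.
  rewrite mulr_natl mulr2n lerD// module_contract//.
  - by move=> x Mx; case: hb => -[_ h'] _ _; exact: h'.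
  - by move=> x; exists (h x).
  - by move=> x Mx; case: hb => _ [_ h'] _; exact: h'.
  - by move=> x; exists (h x).
have [A [h1 [mA mh1 h101 hdig]]] := binary_digit mh h01.
have IH1 := IH _ mh1 h101 (unit_abs h101).
pose f1 := Linfty_real mu mh1 (unit_abs h101).
pose k x := h1 x + \1_A x.
have mk : measurable_fun setT k by apply: measurable_funD => //; exact: measurable_indic.
have kC x : `|k x| <= 2.
  have -> : k x = 2 * h x by rewrite hdig mulVKf// addrC.
  by rewrite normrM ger0_norm// ler_piMr.
pose fk := Linfty_real mu mk kC.
have e1 : dl fk = 1 *: dl f1 + dl (ind A).
  by apply: dl_comb; apply: aeW => x; rewrite mul1r Linfty_indicE// -rmorphD.
have e2 : dl (Linfty_real mu mh hC) = (2^-1)%:C *: dl fk + dl (ind set0).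
  apply: dl_comb; apply: aeW => x; rewrite Linfty_indicE// indicE in_set0 addr0 -rmorphM/=.
  by congr (_%:C); rewrite hdig /k addrC.
rewrite e2 e1 !dl_ind// scale1r !addr0 hnormZ exprS -mulrA ger0_norm ?invr_ge0//.
by rewrite ler_wpM2l ?invr_ge0.
Qed.

Let dl_unit0 (h : X -> R) (mh : measurable_fun setT h) (h01 : forall x, 0 <= h x <= 1)
    (hC : forall x, `|h x| <= 1) : dl (Linfty_real mu mh hC) = 0.
Proof.
apply: (@hnorm_eq0 _ _ (hs_dot K)); apply/eqP; rewrite eq_le hnorm_ge0 andbT.
exact: geometric_le0 (fun n => dl_unit n mh h01 hC).
Qed.

Lemma central_of_indic : central (@Linfty_algebra _ _ _ _ _ hX hE) l r eta.
Proof.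
move=> _ [f _ <-]; apply/eqP; rewrite -subr_eq0; apply/eqP; rewrite -/(dl f).
have [mf1 mf2] := Linfty_measurable f.
have [C0 fC0] := Linfty_bounded f; pose C := Num.max C0 1.
have C1 : 1 <= C by rewrite le_max lexx orbT.
have Cp : 0 < C by apply: lt_le_trans C1.
have fC : {ae mu, forall x, normc (f x) <= C}.
  by apply: filterS fC0 => x /le_trans; apply; rewrite le_max lexx.
(* [f] is bounded only almost everywhere. Clamping the affine rescaling to [0,1] gives functions
   bounded everywhere that determine [f] almost everywhere. *)
pose cl (y : R) := Num.max 0 (Num.min 1 ((y / C + 1) / 2)).
have cl01 y : 0 <= cl y <= 1.
  by rewrite /cl le_max lexx/= ge_max ler01/= ge_min lexx.
have clE y : `|y| <= C -> y = 2 * C * cl y - C.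
  move=> yC; have : `|y / C| <= 1 by rewrite normrM normfV (gtr0_norm Cp) ler_pdivrMr// mul1r.
  rewrite ler_norml => /andP[y1 y2]; rewrite /cl min_r; last by lra.
  rewrite max_r; last by lra.
  by field; rewrite gt_eqF.
have mcl (g : X -> R) : measurable_fun setT g -> measurable_fun setT (fun x => cl (g x)).
  move=> mg; apply: measurable_maxr => //; apply: measurable_minr => //.
  by apply: measurable_funM => //; apply: measurable_funD => //; exact: measurable_funM.
pose h1 x := cl (re (f x)); pose h2 x := cl (im (f x)).
have mh1 : measurable_fun setT h1 by exact: (mcl (re \o f)).
have mh2 : measurable_fun setT h2 by exact: (mcl (im \o f)).
have h101 x : 0 <= h1 x <= 1 by exact: cl01.
have h201 x : 0 <= h2 x <= 1 by exact: cl01.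
pose f1 := Linfty_real mu mh1 (unit_abs h101).
pose f2 := Linfty_real mu mh2 (unit_abs h201).
have cmb (a : R[i]) (u v : Linfty mu) : exists w : Linfty mu, forall x, w x = a * u x + v x.
  have mw : cmeasurable (fun x => a * u x + v x).
    apply: (@cmeasurableD _ _ _ (fun x => a * u x) v); last exact: Linfty_measurable.
    by apply: (@cmeasurableM _ _ _ (fun=> a) u); [exact: cmeasurable_cst|exact: Linfty_measurable].
  have [Cu hu] := Linfty_bounded u; have [Cv hv] := Linfty_bounded v.
  have bw : exists C : R, {ae mu, forall x, normc (a * u x + v x) <= C}.
    exists (normc a * Cu + Cv); apply: filterS2 hu hv => x ux vx.
    apply: (le_trans (le_normcD _ _)); rewrite lerD// normcM ler_wpM2l//.
    exact: normc_ge0.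
  by exists (MkLinfty mw bw).
(* Almost everywhere f = 2C f1 + 2Ci f2 - (C + iC). The constant is a multiple of the indicator of
   the whole space, and the indicator of the empty set ends the chain of combinations. *)
have [g2 g2E] := cmb (- (C +i* C)) (ind setT) (ind set0).
have [g1 g1E] := cmb ((2 * C)%:C * 'i) f2 g2.
have -> : dl f = (2 * C)%:C *: dl f1 + dl g1.
  apply: dl_comb; apply: filterS fC => x fx.
  rewrite g1E g2E !Linfty_indicE// !indicE in_setT in_set0.
  have fr : `|re (f x)| <= C by exact: le_trans (re_le_normc _) fx.
  have fi : `|im (f x)| <= C by exact: le_trans (im_le_normc _) fx.
  apply/eqP; rewrite eq_complex; apply/andP; split; apply/eqP.
    by rewrite {1}(clE _ fr) /= /h1 /h2; ring.
  by rewrite {1}(clE _ fi) /= /h1 /h2; ring.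
rewrite (dl_comb (aeW _ g1E)) (dl_comb (aeW _ g2E)) !dl_unit0// !dl_ind//.
by rewrite !scaler0 !addr0.
Qed.

End central_vector.

(** This is all that is retained of the bimodule; the constructions after it deal with measures on
    the square only. *)
Lemma bimodule_measure : exists lam : probability (X * X)%type R,
  [/\ forall A, measurable A -> lam (A `*` setT) = mu A /\ lam (setT `*` A) = mu A,
      forall A, measurable A -> fine (lam (A `*` ~` A)) <= hn (l (L (ind A)) xi - r (L (ind A)) xi) ^+ 2,
      forall (theta : full_group mu E) S, measurable S ->
        `|fine (lam ((fun z => (theta z.1, theta z.2)) @^-1` S)) - fine (lam S)| <=
        2 * hn (l (U theta) xi - r (U theta) xi) &
      exists2 eta : K, central (@Linfty_algebra _ _ _ _ _ hX hE) l r eta &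
        hn (eta - xi) ^+ 2 <= fine (lam (~` diagonal))].
Proof.
have [lam lamE] := spectral_measure_exists hX p_sub q_sub p_adj q_adj pI qI pC qC pq p_xi q_xi.
have indT u : L (ind setT) u = u.
  by apply: L2mul1; apply: aeW => x; rewrite Linfty_indicE// indicE in_setT.
have qT u : q setT u = u by exact: (module_id hr indT).
have pT u : p setT u = u by exact: (module_id hl indT).
exists lam; split.
- by move=> A mA; rewrite !lamE// qT pT p_xi// q_xi// fineK// fin_num_measure.
- exact: (nu_commutator p_sub q_sub p_adj q_adj pI qI pC qC pq lamE).
- move=> theta S mS; rewrite -W_xi.
  exact: (nu_almost_invariant p_sub q_sub p_adj q_adj pI qI pC qC pq lamE (fg_measurable theta)
    (W_sub theta) (W_iso theta) (@Wp theta) (@Wq theta) xi1).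
- have [B [mB _ sepB]] := standard_borel_generator hX.
  have [eta [h1 h2]] := diagonal_vector_exists hX p_sub q_sub p_adj q_adj pI qI pC qC pq lamE mB sepB xi1.
  by exists eta => //; exact: central_of_indic.
Qed.

End bimodule_measure.

(** * Integrals of bounded functions, and passage from sets to functions *)

Section bounded_measurable.
Context d (T : measurableType d) (R : realType).
Implicit Types f g : T -> R.

Definition bmeas f := measurable_fun setT f /\ exists B : R, forall x, `|f x| <= B.

Lemma bmeas_cst (c : R) : bmeas (fun=> c).
Proof. by split; [exact: measurable_cst|exists `|c|]. Qed.

Lemma bmeas_indic A : measurable A -> bmeas (\1_A).
Proof.
move=> mA; split; first exact: measurable_indic.
by exists 1 => x; rewrite indicE ger0_norm// lern1 leq_b1.
Qed.

Lemma bmeasD f g : bmeas f -> bmeas g -> bmeas (fun x => f x + g x).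
Proof.
move=> [mf [B fB]] [mg [C gC]]; split; first exact: measurable_funD.
by exists (B + C) => x; rewrite (le_trans (ler_normD _ _))// lerD.
Qed.

Lemma bmeasM f g : bmeas f -> bmeas g -> bmeas (fun x => f x * g x).
Proof.
move=> [mf [B fB]] [mg [C gC]]; split; first exact: measurable_funM.
by exists (B * C) => x; rewrite normrM ler_pM.
Qed.

Lemma bmeasZ (c : R) f : bmeas f -> bmeas (fun x => c * f x).
Proof. by move=> bf; apply: bmeasM => //; exact: bmeas_cst. Qed.

Lemma bmeasB f g : bmeas f -> bmeas g -> bmeas (fun x => f x - g x).
Proof.
move=> bf bg; rewrite (_ : (fun x => _) = fun x => f x + (-1) * g x).
  by apply: bmeasD => //; exact: bmeasZ.
by apply/funext => x; rewrite mulN1r.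
Qed.

Lemma bmeas_norm f : bmeas f -> bmeas (fun x => `|f x|).
Proof.
move=> [mf [B fB]]; split; first exact: measurableT_comp.
by exists B => x; rewrite normr_id.
Qed.

Lemma bmeas01 f : measurable_fun setT f -> (forall x, 0 <= f x <= 1) -> bmeas f.
Proof.
by move=> mf f01; split=> //; exists 1 => x; have /andP[f0 f1] := f01 x; rewrite ger0_norm.
Qed.

Variable m : probability T R.

Lemma bmeas_integrable f : bmeas f -> m.-integrable setT (EFin \o f).
Proof.
move=> [mf [B fB]]; apply: measurable_bounded_integrable => //.
  by rewrite ltey_eq fin_num_measure.
by exists B; split; [exact: num_real|move=> M BM x _ /=; rewrite (le_trans (fB x))// ltW].
Qed.

Definition Int f : R := (\int[m]_x f x)%R.

Lemma IntD f g : bmeas f -> bmeas g -> Int (fun x => f x + g x) = Int f + Int g.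
Proof. by move=> /bmeas_integrable bf /bmeas_integrable bg; exact: RintegralD. Qed.

Lemma IntB f g : bmeas f -> bmeas g -> Int (fun x => f x - g x) = Int f - Int g.
Proof. by move=> /bmeas_integrable bf /bmeas_integrable bg; exact: RintegralB. Qed.

Lemma IntZ c f : bmeas f -> Int (fun x => c * f x) = c * Int f.
Proof. by move=> /bmeas_integrable bf; exact: RintegralZl. Qed.

Lemma Int_le f g : bmeas f -> bmeas g -> (forall x, f x <= g x) -> Int f <= Int g.
Proof.
by move=> /bmeas_integrable bf /bmeas_integrable bg fg; apply: le_Rintegral.
Qed.

Lemma Int_ge0 f : (forall x, 0 <= f x) -> 0 <= Int f.
Proof. by move=> f0; exact: Rintegral_ge0. Qed.

Lemma Int_indic A : measurable A -> Int \1_A = pr m A.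
Proof. by move=> mA; rewrite /Int/Rintegral integral_indic// setIT. Qed.

Lemma Int_cst c : Int (fun=> c) = c.
Proof. by rewrite /Int Rintegral_cst// [fine _](prT m) mulr1. Qed.

Lemma Int_norm f : bmeas f -> `|Int f| <= Int (fun x => `|f x|).
Proof. by move=> /bmeas_integrable bf; apply: le_normr_Rintegral. Qed.

Lemma Int01 f : measurable_fun setT f -> (forall x, 0 <= f x <= 1) -> 0 <= Int f <= 1.
Proof.
move=> mf f01; rewrite Int_ge0 => [|x]; last by case/andP: (f01 x).
by rewrite -(Int_cst 1) Int_le//; [exact: bmeas01|exact: bmeas_cst|move=> x; case/andP: (f01 x)].
Qed.

End bounded_measurable.

Section dyadic.
Context d (T : measurableType d) (R : realType).

(* The sets s k are the first n binary digits of h; they do not depend on J, so one finite family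
   serves all the functionals attached to a sequence of measures. *)
Lemma dyadic_bound (n : nat) (h : T -> R) : measurable_fun setT h -> (forall x, 0 <= h x <= 1) ->
  exists s : nat -> set T, (forall k, measurable (s k)) /\
  forall (J : (T -> R) -> R) (B e : R), 0 <= e ->
    (forall (A : set T) (h1 : T -> R), measurable A -> measurable_fun setT h1 -> (forall x, 0 <= h1 x <= 1) ->
      J (fun x => 2^-1 * (\1_A x + h1 x)) <= 2^-1 * (J \1_A + J h1)) ->
    (forall h1 : T -> R, measurable_fun setT h1 -> (forall x, 0 <= h1 x <= 1) -> J h1 <= B) ->
    (forall k, (k < n)%N -> J \1_(s k) <= e) -> J h <= e + 2^-1 ^+ n * B.
Proof.
elim: n h => [|n IH] h mh h01.
  exists (fun=> set0); split=> // J B e e0 _ JB _.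
  by rewrite expr0 mul1r (le_trans (JB _ mh h01))// lerDr.
have [A [h1 [mA mh1 h101 hE]]] := binary_digit mh h01.
have [s [ms Hs]] := IH _ mh1 h101.
exists (fun k => if k is k'.+1 then s k' else A); split; first by case.
move=> J B e e0 Jhalf JB Je.
have J1 := Hs J B e e0 Jhalf JB (fun k kn => Je k.+1 kn).
have J2 := Je 0%N isT; have J3 := Jhalf _ _ mA mh1 h101.
rewrite -hE in J3; rewrite exprS -mulrA; move: J1 J2 J3.
by set b := _ * B; set j1 := J _; set j2 := J _; set j3 := J _; lra.
Qed.

(** Meant for [J] the absolute difference of two linear functionals, which satisfies the halving
    hypothesis. [D] may be crude, since its share is divided by 2^n with n arbitrary. *)
Lemma dyadic_le (J : (T -> R) -> R) (D e : R) (h : T -> R) :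
  measurable_fun setT h -> (forall x, 0 <= h x <= 1) -> 0 <= e ->
  (forall (A : set T) (h1 : T -> R), measurable A -> measurable_fun setT h1 -> (forall x, 0 <= h1 x <= 1) ->
      J (fun x => 2^-1 * (\1_A x + h1 x)) <= 2^-1 * (J \1_A + J h1)) ->
  (forall h1 : T -> R, measurable_fun setT h1 -> (forall x, 0 <= h1 x <= 1) -> J h1 <= D) ->
  (forall A, measurable A -> J \1_A <= e) -> J h <= e.
Proof.
move=> mh h01 e0 Jhalf JD J0; rewrite -subr_le0.
apply: (@geometric_le0 _ _ D) => n.
have [s [ms Hs]] := dyadic_bound n mh h01.
by rewrite lerBlDl; apply: (Hs J D e e0 Jhalf JD) => k _; exact: J0.
Qed.

End dyadic.

(** * Bounded densities *)

Section density.
Context d (T : measurableType d) (R : realType) (mu : probability T R).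

(** Truncating the Radon-Nikodym density at [C] makes the bound hold everywhere. It alters the
    density on a null set only: where the density is at least C + 1/(k+1), a set of positive measure
    would contradict the domination. *)
Lemma bounded_density (rho : probability T R) (C : R) : 0 <= C ->
  (forall A, measurable A -> pr rho A <= C * pr mu A) ->
  exists h : T -> R, [/\ measurable_fun setT h, forall x, 0 <= h x <= C &
    forall A, measurable A -> pr rho A = Int mu (fun x => \1_A x * h x)].
Proof.
move=> C0 dom.
have ac : rho `<< mu.
  apply/null_content_dominatesP => A mA A0; have := dom A mA.
  rewrite A0 mulr0 => h; rewrite (prE rho mA); congr (_%:E); apply/eqP.
  by rewrite eq_le h pr_ge0.
have [f [f0 ff fi fE]] := radon_nikodym_sigma_finite ac.
pose g x := fine (f x).
have fg x : f x = (g x)%:E by rewrite /g fineK.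
have g0 x : 0 <= g x by rewrite fine_ge0.
have mg : measurable_fun setT g.
  by apply/measurable_EFinP; case/integrableP : fi => mf _; apply: eq_measurable_fun mf => x _; exact: fg.
pose h x := Num.min (g x) C.
have mh : measurable_fun setT h by apply: measurable_minr => //; exact: measurable_cst.
have mf : measurable_fun setT f by case/integrableP : fi.
pose D k := [set x | C + k.+1%:R^-1 <= g x].
have mD k : measurable (D k).
  by rewrite -[D k]setTI; apply: measurable_fun_le => //; exact: measurable_cst.
have D0 k : mu (D k) = 0%E.
  have k0 : 0 < k.+1%:R^-1 :> R by [].
  have H : ((C + k.+1%:R^-1)%:E * mu (D k) <= rho (D k))%E.
    rewrite fE// -integral_cst//; apply: ge0_le_integral => //.
    - by move=> x _; rewrite lee_fin addr_ge0// ltW.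
    - exact: measurable_funTS.
    - by move=> x Dx; rewrite fg lee_fin.
  rewrite (prE mu (mD k)) (prE rho (mD k)) -EFinM lee_fin in H.
  have := le_trans H (dom _ (mD k)); rewrite mulrDl gerDl => H1.
  rewrite (prE mu (mD k)); congr (_%:E); apply/eqP; rewrite eq_le pr_ge0 andbT.
  by rewrite -(pmulr_rle0 _ k0).
have hg : {ae mu, forall x, h x = g x}.
  exists (\bigcup_k D k); split.
  - exact: bigcup_measurable.
  - exact: measure_bigcup_null.
  - move=> x /= /eqP hx; have Cg : C < g x.
      by rewrite ltNge; apply/negP => gC; move/eqP: hx; apply; rewrite /h min_l.
    have [k kC] := ltr_add_invr Cg; exists k => //=; exact: ltW.
exists h; split=> //.
  by move=> x; rewrite /h le_min g0 C0/= ge_min lexx orbT.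
move=> A mA; rewrite fE// integral_mkcond /Int/Rintegral; congr fine.
apply: ae_eq_integral => //.
- by apply/(measurable_restrictT _ _).1 => //; exact: measurable_funTS.
- by apply/measurable_EFinP; apply: measurable_funM => //; exact: measurable_indic.
apply: filterS hg => x hx _; rewrite patchE indicE fg hx.
by case: (x \in A); rewrite ?mul1r ?mul0r.
Qed.

(** [dyadic_le] with error 0 extends the equality from sets to [0,1]-valued functions; a bounded [f]
    is an affine image of one of these, and the constant term is compared on the whole space. *)
Lemma density_Int d' (T' : measurableType d') (om : probability T' R) (phi : T' -> T)
    (h : T -> R) (f : T -> R) : measurable_fun setT phi -> bmeas h ->
  (forall A, measurable A -> pr om (phi @^-1` A) = Int mu (fun x => \1_A x * h x)) ->
  bmeas f -> Int om (fun z => f (phi z)) = Int mu (fun x => f x * h x).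
Proof.
move=> mphi bh omA.
have bphi (g : T -> R) : bmeas g -> bmeas (fun z => g (phi z)).
  by move=> [mg [B gB]]; split; [exact: measurableT_comp|exists B].
suff H01 (g : T -> R) : measurable_fun setT g -> (forall x, 0 <= g x <= 1) ->
    Int om (fun z => g (phi z)) = Int mu (fun x => g x * h x).
  move=> [mf [B0 fB0]]; pose B := Num.max B0 1.
  have Bp : 0 < B by rewrite lt_max ltr01 orbT.
  have fB x : `|f x| <= B by rewrite (le_trans (fB0 x))// le_max lexx.
  pose g x := (f x / B + 1) / 2.
  have mg : measurable_fun setT g.
    by apply: measurable_funM => //; apply: measurable_funD => //; exact: measurable_funM.
  have g01 x : 0 <= g x <= 1.
    have : `|f x / B| <= 1 by rewrite normrM normfV (gtr0_norm Bp) ler_pdivrMr// mul1r.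
    by rewrite /g ler_norml => /andP[? ?]; apply/andP; split; lra.
  have fE x : f x = 2 * B * g x - B by rewrite /g; field; rewrite gt_eqF.
  have bg := bmeas01 mg g01.
  rewrite (_ : (fun z => f (phi z)) = fun z => 2 * B * g (phi z) - B); last first.
    by apply/funext => z; rewrite fE.
  rewrite (_ : (fun x => f x * h x) = fun x => 2 * B * (g x * h x) - B * (\1_setT x * h x)); last first.
    apply/funext => z; rewrite [in LHS]fE indicE in_setT/=; move: (g z) (h z) => a b; ring.
  have b1 := bmeasM (bmeas_indic R measurableT) bh.
  rewrite IntB; [|exact/bmeasZ/bphi|exact: bmeas_cst].
  rewrite [RHS]IntB; [|exact/bmeasZ/bmeasM|exact: bmeasZ].
  rewrite !IntZ//; [|exact: bmeasM|exact: bphi].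
  by rewrite H01// Int_cst -omA// preimage_setT prT mulr1.
move=> mg g01.
pose J (u : T -> R) := `|Int om (fun z => u (phi z)) - Int mu (fun x => u x * h x)|.
apply/eqP; rewrite -subr_eq0 -normr_le0 -/(J g).
have [_ [Bh hB]] := bh.
apply: (@dyadic_le _ _ _ J (1 + Int mu (fun x => `|h x|)) 0 g mg g01 (lexx 0)).
- move=> A h1 mA mh1 h101; rewrite /J.
  have b1 := bmeas_indic R mA; have b2 := bmeas01 mh1 h101.
  have -> : Int om (fun z => 2^-1 * (\1_A (phi z) + h1 (phi z))) =
      2^-1 * (Int om (fun z => \1_A (phi z)) + Int om (fun z => h1 (phi z))).
    by rewrite IntZ; [rewrite IntD//; exact: bphi|apply: bmeasD; exact: bphi].
  have -> : Int mu (fun x => 2^-1 * (\1_A x + h1 x) * h x) =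
      2^-1 * (Int mu (fun x => \1_A x * h x) + Int mu (fun x => h1 x * h x)).
    rewrite -IntD; [|exact: bmeasM|exact: bmeasM].
    rewrite -IntZ; last by apply: bmeasD; exact: bmeasM.
    by congr Int; apply/funext => x; ring.
  rewrite -mulrBr normrM ger0_norm ?invr_ge0// ler_pM2l ?invr_gt0//.
  by rewrite opprD addrACA ler_normD.
- move=> h1 mh1 h101; rewrite /J.
  have b2 := bmeas01 mh1 h101.
  apply: (le_trans (ler_normB _ _)); apply: lerD.
    have /andP[i0 i1] := @Int01 _ _ _ om (fun z => h1 (phi z)) (measurableT_comp mh1 mphi) (fun z => h101 (phi z)).
    by rewrite ger0_norm.
  apply: (le_trans (Int_norm _ (bmeasM b2 bh))); apply: Int_le.
  + exact/bmeas_norm/bmeasM.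
  + exact: bmeas_norm.
  + move=> x; have /andP[a0 a1] := h101 x.
    by rewrite normrM (ger0_norm a0) ler_piMl.
- move=> A mA; rewrite /J -omA// (_ : (fun z => _) = \1_(phi @^-1` A)); last first.
    by apply/funext => z; rewrite !indicE.
  rewrite Int_indic ?subrr ?normr0//.
  by rewrite -[X in measurable X]setTI; exact: mphi.
Qed.

End density.

(** * Uniqueness of invariant probabilities *)

Section ergodicity.
Context d (X : measurableType d) (R : realType) (mu : probability X R) (E : set (X * X)).
Hypothesis hE : cmp_relation mu E.

(** The acting group consists of bijections defined everywhere, so its graphs exhaust [E] exactly
    and not merely up to null sets. *)
Lemma full_group_enum : exists th : nat -> full_group mu E,
  forall x y, E (x, y) <-> exists k, y = th k x.
Proof.
have [G [a [cG [a1 aM ma pa] aE]]] := cmp_action hE.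
have aK g : cancel (a g) (a g^-1%g).
  by move=> x; rewrite -[LHS]/((a g^-1%g \o a g) x) -aM mulVg a1.
have aVK g : cancel (a g^-1%g) (a g).
  by move=> x; rewrite -[LHS]/((a g \o a g^-1%g) x) -aM mulgV a1.
have ae g : {ae mu, forall x, E (x, a g x)}.
  by apply: aeW => x; apply/aE; exists g.
pose F g : full_group mu E := FullGroup (aK g) (aVK g) (ma g) (ma g^-1%g) (pa g) (ae g).
move: cG => /pfcard_geP[G0|[e]].
  by have : [set: G] 1%g by []; rewrite G0.
exists (fun k => F (e k)) => x y; rewrite aE; split=> [[g ->]|[k ->]]; last by exists (e k).
have [k _ <-] : (e @` setT) g by rewrite image_eq.
by exists k.
Qed.

Variable th : nat -> full_group mu E.
Hypothesis thE : forall x y, E (x, y) <-> exists k, y = th k x.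

(** Let B' be the set where the density exceeds 1: [rho] exceeds [mu] on its non-null subsets, but
    on no subset of the complement. A piece outside B' that some [th k] moves into B' is null, since
    invariance carries the inequality rho <= mu along with it. So B' is invariant up to null sets.
    If it is null then rho <= mu, which forces equality of two probabilities; it cannot be co-null
    because [rho] has mass 1. *)
Lemma invariant_probability_eq (rho : probability X R) (C : R) : ergodic mu E -> 0 <= C ->
  (forall A, measurable A -> pr rho A <= C * pr mu A) ->
  (forall k A, measurable A -> pr rho (th k @^-1` A) = pr rho A) ->
  forall A, measurable A -> pr rho A = pr mu A.
Proof.
move=> erg C0 dom inv.
have [h [mh hC hA]] := bounded_density C0 dom.
have bh : bmeas h.
  by split=> //; exists C => x; have /andP[h0 h1] := hC x; rewrite ger0_norm.
have null A : measurable A -> pr mu A <= 0 -> mu A = 0%E.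
  by move=> mA A0; rewrite (prE mu mA); congr (_%:E); apply/eqP; rewrite eq_le A0 pr_ge0.
have diffE D : measurable D -> pr rho D - pr mu D = Int mu (fun x => \1_D x * (h x - 1)).
  move=> mD; rewrite hA// -(Int_indic mu mD) -IntB.
  - by congr Int; apply/funext => x; rewrite mulrBr mulr1.
  - by apply: bmeasM => //; exact: bmeas_indic.
  - exact: bmeas_indic.
have bD D : measurable D -> bmeas (fun x => \1_D x * (h x - 1)).
  by move=> mD; apply: bmeasM; [exact: bmeas_indic|apply: bmeasB => //; exact: bmeas_cst].
pose B' := [set x | 1 < h x].
have mB' : measurable B'.
  rewrite (_ : B' = ~` [set x | h x <= 1]).
    by apply: measurableC; rewrite -[X in measurable X]setTI; apply: measurable_fun_le => //; exact: measurable_cst.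
  by apply/seteqP; split=> x; rewrite /B'/= ltNge => /negP.
have strict D : measurable D -> D `<=` B' -> pr rho D <= pr mu D -> mu D = 0%E.
  move=> mD DB rD; pose Dj j := D `&` [set x | 1 + j.+1%:R^-1 <= h x].
  have mDj j : measurable (Dj j).
    apply: measurableI => //; rewrite -[X in measurable X]setTI.
    by apply: measurable_fun_le => //; exact: measurable_cst.
  have -> : D = \bigcup_j Dj j.
    apply/seteqP; split=> [x Dx|x [j _ []]//].
    have [j jh] := ltr_add_invr (DB _ Dx); exists j => //; split=> //=; exact: ltW.
  apply: measure_bigcup_null => // j; apply: null => //.
  have j0 : 0 < j.+1%:R^-1 :> R by [].
  rewrite -(pmulr_rle0 _ j0) -(Int_indic mu (mDj j)) -IntZ; last exact: bmeas_indic.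
  apply: (@le_trans _ _ (pr rho D - pr mu D)); last by rewrite subr_le0.
  rewrite diffE//; apply: Int_le; [exact/bmeasZ/bmeas_indic|exact: bD|move=> x].
  rewrite !indicE; have [Dx|NDx] := pselect (D x); last first.
    by rewrite !memNset ?mulr0 ?mul0r// => -[].
  rewrite (mem_set Dx) mul1r; have := DB _ Dx; rewrite /B'/= => hx1.
  have [Djx|NDjx] := pselect (Dj j x).
    by rewrite mem_set// mulr1; have [_ /=] := Djx; rewrite lerBrDl.
  by rewrite memNset// mulr0 subr_ge0 ltW.
have weak D : measurable D -> D `<=` ~` B' -> pr rho D <= pr mu D.
  move=> mD DB; rewrite -subr_le0 diffE// -[leRHS](Int_cst mu 0).
  apply: Int_le; [exact: bD|exact: bmeas_cst|move=> x].
  rewrite indicE; have [Dx|NDx] := pselect (D x); last by rewrite memNset ?mul0r.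
  by rewrite mem_set// mul1r subr_le0; have := DB _ Dx; rewrite /B'/= => /negP; rewrite -leNgt.
(* [ergodic] speaks of exactly invariant sets, so B' is replaced by its saturation. *)
pose B := \bigcup_k (th k @^-1` B').
have mk k : measurable (th k @^-1` B') by exact: measurable_preimage_fg.
have mB : measurable B by exact: bigcup_measurable.
have B'B : B' `<=` B.
  move=> x B'x; have /thE[k xk] := cmp_refl hE x.
  by exists k => //=; rewrite -xk.
have Bnull : mu (B `\` B') = 0%E.
  rewrite (_ : B `\` B' = \bigcup_k (th k @^-1` B' `\` B')); last first.
    by rewrite /B setDE setI_bigcupl.
  apply: measure_bigcup_null => [k|k]; first exact: measurableD.
  set D := _ `\` _; have mD : measurable D by exact: measurableD.
  pose D' := fg_inv (th k) @^-1` D.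
  have mD' : measurable D' by exact: measurable_preimage_fgV.
  have DE : th k @^-1` D' = D.
    by apply/seteqP; split=> x; rewrite /D'/= fg_funK.
  rewrite -DE fg_preserving//; apply: strict => //.
    by move=> y [/=]; rewrite fg_invK.
  rewrite -(inv k _ mD') -(fg_preserving (th k) mD') DE; apply: weak => //.
  by move=> x [].
have [] := erg B mB.
- move=> x y xy [k _ /= B'x].
  have /thE[j yj] : E (y, th k x).
    by apply: (cmp_trans hE (cmp_sym hE xy)); apply/thE; exists k.
  by exists j => //=; rewrite -yj.
- move=> B0; have B'0 : mu B' = 0%E.
    by apply/eqP; rewrite eq_le measure_ge0 andbT -B0 le_measure ?inE.
  have le A : measurable A -> pr rho A <= pr mu A.
    move=> mA; rewrite (prID rho mA mB').
    have mI := measurableI _ _ mA mB'; have mS := measurableD mA mB'.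
    have -> : pr rho (A `&` B') = 0.
      apply/eqP; rewrite eq_le pr_ge0 andbT; apply: (le_trans (dom _ mI)).
      have : pr mu (A `&` B') <= 0 by have := @pr_le _ _ _ mu _ _ mI mB' (@subIsetr _ _ _); rewrite B'0.
      by move=> ?; rewrite mulr_ge0_le0.
    rewrite add0r; apply: le_trans (weak _ mS _) _; first by move=> x [].
    by apply: pr_le => // x [].
  move=> A mA; apply/eqP; rewrite eq_le le//=.
  have := le _ (measurableC mA); rewrite !prC//; lra.
- move=> NB0.
  have B1 : pr mu B = 1 by have := prC mu mB; rewrite NB0/=; lra.
  have B'1 : pr mu B' = 1.
    have := prID mu mB mB'; rewrite Bnull (setIidr B'B) B1/=; lra.
  have B'n0 : mu B' <> 0%E by move=> B0; move: B'1; rewrite B0/= => /esym/eqP; rewrite oner_eq0.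
  by exfalso; apply: B'n0; apply: strict => //; rewrite B'1 pr_le1.
Qed.

End ergodicity.

(** The limit is the supremum of the t that lie below U-almost all terms; an ultrafilter decides
    each such condition. *)
Lemma ultra_limit (R : realType) (U : set_system nat) (a : nat -> R) : UltraFilter U ->
  (forall n, 0 <= a n <= 1) ->
  exists x, forall e, 0 < e -> U [set n | `|a n - x| <= e].
Proof.
move=> UU a01; pose S := [set t : R | U [set n | t <= a n]].
have S0 : S 0 by rewrite /S/=; apply: filterS filterT => n _ /=; case/andP: (a01 n).
have Sub : ubound S 1.
  move=> t St; have [n /= tn] := filter_ex St.
  by rewrite (le_trans tn)//; case/andP: (a01 n).
have hS : has_sup S by split; [exists 0|exists 1].
exists (sup S) => e e0.
have [t St tS] := sup_adherent e0 hS.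
have NS : ~ S (sup S + e).
  by move=> /(ub_le_sup (ex_intro _ 1 Sub)); rewrite gerDl leNgt e0.
have [//|UC] := in_ultra_setVsetC [set n | sup S + e <= a n] UU.
apply: filterS2 St UC => n /= tn /negP; rewrite -ltNge => an.
rewrite ler_norml; apply/andP; split; lra.
Qed.

(** * Weak limits of the marginals *)

Section weak_limit.
Context d (X : measurableType d) (R : realType) (mu : probability X R) (E : set (X * X)).
Hypothesis hE : cmp_relation mu E.
Hypothesis erg : ergodic mu E.
Variable th : nat -> full_group mu E.
Hypothesis thE : forall x y, E (x, y) <-> exists k, y = th k x.
Variables (rho : nat -> probability X R) (C : R).
Hypothesis C0 : 0 <= C.
Hypothesis dom : forall n A, measurable A -> pr (rho n) A <= C * pr mu A.
Hypothesis inv : forall k A (e : R), measurable A -> 0 < e -> exists N, forall n, (N <= n)%N ->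
  `|pr (rho n) (th k @^-1` A) - pr (rho n) A| <= e.

(** Along an ultrafilter all sets converge at once. The limits are finitely additive, domination
    makes them a probability, and asymptotic invariance becomes exact because [U] contains the
    tails. *)
Lemma ultra_weak_limit (U : set_system nat) A (e : R) : UltraFilter U -> \oo `<=` U ->
  measurable A -> 0 < e -> U [set n | `|pr (rho n) A - pr mu A| <= e].
Proof.
move=> UU ooU.
have /choice[L HL] A' : exists x, measurable A' ->
    forall e : R, 0 < e -> U [set n | `|pr (rho n) A' - x| <= e].
  have [mA|NmA] := pselect (measurable A'); last by exists 0.
  have [|x Hx] := @ultra_limit R U (fun n => pr (rho n) A') UU; last by exists x.
  by move=> n; rewrite pr_ge0 pr_le1.
have uniq A' y : measurable A' -> (forall e : R, 0 < e -> U [set n | `|pr (rho n) A' - y| <= e]) -> L A' = y.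
  move=> mA' Hy; apply/eqP; rewrite -subr_eq0 -normr_le0; apply/ler_addgt0Pr => e' e0.
  have e2 : 0 < e' / 2 by rewrite divr_gt0.
  have [n [/= h1 h2]] := filter_ex (filterI (HL A' mA' _ e2) (Hy _ e2)).
  by move: h1 h2; rewrite !ler_norml => /andP[? ?] /andP[? ?]; apply/andP; split; lra.
have L0 A' : measurable A' -> 0 <= L A'.
  move=> mA'; apply/ler_addgt0Pr => e' e0.
  have [n /= h] := filter_ex (HL A' mA' _ e0); have := pr_ge0 (rho n) A'.
  by move: h; rewrite ler_norml => /andP[? ?]; lra.
have LU A1 A2 : measurable A1 -> measurable A2 -> A1 `&` A2 = set0 -> L (A1 `|` A2) = L A1 + L A2.
  move=> m1 m2 A12; apply: uniq; first exact: measurableU.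
  move=> e' e0; have e2 : 0 < e' / 2 by rewrite divr_gt0.
  apply: filterS2 (HL _ m1 _ e2) (HL _ m2 _ e2) => n /=.
  by rewrite prU// !ler_norml => /andP[? ?] /andP[? ?]; apply/andP; split; lra.
have Ldom A' : measurable A' -> L A' <= C * (pr mu A' + pr mu A').
  move=> mA'; apply/ler_addgt0Pr => e' e0.
  have [n /= h] := filter_ex (HL A' mA' _ e0); have := dom n mA'.
  have : 0 <= C * pr mu A' by rewrite mulr_ge0// pr_ge0.
  by move: h; rewrite ler_norml mulrDr => /andP[? ?]; lra.
have LT : L setT = 1.
  apply: uniq => // e' e0; apply: filterS filterT => n _ /=.
  by rewrite prT subrr normr0 ltW.
have [r rE] := dominated_probability L0 LU Ldom LT.
(* [dominated_probability] was applied with [mu] as both dominating measures, hence the constant. *)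
have C20 : 0 <= C + C by rewrite addr_ge0.
have rmu : forall A, measurable A -> pr r A = pr mu A.
  apply: (@invariant_probability_eq _ _ _ _ _ hE th thE r (C + C) erg C20).
  - by move=> A' mA'; rewrite rE// mulrDl -mulrDr Ldom.
  - move=> k A' mA'; have mk := measurable_preimage_fg (th k) mA'; rewrite !rE//.
    apply: uniq => // e' e0; have e2 : 0 < e' / 2 by rewrite divr_gt0.
    have [N HN] := inv k mA' e2.
    have UN : U [set n | (N <= n)%N] by apply: ooU; exact: nbhs_infty_ge.
    apply: filterS2 (HL _ mA' _ e2) UN => n /= h /HN.
    by move: h; rewrite !ler_norml => /andP[? ?] /andP[? ?]; apply/andP; split; lra.
by move=> mA e0; rewrite -rmu// rE//; exact: HL.
Qed.

Variable h : nat -> X -> R.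
Hypothesis mh : forall n, measurable_fun setT (h n).
Hypothesis hC : forall n x, 0 <= h n x <= C.
Hypothesis hE' : forall n A, measurable A -> pr (rho n) A = Int mu (fun x => \1_A x * h n x).

Let bh n : bmeas (h n).
Proof. by split=> //; exists C => x; have /andP[? ?] := hC n x; rewrite ger0_norm. Qed.

(** One index beyond [N] is all that the greedy averages ask for, so the ultrafilter stays confined
    to this proof. *)
Lemma weak_cluster (F : X -> R) (e : R) N : bmeas F -> 0 < e ->
  exists2 n, (N <= n)%N & `|Int mu (fun x => F x * h n x) - Int mu F| <= e.
Proof.
move=> bF; have [U [UU ooU]] := @ultraFilterLemma nat \oo _.
suff H01 (g : X -> R) (e' : R) : measurable_fun setT g -> (forall x, 0 <= g x <= 1) -> 0 < e' ->
    U [set n | `|Int mu (fun x => g x * h n x) - Int mu g| <= e'].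
  move=> e0; have [mF [B0 fB0]] := bF; pose B := Num.max B0 1.
  have Bp : 0 < B by rewrite lt_max ltr01 orbT.
  have fB x : `|F x| <= B by rewrite (le_trans (fB0 x))// le_max lexx.
  pose g x := (F x / B + 1) / 2.
  have mg : measurable_fun setT g.
    by apply: measurable_funM => //; apply: measurable_funD => //; exact: measurable_funM.
  have g01 x : 0 <= g x <= 1.
    have : `|F x / B| <= 1 by rewrite normrM normfV (gtr0_norm Bp) ler_pdivrMr// mul1r.
    by rewrite /g ler_norml => /andP[? ?]; apply/andP; split; lra.
  have FE x : F x = 2 * B * g x - B by rewrite /g; field; rewrite gt_eqF.
  have bg := bmeas01 mg g01.
  have e1 : 0 < e / (2 * B) by rewrite divr_gt0// mulr_gt0.
  have UN : U [set n | (N <= n)%N] by apply: ooU; exact: nbhs_infty_ge.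
  have [n [/= Hn Nn]] := filter_ex (filterI (H01 g _ mg g01 e1) UN).
  exists n => //.
  have -> : Int mu (fun x => F x * h n x) = 2 * B * Int mu (fun x => g x * h n x) - B.
    transitivity (2 * B * Int mu (fun x => g x * h n x) - B * Int mu (fun x => \1_setT x * h n x)).
      rewrite -!IntZ -?IntB; try exact: bmeasM; try (apply: bmeasZ; exact: bmeasM).
      - congr Int; apply/funext => x; rewrite [in LHS]FE indicE in_setT/=.
        by move: (g x) (h n x) => a b; ring.
      - by apply: bmeasZ; apply: bmeasM => //; exact: bmeas_indic.
      - by apply: bmeasM => //; exact: bmeas_indic.
    by rewrite -hE'// prT mulr1.
  have -> : Int mu F = 2 * B * Int mu g - B.
    rewrite -IntZ// -[X in _ - X](Int_cst mu) -IntB; [|exact: bmeasZ|exact: bmeas_cst].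
    by congr Int; apply/funext => x; exact: FE.
  rewrite opprB addrA subrK -mulrBr normrM ger0_norm; last by rewrite mulr_ge0// ltW.
  by rewrite mulrC -ler_pdivlMr// mulr_gt0.
move=> mg g01 e0.
(* [C + 1] bounds the error functional [J] on [0,1]-valued functions, so digits beyond depth [k]
   cost at most half of the tolerance. What remains concerns [k] sets, a finite intersection in
   [U]. *)
have [k Hk] : exists k, 2^-1 ^+ k * (C + 1) <= e' / 2.
  have D0 : 0 <= (C + 1) / (e' / 2) by rewrite divr_ge0 ?addr_ge0// ltW// divr_gt0.
  have := archi_boundP D0; set n := Num.bound _ => Dn; exists n.
  rewrite exprVn mulrC ler_pdivrMr ?exprn_gt0// mulrC -ler_pdivrMr ?divr_gt0//.
  by rewrite (le_trans (ltW Dn))// -natrX ler_nat ltnW// ltn_expl.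
have [s [ms Hs]] := dyadic_bound k mg g01.
have e2 : 0 < e' / 2 by rewrite divr_gt0.
have Us j : U [set n | forall i, (i < j)%N -> `|pr (rho n) (s i) - pr mu (s i)| <= e' / 2].
  elim: j => [|j IH]; first by apply: filterS filterT => n _ /= i.
  apply: filterS2 IH (ultra_weak_limit UU ooU (ms j) e2) => n /= h1 h2 i.
  by rewrite ltnS leq_eqVlt => /orP[/eqP ->//|]; exact: h1.
apply: filterS (Us k) => n /= Hn.
pose J (u : X -> R) := `|Int mu (fun x => u x * h n x) - Int mu u|.
rewrite -/(J g) [e']splitr; apply: le_trans (_ : e' / 2 + 2^-1 ^+ k * (C + 1) <= _); last by rewrite lerD2l.
apply: Hs (ltW e2) _ _ _.
- move=> A h1 mA mh1 h101; rewrite /J.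
  have b1 := bmeas_indic R mA; have b2 := bmeas01 mh1 h101.
  have -> : Int mu (fun x => 2^-1 * (\1_A x + h1 x)) = 2^-1 * (Int mu \1_A + Int mu h1).
    by rewrite IntZ; [rewrite IntD|apply: bmeasD].
  have -> : Int mu (fun x => 2^-1 * (\1_A x + h1 x) * h n x) =
      2^-1 * (Int mu (fun x => \1_A x * h n x) + Int mu (fun x => h1 x * h n x)).
    rewrite -IntD; [|exact: bmeasM|exact: bmeasM].
    rewrite -IntZ; last by apply: bmeasD; exact: bmeasM.
    by congr Int; apply/funext => x; ring.
  rewrite -mulrBr normrM ger0_norm ?invr_ge0// ler_pM2l ?invr_gt0//.
  by rewrite opprD addrACA ler_normD.
- move=> h1 mh1 h101; rewrite /J; have b2 := bmeas01 mh1 h101.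
  apply: (le_trans (ler_normB _ _)); apply: lerD.
    apply: (le_trans (Int_norm _ (bmeasM b2 (bh n)))); rewrite -[leRHS](Int_cst mu).
    apply: Int_le; [exact/bmeas_norm/bmeasM|exact: bmeas_cst|move=> x].
    have /andP[a0 a1] := h101 x; have /andP[c0 c1] := hC n x.
    by rewrite normrM !ger0_norm// -[leRHS]mul1r ler_pM.
  by have /andP[i0 i1] := Int01 mu mh1 h101; rewrite ger0_norm.
- by move=> i ik; rewrite /J -hE'// Int_indic//; exact: Hn.
Qed.

End weak_limit.

(** * Greedy averages with density close to 1 *)

Section averages.
Context d (X : measurableType d) (R : realType) (mu : probability X R).
Variables (lam : nat -> probability (X * X)%type R) (h : nat -> X -> R) (C : R).
Hypothesis mh : forall n, measurable_fun setT (h n).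
Hypothesis hC : forall n x, 0 <= h n x <= C.
Hypothesis lam1 : forall n A, measurable A -> pr (lam n) (fst @^-1` A) = Int mu (fun x => \1_A x * h n x).
Hypothesis lam2 : forall n A, measurable A -> pr (lam n) (snd @^-1` A) = Int mu (fun x => \1_A x * h n x).
Hypothesis wc : forall (F : X -> R) (e : R) N, bmeas F -> 0 < e ->
  exists2 n, (N <= n)%N & `|Int mu (fun x => F x * h n x) - Int mu F| <= e.

Let bh n : bmeas (h n).
Proof. by split=> //; exists C => x; have /andP[? ?] := hC n x; rewrite ger0_norm. Qed.

Let bsq (f : X -> R) : bmeas f -> bmeas (fun x => (f x - 1) ^+ 2).
Proof.
move=> bf; rewrite (_ : (fun x => _) = fun x => (f x - 1) * (f x - 1)); last by apply/funext => x; rewrite expr2.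
by apply: bmeasM; apply: bmeasB => //; exact: bmeas_cst.
Qed.

(** Induction on m, as in the Banach-Saks theorem. With M = m+1 and K = (C+1)^2 + 1, the new term is
    nearly orthogonal to f - 1, so (M+1)^2 times the new squared distance is at most M^2 times the
    old one, plus 1 for the cross term, plus (C+1)^2; by induction this is at most (M+1) K.
    Averaging preserves every estimate valid for all [lam n] with n >= N. *)
Lemma good_average N m : exists (om : probability (X * X)%type R) (f : X -> R),
  [/\ measurable_fun setT f /\ (forall x, 0 <= f x <= C),
      forall A, measurable A -> pr om (fst @^-1` A) = Int mu (fun x => \1_A x * f x) /\
        pr om (snd @^-1` A) = Int mu (fun x => \1_A x * f x),
      forall S1 S2 (e : R), measurable S1 -> measurable S2 ->
        (forall n, (N <= n)%N -> `|pr (lam n) S1 - pr (lam n) S2| <= e) ->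
        `|pr om S1 - pr om S2| <= e &
      m.+1%:R * Int mu (fun x => (f x - 1) ^+ 2) <= (C + 1) ^+ 2 + 1].
Proof.
have hsq n : Int mu (fun x => (h n x - 1) ^+ 2) <= (C + 1) ^+ 2.
  rewrite -[leRHS](Int_cst mu); apply: Int_le; [exact: bsq|exact: bmeas_cst|move=> x].
  have /andP[? ?] := hC n x; have Cp : 0 <= C by lra.
  by rewrite -(real_normK (num_real (h n x - 1))) lerXn2r ?nnegrE//; [lra|rewrite ler_norml; apply/andP; split; lra].
elim: m => [|m [om [f [[mf f0] omA omT fK]]]].
  exists (lam N), (h N); split=> //.
  - by move=> A mA; rewrite lam1// lam2.
  - by move=> S1 S2 e _ _; apply.
  - by rewrite mul1r; have := hsq N; lra.
have bf : bmeas f.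
  by split=> //; exists C => x; have /andP[? ?] := f0 x; rewrite ger0_norm.
set M : R := m.+1%:R in fK *; have M0 : 0 < M by rewrite /M ltr0n.
have M1 : m.+2%:R = M + 1 :> R by rewrite /M -natr1.
have Mp : 0 < M + 1 by lra.
pose F x := f x - 1.
have bF : bmeas F by apply: bmeasB => //; exact: bmeas_cst.
(* This tolerance makes the cross term, which carries the factor 2M, at most 1. *)
have e0 : 0 < 1 / (2 * M) by rewrite divr_gt0// mulr_gt0.
have [n Nn Hn] := wc N bF e0.
pose P S := (M + 1)^-1 * (M * pr om S + pr (lam n) S).
have [| | | |om' om'E] := @dominated_probability _ _ _ om (lam n) P 1.
- by move=> A mA; rewrite mulr_ge0 ?invr_ge0 ?(ltW Mp)// addr_ge0 ?pr_ge0// mulr_ge0 ?pr_ge0 ?(ltW M0).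
- by move=> A B mA mB AB; rewrite /P !prU//; ring.
- move=> A mA; rewrite mul1r /P mulrC ler_pdivrMr//.
  have := pr_ge0 om A; have := pr_ge0 (lam n) A => l0 o0.
  have := mulr_ge0 (ltW M0) l0; lra.
- by rewrite /P !prT mulr1 mulVf// gt_eqF.
pose f' x := (M + 1)^-1 * (M * f x + h n x).
have bf1 : bmeas (fun x => M * f x + h n x) by apply: bmeasD => //; exact: bmeasZ.
have bf' : bmeas f' by exact: bmeasZ.
have IA A : measurable A -> Int mu (fun x => \1_A x * f' x) =
    (M + 1)^-1 * (M * Int mu (fun x => \1_A x * f x) + Int mu (fun x => \1_A x * h n x)).
  move=> mA; have bA := bmeas_indic R mA.
  rewrite -IntZ; last exact: bmeasM.
  rewrite -IntD; [|exact/bmeasZ/bmeasM|exact: bmeasM].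
  rewrite -IntZ; last by apply: bmeasD; [exact/bmeasZ/bmeasM|exact: bmeasM].
  by congr Int; apply/funext => x; rewrite /f'; ring.
have mfst (A : set X) : measurable A -> measurable (fst @^-1` A : set (X * X)).
  by move=> mA; rewrite -[X in measurable X]setTI; exact: measurable_fst.
have msnd (A : set X) : measurable A -> measurable (snd @^-1` A : set (X * X)).
  by move=> mA; rewrite -[X in measurable X]setTI; exact: measurable_snd.
exists om', f'; split.
- split; first by case: bf'.
  move=> x; have /andP[a0 a1] := f0 x; have /andP[b0 b1] := hC n x.
  rewrite /f' mulr_ge0 ?invr_ge0 ?(ltW Mp)//=; last by rewrite addr_ge0// mulr_ge0// (ltW M0).
  rewrite mulrC ler_pdivrMr// mulrDr mulr1 mulrC; have := ler_pM a0 (ltW M0) a1 (lexx M).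
  by rewrite mulrC; lra.
- move=> A mA; have [q1 q2] := omA A mA.
  by rewrite om'E ?om'E//; [rewrite /P IA// q1 q2 lam1// lam2|exact: msnd|exact: mfst].
- move=> S1 S2 e mS1 mS2 He; rewrite !om'E// /P -mulrBr.
  have := omT _ _ _ mS1 mS2 He; have := He n Nn.
  rewrite normrM gtr0_norm ?invr_gt0// mulrC ler_pdivrMr// => h1 h2.
  rewrite (_ : _ - _ = M * (pr om S1 - pr om S2) + (pr (lam n) S1 - pr (lam n) S2)); last by ring.
  apply: (le_trans (ler_normD _ _)); rewrite normrM (gtr0_norm M0).
  have := ler_wpM2l (ltW M0) h2; lra.
have cross : `|Int mu (fun x => F x * (h n x - 1))| <= 1 / (2 * M).
  rewrite (_ : (fun x => _) = fun x => F x * h n x - F x).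
    by rewrite IntB//; exact: bmeasM.
  by apply/funext => x; rewrite mulrBr mulr1.
have sqE : (M + 1) ^+ 2 * Int mu (fun x => (f' x - 1) ^+ 2) =
    M ^+ 2 * Int mu (fun x => (f x - 1) ^+ 2) + 2 * M * Int mu (fun x => F x * (h n x - 1)) +
    Int mu (fun x => (h n x - 1) ^+ 2).
  have b1 := bsq bf; have b2 := bsq (bh n).
  have b3 : bmeas (fun x => F x * (h n x - 1)).
    by apply: bmeasM => //; apply: bmeasB => //; exact: bmeas_cst.
  rewrite -!IntZ//; last exact: bsq.
  rewrite -IntD; [|exact: bmeasZ|exact: bmeasZ].
  rewrite -IntD//; last by apply: bmeasD; exact: bmeasZ.
  congr Int; apply/funext => x; rewrite /f' /F; field.
  by rewrite gt_eqF.
rewrite M1 -(ler_pM2l Mp) mulrA -expr2 sqE.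
have h1 := hsq n.
have h2 : 2 * M * Int mu (fun x => F x * (h n x - 1)) <= 1.
  have /(le_trans (ler_norm _)) := cross; rewrite ler_pdivlMr ?mulr_gt0//; lra.
have h3 : M ^+ 2 * Int mu (fun x => (f x - 1) ^+ 2) <= M * ((C + 1) ^+ 2 + 1).
  by rewrite expr2 -mulrA ler_pM2l.
rewrite mulrDl mul1r.
move: h1 h2 h3; lra.
Qed.

End averages.

(** * Exact correction of the marginals off the diagonal *)

Section diagonal_null.
Context (R : realType) d (X : measurableType d) (mu : probability X R).
Hypothesis hX : standard_borel R X.
Hypothesis hmu : nonatomic mu.

Lemma measurable_point (x : X) : measurable [set x].
Proof.
have := measurable_xsection x (measurable_diagonal hX).
rewrite (_ : xsection _ _ = [set x])//.
by apply/seteqP; split=> y; rewrite xsectionE /diagonal/= => ->.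
Qed.

Lemma nonatomic_point (x : X) : mu [set x] = 0%E.
Proof.
apply/eqP; rewrite eq_le measure_ge0 andbT leNgt; apply/negP => x0.
have [B Bx [mB /andP[B0 Bl]]] := hmu (measurable_point x) x0.
have [Bxx|NBx] := pselect (B x).
  by move: Bl; rewrite (_ : B = [set x]) ?ltxx//; apply/seteqP; split=> // _ ->.
move: B0; rewrite (_ : B = set0) ?measure0 ?ltxx//.
by apply/seteqP; split=> // y By; apply: NBx; rewrite -(Bx _ By).
Qed.

Lemma product_probability (r1 r2 : probability X R) : exists rr : probability (X * X)%type R,
  (forall A B, measurable A -> measurable B -> pr rr (A `*` B) = pr r1 A * pr r2 B) /\
  ((forall x, r2 [set x] = 0%E) -> pr rr diagonal = 0).
Proof.
exists (r1 \x r2)%E; split.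
  move=> A B mA mB; rewrite -fineM ?fin_num_measure//; congr fine.
  exact: product_measure1E.
move=> r20; rewrite -[RHS]/(fine 0%E); congr fine.
transitivity (\int[r1]_x (r2 (xsection diagonal x)))%E; first by [].
rewrite integral0_eq// => x _ /=.
rewrite -(r20 x); congr (r2 _).
by apply/seteqP; split=> y; rewrite xsectionE /diagonal/= => ->.
Qed.

Lemma measurable_fst_preimage (A : set X) : measurable A -> measurable (fst @^-1` A : set (X * X)).
Proof. by move=> mA; rewrite -[X in measurable X]setTI; exact: measurable_fst. Qed.

Lemma measurable_snd_preimage (A : set X) : measurable A -> measurable (snd @^-1` A : set (X * X)).
Proof. by move=> mA; rewrite -[X in measurable X]setTI; exact: measurable_snd. Qed.

Lemma bmeas_fst (f : X -> R) : bmeas f -> bmeas (fun z : X * X => f z.1).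
Proof. by move=> [mf [B fB]]; split; [exact: measurableT_comp|exists B]. Qed.

Lemma bmeas_snd (f : X -> R) : bmeas f -> bmeas (fun z : X * X => f z.2).
Proof. by move=> [mf [B fB]]; split; [exact: measurableT_comp|exists B]. Qed.

Variables (om : probability (X * X)%type R) (f : X -> R) (C eta : R).
Hypothesis mf : measurable_fun setT f.
Hypothesis fC : forall x, 0 <= f x <= C.
Hypothesis om1 : forall A, measurable A -> pr om (fst @^-1` A) = Int mu (fun x => \1_A x * f x).
Hypothesis om2 : forall A, measurable A -> pr om (snd @^-1` A) = Int mu (fun x => \1_A x * f x).
Hypothesis om_diag : pr om diagonal = 0.
Hypothesis eta01 : 0 < eta < 1.
Hypothesis f1 : Int mu (fun x => `|f x - 1|) <= eta.

Let eta0 : 0 < eta. Proof. by case/andP: eta01. Qed.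
Let eta1 : eta < 1. Proof. by case/andP: eta01. Qed.

Let bf : bmeas f.
Proof. by split=> //; exists C => x; have /andP[? ?] := fC x; rewrite ger0_norm. Qed.

Let g x := Num.max 1 (f x).
Let g1 x : 1 <= g x. Proof. by rewrite /g le_max lexx. Qed.
Let g0 x : 0 < g x. Proof. by apply: lt_le_trans (g1 x). Qed.
Let b x := (g x)^-1.
Let mg : measurable_fun setT g. Proof. by apply: measurable_maxr => //; exact: measurable_cst. Qed.
Let mb : measurable_fun setT b.
Proof.
rewrite (_ : b = fun x => expR (- ln (g x))); last first.
  by apply/funext => x; rewrite expRN lnK// posrE.
apply: measurableT_comp; first exact: measurable_expR.
apply: measurableT_comp => //; apply: measurableT_comp mg; exact: measurable_ln.
Qed.
Let b01 x : 0 <= b x <= 1.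
Proof. by rewrite /b invr_ge0 (ltW (g0 x))/= invf_le1. Qed.
Let bb : bmeas b. Proof. exact: bmeas01. Qed.
Let bf_le1 x : 0 <= b x * f x <= 1.
Proof.
have /andP[a0 a1] := b01 x; have /andP[c0 c1] := fC x.
rewrite mulr_ge0//= mulrC ler_pdivrMr// mul1r.
by rewrite /g le_max lexx orbT.
Qed.
Let bf_ge x : 1 - `|f x - 1| <= b x * f x.
Proof.
rewrite /b /g; have [f1'|f1'] := leP (f x) 1.
  by rewrite invr1 mul1r ler0_norm ?subr_le0//; lra.
rewrite mulVf; last by rewrite gt_eqF// (lt_trans ltr01).
by rewrite gerBl.
Qed.

(** The factor 1 - eta leaves a deficit [kappa] of at least eta, so that dividing by it is
    legitimate even when [f] is already 1. *)
Let w (z : X * X) := (1 - eta) * (b z.1 * b z.2).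
Let bw : bmeas w.
Proof. by apply: bmeasZ; apply: bmeasM; [exact: bmeas_fst|exact: bmeas_snd]. Qed.
Let w01 z : 0 <= w z <= 1 - eta.
Proof.
have /andP[a0 a1] := b01 z.1; have /andP[c0 c1] := b01 z.2.
have e1 : 0 <= 1 - eta by rewrite subr_ge0 ltW.
rewrite /w mulr_ge0 ?mulr_ge0//= -[leRHS]mulr1 ler_wpM2l// -[leRHS]mul1r.
by rewrite ler_pM.
Qed.

Let Pw S := Int om (fun z => \1_S z * w z).
Let bS S : measurable S -> bmeas (fun z => \1_S z * w z).
Proof. by move=> mS; apply: bmeasM => //; exact: bmeas_indic. Qed.

Let Pw_ge0 S : 0 <= Pw S.
Proof. by apply: Int_ge0 => z; rewrite mulr_ge0//; case/andP: (w01 z). Qed.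

Let Pw_le S : measurable S -> Pw S <= pr om S.
Proof.
move=> mS; rewrite -Int_indic//; apply: Int_le; [exact: bS|exact: bmeas_indic|move=> z].
have /andP[_ w1] := w01 z; rewrite ler_piMr// (le_trans w1)// gerBl ltW//.
Qed.

Let PwU S S' : measurable S -> measurable S' -> S `&` S' = set0 -> Pw (S `|` S') = Pw S + Pw S'.
Proof.
move=> mS mS' SS'; rewrite /Pw -IntD; [|exact: bS|exact: bS].
congr Int; apply/funext => z; rewrite -mulrDl; congr (_ * _).
rewrite !indicE in_setU; have [Sz|//] := boolP (z \in S).
  rewrite (_ : (z \in S') = false) ?addr0//; apply/negP => /set_mem Sz'.
  have : (S `&` S') z by split=> //; exact: set_mem.
  by rewrite SS'.
by rewrite add0r.
Qed.

Let kappa := 1 - Pw setT.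

Let PwT : Pw setT = Int om w.
Proof. by congr Int; apply/funext => z; rewrite indicE in_setT mul1r. Qed.

Let kappa_gt0 : eta <= kappa.
Proof.
rewrite /kappa PwT lerBrDr -lerBrDl -(Int_cst om (1 - eta)).
by apply: Int_le => [//||z]; [exact: bmeas_cst|case/andP: (w01 z)].
Qed.

(** Each coordinate gives b the integral of b f, at least 1 - eta. Since (1 - b)(1 - b') >= 0, the
    product of the two weights has integral at least 1 - 2 eta, and the factor 1 - eta costs one
    more eta. *)
Let kappa_le : kappa <= 3 * eta.
Proof.
rewrite /kappa PwT.
have B1 := density_Int (@measurable_fst _ _ X X) bf om1 bb.
have B2 := density_Int (@measurable_snd _ _ X X) bf om2 bb.
have B3 : 1 - eta <= Int mu (fun x => b x * f x).
  apply: (@le_trans _ _ (Int mu (fun x => 1 - `|f x - 1|))); last first.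
    apply: Int_le; [|exact: bmeasM|exact: bf_ge].
    by apply: bmeasB; [exact: bmeas_cst|apply/bmeas_norm/bmeasB => //; exact: bmeas_cst].
  rewrite IntB; [rewrite Int_cst lerD2l lerN2; exact: f1|exact: bmeas_cst|].
  by apply/bmeas_norm/bmeasB => //; exact: bmeas_cst.
have b1' := bmeas_fst bb; have b2' := bmeas_snd bb.
have B4 : 1 - 2 * eta <= Int om (fun z => b z.1 * b z.2).
  apply: (@le_trans _ _ (Int om (fun z => b z.1 + b z.2 - 1))).
    rewrite IntB; [|exact: bmeasD|exact: bmeas_cst].
    by rewrite IntD// B1 B2 Int_cst; lra.
  apply: Int_le; [|exact: bmeasM|move=> z].
    by apply: bmeasB; [exact: bmeasD|exact: bmeas_cst].
  have /andP[a0 a1] := b01 z.1; have /andP[c0 c1] := b01 z.2.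
  have : 0 <= (1 - b z.1) * (1 - b z.2) by rewrite mulr_ge0 ?subr_ge0.
  by lra.
rewrite /w IntZ; last exact: bmeasM.
have : (1 - eta) * (1 - 2 * eta) <= (1 - eta) * Int om (fun z => b z.1 * b z.2).
  by rewrite ler_wpM2l// subr_ge0 ltW.
have := mulr_ge0 (ltW eta0) (ltW eta0).
by move: eta0 eta1; lra.
Qed.

Let kp : 0 < kappa. Proof. exact: lt_le_trans kappa_gt0. Qed.

(** The normalized deficit of one marginal. As w is at most b of that coordinate, the reweighted
    marginal has density at most b f <= 1, so the deficit is non-negative; its mass is [kappa] for
    either coordinate. *)
Let residual (phi : X * X -> X) : measurable_fun setT phi ->
  (forall z, w z <= b (phi z)) ->
  (forall A, measurable A -> pr om (phi @^-1` A) = Int mu (fun x => \1_A x * f x)) ->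
  exists r : probability X R, (forall A, measurable A -> pr r A = (pr mu A - Pw (phi @^-1` A)) / kappa).
Proof.
move=> mphi wb omphi.
have mp A : measurable A -> measurable (phi @^-1` A).
  by move=> mA; rewrite -[X in measurable X]setTI; exact: mphi.
pose P A := (pr mu A - Pw (phi @^-1` A)) / kappa.
apply: (@dominated_probability _ _ _ mu mu P kappa^-1).
- move=> A mA; rewrite /P divr_ge0 ?(ltW kp)// subr_ge0.
  have bA := bmeas_indic R mA.
  have Ab : bmeas (fun x => \1_A x * b x) by exact: bmeasM.
  apply: (@le_trans _ _ (Int om (fun z => \1_A (phi z) * b (phi z)))).
    apply: Int_le; [by apply: bS; exact: mp| |move=> z].
      by have [mAb [B hB]] := Ab; split; [exact: (measurableT_comp mAb mphi)|exists B => z; exact: hB].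
    by rewrite ler_wpM2l.
  rewrite (density_Int mphi bf omphi Ab) -(Int_indic mu mA).
  apply: Int_le => //; first exact: bmeasM.
  move=> x; have /andP[_ q1] := bf_le1 x.
  by rewrite -mulrA ler_piMr// indicE.
- move=> A A' mA mA' AA'; rewrite /P preimage_setU prU// PwU; [|exact: mp|exact: mp|].
    by rewrite -mulrDl opprD addrACA.
  by rewrite -preimage_setI AA' preimage_set0.
- move=> A mA; rewrite /P mulrC ler_pM2l ?invr_gt0//.
  have := Pw_ge0 (phi @^-1` A); have := pr_ge0 mu A; lra.
- by rewrite /P preimage_setT prT divff// gt_eqF.
Qed.

(** Adding [kappa] times the product of the two normalized deficits fills both marginals at once.
    The second deficit is at most mu / kappa and so has no atoms, which keeps the product off the
    diagonal. The mass removed by the weight and the mass added are both [kappa], and they act in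
    opposite directions. *)
Lemma marginal_correction : exists om' : probability (X * X)%type R,
  [/\ forall A, measurable A -> pr om' (fst @^-1` A) = pr mu A /\ pr om' (snd @^-1` A) = pr mu A,
      pr om' diagonal = 0 &
      forall S, measurable S -> `|pr om' S - pr om S| <= 3 * eta].
Proof.
have wb1 z : w z <= b z.1.
  have /andP[a0 a1] := b01 z.1; have /andP[c0 c1] := b01 z.2.
  rewrite /w mulrCA ler_piMr// mulr_ile1// ?subr_ge0 ?(ltW eta1)// gerBl ltW//.
have wb2 z : w z <= b z.2.
  have /andP[a0 a1] := b01 z.1; have /andP[c0 c1] := b01 z.2.
  rewrite /w mulrA mulrC ler_piMr// mulr_ile1// ?subr_ge0 ?(ltW eta1)// gerBl ltW//.
have [r1 r1E] := residual (@measurable_fst _ _ X X) wb1 om1.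
have [r2 r2E] := residual (@measurable_snd _ _ X X) wb2 om2.
have [rr [rrE rrD]] := product_probability r1 r2.
have mD := measurable_diagonal hX.
have r2pt x : r2 [set x] = 0%E.
  have mx := measurable_point x; rewrite (prE r2 mx) r2E// nonatomic_point; congr (_%:E).
  have q1 := Pw_ge0 (snd @^-1` [set x]).
  have q2 := pr_ge0 r2 [set x]; rewrite r2E// nonatomic_point/= in q2.
  apply/eqP; rewrite eq_le q2 andbT.
  by rewrite mulr_le0_ge0 ?invr_ge0 ?(ltW kp)// sub0r oppr_le0.
pose P S := Pw S + kappa * pr rr S.
have [| | | |om' om'E] := @dominated_probability _ _ _ om rr P 1.
- by move=> A mA; rewrite addr_ge0// mulr_ge0 ?pr_ge0 ?(ltW kp).
- by move=> A B mA mB AB; rewrite /P PwU// prU//; ring.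
- move=> A mA; rewrite mul1r lerD ?Pw_le// ler_piMl ?pr_ge0//.
  by rewrite /kappa gerBl.
- by rewrite /P prT /kappa; ring.
have kk x : kappa * (x / kappa) = x by rewrite mulrC divfK// gt_eqF.
have rT (r : probability X R) : pr r setT = 1 by exact: prT.
exists om'; split.
- move=> A mA; have m1 := measurable_fst_preimage mA; have m2 := measurable_snd_preimage mA.
  rewrite !om'E// /P.
  have -> : pr rr (fst @^-1` A) = pr r1 A.
    rewrite (_ : fst @^-1` A = A `*` setT); last by apply/seteqP; split=> z /=; tauto.
    by rewrite rrE// rT mulr1.
  have -> : pr rr (snd @^-1` A) = pr r2 A.
    rewrite (_ : snd @^-1` A = setT `*` A); last by apply/seteqP; split=> z /=; tauto.
    by rewrite rrE// rT mul1r.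
  by rewrite r1E// r2E// !kk; split; ring.
- rewrite om'E// /P rrD// mulr0 addr0; apply/eqP; rewrite eq_le Pw_ge0 andbT.
  by rewrite (le_trans (Pw_le mD))// om_diag.
- move=> S mS; rewrite om'E// /P; apply: le_trans kappa_le.
  have q1 := Pw_le mS; have q2 := Pw_le (measurableC mS).
  have q3 : Pw setT = Pw S + Pw (~` S).
    by rewrite -PwU ?setUv ?setICr//; exact: measurableC.
  have q4 : 0 <= kappa * pr rr S by rewrite mulr_ge0 ?pr_ge0 ?(ltW kp).
  have q5 : kappa * pr rr S <= kappa by rewrite ler_piMr ?pr_le1 ?(ltW kp).
  have q6 := prC om mS; rewrite q6 in q2.
  rewrite ler_norml; move: q4 q5; set y := kappa * _; rewrite /kappa q3 => q4 q5.
  apply/andP; split; lra.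
Qed.

End diagonal_null.

(** * A sequence off the diagonal with exact marginals *)

Section off_diagonal.
Context (R : realType) d (X : measurableType d) (mu : probability X R) (E : set (X * X)).
Hypotheses (hX : standard_borel R X) (hmu : nonatomic mu) (hE : cmp_relation mu E).
Hypothesis erg : ergodic mu E.
Variable th : nat -> full_group mu E.
Hypothesis thE : forall x y, E (x, y) <-> exists k, y = th k x.
Variable nu : nat -> probability (X * X)%type R.
Hypothesis nu1 : forall n A, measurable A -> pr (nu n) (fst @^-1` A) = pr mu A.
Hypothesis nu2 : forall n A, measurable A -> pr (nu n) (snd @^-1` A) = pr mu A.
Hypothesis nu_inv : forall k (e : R), 0 < e -> exists N, forall n, (N <= n)%N ->
  forall S, measurable S -> `|pr (nu n) (pair_map (th k) @^-1` S) - pr (nu n) S| <= e.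
Variable B : nat -> set X.
Hypothesis mB : forall k, measurable (B k).
Hypothesis nu_B : forall k (e : R), 0 < e -> exists N, forall n, (N <= n)%N ->
  pr (nu n) (B k `*` ~` B k) <= e.
Variable c : R.
Hypothesis c0 : 0 < c.
Hypothesis nu_off : forall n, c <= pr (nu n) (~` diagonal).

Let mD : measurable (~` @diagonal X).
Proof. by apply: measurableC; exact: (measurable_diagonal hX). Qed.

Let cn n := pr (nu n) (~` diagonal).
Let cn0 n : 0 < cn n. Proof. exact: lt_le_trans (nu_off n). Qed.

Let lam_exists n : exists lam : probability (X * X)%type R,
  forall S, measurable S -> pr lam S = pr (nu n) (S `&` ~` diagonal) / cn n.
Proof.
apply: (@dominated_probability _ _ _ (nu n) (nu n) _ (cn n)^-1).
- by move=> A mA; rewrite divr_ge0 ?pr_ge0 ?(ltW (cn0 n)).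
- move=> A A' mA mA' AA'; rewrite setIUl prU; [by rewrite mulrDl|exact: measurableI|exact: measurableI|].
  by rewrite setIACA AA' set0I.
- move=> A mA; rewrite mulrC ler_pM2l ?invr_gt0//.
  have := pr_ge0 (nu n) A; have := pr_le (nu n) (measurableI _ _ mA mD) mA (@subIsetl _ _ _); lra.
- by rewrite setTI; apply: divff; rewrite (gt_eqF (cn0 n)).
Qed.

Lemma off_diagonal_sequence : exists nu' : nat -> probability (X * X)%type R,
  [/\ forall n, pr (nu' n) diagonal = 0,
      forall n A, measurable A -> pr (nu' n) (fst @^-1` A) = pr mu A /\
        pr (nu' n) (snd @^-1` A) = pr mu A,
      forall k (e : R), 0 < e -> exists N, forall n, (N <= n)%N ->
        forall S, measurable S -> `|pr (nu' n) (pair_map (th k) @^-1` S) - pr (nu' n) S| <= e &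
      forall k (e : R), 0 < e -> exists N, forall n, (N <= n)%N ->
        pr (nu' n) (B k `*` ~` B k) <= e].
Proof.
have [lam lamE] := choice lam_exists.
have scale n x : 0 <= x -> x / cn n <= x / c.
  by move=> x0; rewrite ler_wpM2l// lef_pV2 ?posrE//; exact: nu_off.
have mf (A : set X) : measurable A -> measurable (fst @^-1` A : set (X * X)).
  exact: measurable_fst_preimage.
have ms (A : set X) : measurable A -> measurable (snd @^-1` A : set (X * X)).
  exact: measurable_snd_preimage.
(* The part on the diagonal has the same mass above [A] in either coordinate, so removing it keeps
   the two marginals equal, and a single density serves both. *)
have lam12 n A : measurable A -> pr (lam n) (snd @^-1` A) = pr (lam n) (fst @^-1` A).
  move=> mA; rewrite !lamE; [|exact: mf|exact: ms]; congr (_ / _).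
  have mDi := measurable_diagonal hX.
  have H1 := prID (nu n) (mf _ mA) mDi; have H2 := prID (nu n) (ms _ mA) mDi.
  rewrite nu1// in H1; rewrite nu2// in H2.
  have H3 : fst @^-1` A `&` diagonal = snd @^-1` A `&` @diagonal X.
    by apply/seteqP; split=> -[x y] [/= Ax]; rewrite /diagonal/= => xy; subst.
  by rewrite -!setDE; rewrite H3 in H1; lra.
have lam_dom n A : measurable A -> pr (lam n) (fst @^-1` A) <= c^-1 * pr mu A.
  move=> mA; rewrite lamE; last exact: mf.
  apply: (le_trans (scale _ _ (pr_ge0 _ _))); rewrite mulrC ler_pM2l ?invr_gt0// -(nu1 n mA).
  by apply: pr_le; [apply: measurableI => //; exact: mf|exact: mf|exact: subIsetl].
have rho_ex n : exists rho : probability X R, forall A, measurable A -> pr rho A = pr (lam n) (fst @^-1` A).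
  apply: (@dominated_probability _ _ _ mu mu _ c^-1).
  - by move=> A mA; exact: pr_ge0.
  - by move=> A A' mA mA' AA'; rewrite preimage_setU prU//; [exact: mf|exact: mf|rewrite -preimage_setI AA' preimage_set0].
  - move=> A mA; apply: (le_trans (lam_dom n _ mA)); rewrite ler_pM2l ?invr_gt0//.
    by rewrite lerDl pr_ge0.
  - by rewrite preimage_setT prT.
have [rho rhoE] := choice rho_ex.
have C0 : 0 <= c^-1 by rewrite invr_ge0 ltW.
have dom n A : measurable A -> pr (rho n) A <= c^-1 * pr mu A.
  by move=> mA; rewrite rhoE// lam_dom.
have lam_inv k (e : R) : 0 < e -> exists N, forall n, (N <= n)%N ->
    forall S, measurable S -> `|pr (lam n) (pair_map (th k) @^-1` S) - pr (lam n) S| <= e.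
  move=> e0; have ec : 0 < e * c by rewrite mulr_gt0.
  have [N HN] := nu_inv k ec; exists N => n Nn S mS.
  have mT := measurable_pair_preimage (fg_measurable (th k)).
  rewrite !lamE//; last exact: mT.
  (* Injectivity of [th k] makes the complement of the diagonal exactly invariant, so restriction
     preserves near invariance. *)
  have -> : pair_map (th k) @^-1` S `&` ~` diagonal = pair_map (th k) @^-1` (S `&` ~` diagonal).
    apply/seteqP; split=> -[x y] [/= Sxy]; rewrite /diagonal/pair_map/= => xy; split=> //= H; apply: xy.
      exact: (can_inj (fg_funK (th k))).
    by rewrite H.
  rewrite -mulrBl normrM [X in _ * X]ger0_norm ?invr_ge0 ?(ltW (cn0 n))//.
  apply: (le_trans (scale _ _ (normr_ge0 _))); rewrite ler_pdivrMr//.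
  by apply: HN => //; exact: measurableI.
have rho_inv k A (e : R) : measurable A -> 0 < e -> exists N, forall n, (N <= n)%N ->
    `|pr (rho n) (th k @^-1` A) - pr (rho n) A| <= e.
  move=> mA e0; have [N HN] := lam_inv k _ e0; exists N => n Nn.
  have mk := measurable_preimage_fg (th k) mA.
  by rewrite !rhoE//; apply: (HN n Nn (fst @^-1` A)); exact: mf.
have /choice[h hP] n := bounded_density C0 (dom n).
have mh n : measurable_fun setT (h n) by case: (hP n).
have hC n : forall x, 0 <= h n x <= c^-1 by case: (hP n).
have hA n A : measurable A -> pr (rho n) A = Int mu (fun x => \1_A x * h n x) by case: (hP n) => _ _; exact.
have wc := @weak_cluster _ _ _ mu E hE erg th thE rho c^-1 C0 dom rho_inv h mh hC hA.
have l1 n A : measurable A -> pr (lam n) (fst @^-1` A) = Int mu (fun x => \1_A x * h n x).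
  by move=> mA; rewrite -rhoE// hA.
have l2 n A : measurable A -> pr (lam n) (snd @^-1` A) = Int mu (fun x => \1_A x * h n x).
  by move=> mA; rewrite lam12// l1.
pose K := (c^-1 + 1) ^+ 2 + 1.
have K0 : 0 < K by rewrite /K ltr_pwDr// sqr_ge0.
(* The index is shifted by two because [marginal_correction] needs eta < 1 strictly, already for n =
   0. *)
pose eta n : R := n.+2%:R^-1.
have eta01 n : 0 < eta n < 1 by rewrite invr_gt0 ltr0n/= invf_lt1 ?ltr1n.
(* The correction moves each of the two sets by at most 3 eta, whence 6 eta. Quantifying over pairs
   of sets covers near invariance, and small mass with [S2] empty. *)
have step N : exists nu' : probability (X * X)%type R,
    [/\ pr nu' diagonal = 0,
        forall A, measurable A -> pr nu' (fst @^-1` A) = pr mu A /\ pr nu' (snd @^-1` A) = pr mu A &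
        forall S1 S2 (e : R), measurable S1 -> measurable S2 ->
          (forall n, (N <= n)%N -> `|pr (lam n) S1 - pr (lam n) S2| <= e) ->
          `|pr nu' S1 - pr nu' S2| <= e + 6 * eta N].
  have /andP[e0 e1] := eta01 N.
  have Ke : 0 <= K / eta N ^+ 2 by rewrite divr_ge0 ?sqr_ge0// ltW.
  (* With m + 1 >= K / eta^2 terms the average has squared L2 distance to 1 at most eta^2. *)
  have := archi_boundP Ke; set m := Num.bound _ => mK.
  have [om [f [[mff fC] omA omT fK]]] := @good_average _ X R mu lam h c^-1 mh hC l1 l2 wc N m.
  have bf : bmeas f.
    by split=> //; exists c^-1 => x; have /andP[? ?] := fC x; rewrite ger0_norm.
  have bf1 : bmeas (fun x => f x - 1) by apply: bmeasB => //; exact: bmeas_cst.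
  have bf2 : bmeas (fun x => (f x - 1) ^+ 2).
    by rewrite (_ : (fun x => _) = fun x => (f x - 1) * (f x - 1)); [exact: bmeasM|apply/funext => x; rewrite expr2].
  have sq : Int mu (fun x => (f x - 1) ^+ 2) <= eta N ^+ 2.
    have m1 : 0 < m.+1%:R :> R by rewrite ltr0n.
    rewrite -(ler_pM2l m1); apply: (le_trans fK); rewrite -/K.
    rewrite -ler_pdivrMr ?exprn_gt0//; apply: (le_trans (ltW mK)).
    by rewrite ler_nat.
  (* AM-GM: 2 eta |f - 1| <= eta^2 + (f - 1)^2 *)
  have f1 : Int mu (fun x => `|f x - 1|) <= eta N.
    have e2 : 0 < 2 * eta N by rewrite mulr_gt0.
    rewrite -(ler_pM2l e2) -IntZ; last exact: bmeas_norm.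
    apply: (@le_trans _ _ (Int mu (fun x => eta N ^+ 2 + (f x - 1) ^+ 2))).
      apply: Int_le; [exact/bmeasZ/bmeas_norm|apply: bmeasD => //; exact: bmeas_cst|move=> x].
      have := sqr_ge0 (eta N - `|f x - 1|); rewrite sqrrB real_normK ?num_real//.
      by rewrite -mulr_natl; lra.
    rewrite IntD//; last exact: bmeas_cst.
    by rewrite Int_cst; move: sq; rewrite !expr2; lra.
  have omD : pr om diagonal = 0.
    have mDi := measurable_diagonal hX.
    (* Comparison with the empty set at tolerance 0 carries nullity of the diagonal from the [lam n]
       to their average. *)
    have := omT diagonal set0 0 mDi measurable0; rewrite pr0 subr0 normr_le0 => H.
    apply/eqP/H => n _; rewrite lamE// pr0 setICr pr0 mul0r subrr normr0//.
  have [nu' [n1 n2 n3]] := marginal_correction hX hmu mff fC (fun A mA => (omA A mA).1)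
    (fun A mA => (omA A mA).2) omD (eta01 N) f1.
  exists nu'; split=> // S1 S2 e mS1 mS2 He.
  have := omT _ _ _ mS1 mS2 He; have := n3 _ mS1; have := n3 _ mS2.
  by rewrite !ler_norml => /andP[? ?] /andP[? ?] /andP[? ?]; apply/andP; split; lra.
have [nu' nuP] := choice step.
have eta_small (e : R) : 0 < e -> exists N, forall n, (N <= n)%N -> 6 * eta n <= e.
  move=> e0; have e6 : 0 <= 6 / e by rewrite divr_ge0// ltW.
  have := archi_boundP e6; set N := Num.bound _ => HN; exists N => n Nn.
  rewrite /eta ler_pdivrMr ?ltr0n// mulrC -ler_pdivrMr//; apply: (le_trans (ltW HN)).
  by rewrite ler_nat (leq_trans Nn)// ltnW.
exists nu'; split.
- by move=> n; case: (nuP n).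
- by move=> n; case: (nuP n).
- move=> k e e0; have e2 : 0 < e / 2 by rewrite divr_gt0.
  have [N1 H1] := eta_small _ e2; have [N2 H2] := lam_inv k _ e2.
  exists (maxn N1 N2) => n; rewrite geq_max => /andP[n1 n2] S mS.
  have [_ _ /(_ (pair_map (th k) @^-1` S) S (e / 2))] := nuP n.
  have mT := measurable_pair_preimage (fg_measurable (th k)) mS.
  move=> /(_ mT mS) H; apply: le_trans (H _) _.
    by move=> j nj; apply: H2 => //; exact: leq_trans nj.
  by have := H1 n n1; lra.
- move=> k e e0; have e2 : 0 < e / 2 by rewrite divr_gt0.
  have e2c : 0 < e / 2 * c by rewrite mulr_gt0.
  have [N1 H1] := eta_small _ e2; have [N2 H2] := nu_B k e2c.
  exists (maxn N1 N2) => n; rewrite geq_max => /andP[n1 n2].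
  have mBB : measurable (B k `*` ~` B k) by apply: measurableX => //; exact: measurableC.
  have [_ _ /(_ (B k `*` ~` B k) set0 (e / 2) mBB measurable0)] := nuP n.
  rewrite pr0 subr0 ger0_norm ?pr_ge0// => H; apply: le_trans (H _) _.
    move=> j nj; rewrite pr0 subr0 ger0_norm ?pr_ge0// lamE//.
    apply: (le_trans (scale _ _ (pr_ge0 _ _))); rewrite ler_pdivrMr//.
    apply: le_trans (H2 j (leq_trans n2 nj)).
    by apply: pr_le => //; exact: measurableI.
  by have := H1 n n1; lra.
Qed.

End off_diagonal.

(** * From generators to all Borel sets and the whole full group *)

Section convergence.
Context (R : realType) d (X : measurableType d) (mu : probability X R) (E : set (X * X)).
Hypotheses (hX : standard_borel R X).
Variable th : nat -> full_group mu E.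
Hypothesis thE : forall x y, E (x, y) <-> exists k, y = th k x.
Variable nu : nat -> probability (X * X)%type R.
Hypothesis nu1 : forall n A, measurable A -> pr (nu n) (fst @^-1` A) = pr mu A.
Hypothesis nu2 : forall n A, measurable A -> pr (nu n) (snd @^-1` A) = pr mu A.
Hypothesis nu_inv : forall k (e : R), 0 < e -> exists N, forall n, (N <= n)%N ->
  forall S, measurable S -> `|pr (nu n) (pair_map (th k) @^-1` S) - pr (nu n) S| <= e.
Variable B : nat -> set X.
Hypothesis mB : forall k, measurable (B k).
Hypothesis genB : measurable `<=` <<s range B>>.
Hypothesis nu_B : forall k (e : R), 0 < e -> exists N, forall n, (N <= n)%N ->
  pr (nu n) (B k `*` ~` B k) <= e.

Let asym_null (A : set X) := forall e : R, 0 < e -> exists N, forall n, (N <= n)%N ->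
  pr (nu n) (A `*` ~` A) <= e.

Let mf (A : set X) : measurable A -> measurable (fst @^-1` A : set (X * X)).
Proof. exact: measurable_fst_preimage. Qed.

Let mXC (A : set X) : measurable A -> measurable (A `*` ~` A).
Proof. by move=> mA; apply: measurableX => //; exact: measurableC. Qed.

(** Both masses equal mu A minus the mass of A x A, one by each marginal. *)
Lemma pr_cross n A : measurable A -> pr (nu n) (~` A `*` A) = pr (nu n) (A `*` ~` A).
Proof.
move=> mA; have mAA : measurable (A `*` A) by exact: measurableX.
have mCA : measurable (~` A `*` A) by apply: measurableX => //; exact: measurableC.
have H1 : pr (nu n) (A `*` A) + pr (nu n) (A `*` ~` A) = pr mu A.
  rewrite -(nu1 n mA) -prU//; [|exact: mXC|by apply/seteqP; split=> // -[x y] /= [[? ?] [? ?]]].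
  congr (fine (nu n _)); apply/seteqP; split=> -[x y] /=; first by case=> -[].
  by move=> Ax; case: (pselect (A y)) => Ay; [left|right].
have H2 : pr (nu n) (A `*` A) + pr (nu n) (~` A `*` A) = pr mu A.
  rewrite -(nu2 n mA) -prU//; last by apply/seteqP; split=> // -[x y] /= [[? ?] [? ?]].
  congr (fine (nu n _)); apply/seteqP; split=> -[x y] /=; first by case=> -[].
  by move=> Ay; case: (pselect (A x)) => Ax; [left|right].
by lra.
Qed.

Let asym_null_bigcup (F : nat -> set X) m : (forall k, measurable (F k)) ->
  (forall k, asym_null (F k)) ->
  forall e : R, 0 < e -> exists N, forall n, (N <= n)%N ->
  pr (nu n) (\bigcup_(k < m) (F k `*` ~` F k)) <= e.
Proof.
move=> mF F0; elim: m => [|m IH] e e0.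
  by exists 0%N => n _; rewrite bigcup_mkord big_ord0 pr0 ltW.
have e2 : 0 < e / 2 by rewrite divr_gt0.
have [N1 H1] := IH _ e2; have [N2 H2] := F0 m _ e2.
exists (maxn N1 N2) => n; rewrite geq_max => /andP[n1 n2].
rewrite bigcup_mkord big_ord_recr/= -(bigcup_mkord m (fun k => F k `*` ~` F k)).
apply: (le_trans (prU_le _ _ _)); [|exact: mXC|by have := H1 n n1; have := H2 n n2; lra].
by apply: bigcup_measurable => k _; exact: mXC.
Qed.

(** If x lies in some [F k] with k < m, then the pair (x, y) must leave F k x F k through the second
    coordinate; otherwise x lies in the tail. The first marginal measures the tail by [mu], so one m
    works for all n. *)
Let tail_le n (F : nat -> set X) m (A : set X) (S : set (X * X)) :
  (forall k, measurable (F k)) -> measurable A -> measurable S ->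
  (forall x y, S (x, y) -> A x) -> (forall k x y, (k < m)%N -> F k x -> F k y -> ~ S (x, y)) ->
  pr (nu n) S <= pr (nu n) (\bigcup_(k < m) (F k `*` ~` F k)) + pr mu (A `\` \bigcup_(k < m) F k).
Proof.
move=> mF mA mS SA SF.
have mUm : measurable (\bigcup_(k < m) F k) by exact: bigcup_measurable.
have mU : measurable (\bigcup_(k < m) (F k `*` ~` F k)).
  by apply: bigcup_measurable => k _; exact: mXC.
have mT := mf (measurableD mA mUm).
rewrite -(nu1 n (measurableD mA mUm)).
apply: (le_trans _ (prU_le (nu n) mU mT)); apply: pr_le => //; first exact: measurableU.
move=> [x y] Sxy; case: (pselect ((\bigcup_(k < m) F k) x)) => [[k km Fkx]|Nx].
  by left; exists k => //; split=> //= Fky; exact: (SF k x y).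
by right; split=> //; exact: SA Sxy.
Qed.

(** The sets with this property form a sigma-algebra: complements by [pr_cross], countable unions by
    truncating with [tail_le]. *)
Lemma asymptotically_diagonal A : measurable A -> asym_null A.
Proof.
move=> mA; pose G := [set A : set X | measurable A /\ asym_null A].
suff : G A by case.
have : <<s range B>> A by exact: genB.
apply: smallest_sub.
  split.
  - by split=> // e e0; exists 0%N => n _; rewrite set0X pr0 ltW.
  - move=> C [mC C0]; rewrite setTD; split; first exact: measurableC.
    move=> e e0; have [N HN] := C0 _ e0; exists N => n Nn.
    by rewrite setCK pr_cross//; exact: HN.
  - move=> F GF; have mF k : measurable (F k) by case: (GF k).
    have F0 k : asym_null (F k) by case: (GF k).
    have mU : measurable (\bigcup_k F k) by exact: bigcup_measurable.
    split=> // e e0; have e2 : 0 < e / 2 by rewrite divr_gt0.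
    have [m Hm] := pr_tail mu mF e2; have [N HN] := asym_null_bigcup m mF F0 e2.
    exists N => n Nn.
    apply: (le_trans (@tail_le n F m _ _ mF mU (mXC mU) _ _)).
    - by move=> x y [].
    - by move=> k x y km Fx Fy [_]; apply; exists k.
    - by have := HN n Nn; lra.
by move=> _ [k _ <-]; split; [exact: mB|move=> e e0; exact: nu_B].
Qed.

(** Almost everywhere, theta agrees with [th k] on the pieces [F k] of a partition. The measures
    asymptotically concentrate on the union of finitely many squares F k x F k, because each [F k]
    is asymptotically diagonal, and on such a square theta acts as a generator. *)
Lemma asymptotically_invariant (theta : full_group mu E) (e : R) : 0 < e ->
  exists N, forall n, (N <= n)%N -> forall S, measurable S ->
    `|pr (nu n) (pair_map theta @^-1` S) - pr (nu n) S| <= e.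
Proof.
pose C k := [set x | theta x = th k x].
have mC k : measurable (C k).
  have mg : measurable_fun setT (fun x => (theta x, th k x)).
    by apply: measurable_fun_pair; exact: fg_measurable.
  rewrite (_ : C k = (fun x => (theta x, th k x)) @^-1` diagonal)//.
  by rewrite -[X in measurable X]setTI; apply: mg => //; exact: (measurable_diagonal hX).
pose F := seqDU C; have mF k : measurable (F k) by exact: seqDU_measurable.
have FC k x : F k x -> theta x = th k x by case.
have tF : forall i j x, F i x -> F j x -> i = j.
  by move=> i j x Fi Fj; apply: (@trivIset_seqDU _ C i j I I); exists x.
have cover : pr mu (~` \bigcup_k F k) = 0.
  have mU : measurable (~` \bigcup_k F k) by apply: measurableC; exact: bigcup_measurable.
  have [N [mN N0 NE]] := fg_ae theta.
  apply/eqP; rewrite eq_le pr_ge0 andbT.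
  rewrite -[leRHS]/(fine 0%E) -N0; apply: pr_le => // x Nx; apply: NE => Ex; apply: Nx.
  have /thE[k tk] := Ex; rewrite -seqDU_bigcup_eq; by exists k.
pose D m := \bigcup_(k < m) (F k `*` F k).
pose iF k := fg_inv theta @^-1` F k.
have miF k : measurable (iF k) by exact: measurable_preimage_fgV.
pose D' m := \bigcup_(k < m) (iF k `*` iF k).
have mD m : measurable (D m) by apply: bigcup_measurable => k _; exact: measurableX.
have mD' m : measurable (D' m) by apply: bigcup_measurable => k _; exact: measurableX.
have mT S : measurable S -> measurable (pair_map theta @^-1` S).
  by apply: measurable_pair_preimage; exact: fg_measurable.
have step m : forall e : R, 0 < e -> exists N, forall n, (N <= n)%N -> forall S, measurable S ->
    pr (nu n) (pair_map theta @^-1` S `&` D m) <= pr (nu n) (S `&` D' m) + e.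
  elim: m => [|m IH] {}e e0.
    exists 0%N => n _ S mS; rewrite /D/D' !bigcup_mkord !big_ord0 !setI0 pr0 add0r.
    exact: ltW.
  have e2 : 0 < e / 2 by rewrite divr_gt0.
  have [N1 H1] := IH _ e2; have [N2 H2] := nu_inv m e2.
  exists (maxn N1 N2) => n; rewrite geq_max => /andP[n1 n2] S mS.
  have DS : D m.+1 = D m `|` F m `*` F m by rewrite /D !bigcup_mkord big_ord_recr.
  have D'S : D' m.+1 = D' m `|` iF m `*` iF m by rewrite /D' !bigcup_mkord big_ord_recr.
  have mFF : measurable (F m `*` F m) by exact: measurableX.
  have miFF : measurable (iF m `*` iF m) by exact: measurableX.
  have mSF : measurable (S `&` iF m `*` iF m) by exact: measurableI.
  rewrite DS D'S !setIUr; apply: (le_trans (prU_le _ _ _)).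
  - by apply: measurableI => //; exact: mT.
  - by apply: measurableI => //; exact: mT.
  rewrite [leRHS](_ : _ = pr (nu n) (S `&` D' m) + pr (nu n) (S `&` iF m `*` iF m) + e); last first.
    congr (_ + _); apply: prU => //; first exact: measurableI.
    apply/seteqP; split=> // -[x y] [[_ [k /= km [Fx _]]] [_ [Fx' _]]].
    by have := tF _ _ _ Fx Fx' => km'; move: km; rewrite km' ltnn.
  (* On F m x F m both coordinates are moved by [th m], so near invariance under this generator
     applies to [S] cut down to the image square. *)
  have -> : pair_map theta @^-1` S `&` F m `*` F m =
      pair_map (th m) @^-1` (S `&` iF m `*` iF m).
    have iFE x : iF m (th m x) <-> F m x.
      rewrite /iF/=; split=> [Fx|Fx]; last by rewrite -(FC _ _ Fx) fg_funK.
      have /= := FC _ _ Fx; rewrite fg_invK => /(can_inj (fg_funK (th m))) xE.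
      by rewrite xE.
    apply/seteqP; split=> -[x y]; rewrite /pair_map/=.
      move=> [Sxy [Fx Fy]]; rewrite -(FC _ _ Fx) -(FC _ _ Fy); split=> //.
      by rewrite (FC _ _ Fx) (FC _ _ Fy); split; apply/iFE.
    by move=> [Sxy [/iFE Fx /iFE Fy]]; rewrite (FC _ _ Fx) (FC _ _ Fy).
  have := H1 n n1 _ mS; have := H2 n n2 _ mSF; rewrite ler_norml => /andP[_].
  lra.
have step2 : forall e : R, 0 < e -> exists m, exists N, forall n, (N <= n)%N ->
    pr (nu n) (~` D m) <= e.
  move=> {}e e0; have e2 : 0 < e / 2 by rewrite divr_gt0.
  have [m Hm] := pr_tail mu mF e2; exists m.
  have [N HN] := asym_null_bigcup m mF (fun k => asymptotically_diagonal (mF k)) e2.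
  exists N => n Nn.
  apply: (le_trans (@tail_le n F m _ _ mF measurableT (measurableC (mD m)) _ _)) => //.
    by move=> k x y km Fx Fy; apply; exists k.
  have mU : measurable (\bigcup_k F k) by exact: bigcup_measurable.
  have mUm : measurable (\bigcup_(k < m) F k) by exact: bigcup_measurable.
  have sub : pr mu (setT `\` \bigcup_(k < m) F k) <= pr mu (~` \bigcup_k F k) +
      pr mu (\bigcup_k F k `\` \bigcup_(k < m) F k).
    apply: (le_trans _ (prU_le _ (measurableC mU) (measurableD mU mUm))); apply: pr_le => //.
    - exact: measurableD.
    - by apply: measurableU; [exact: measurableC|exact: measurableD].
    - by move=> x [_ Nx]; case: (pselect ((\bigcup_k F k) x)) => Ux; [right|left].
  by have := HN n Nn; move: sub; rewrite cover; lra.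
move=> e0; have e2 : 0 < e / 2 by rewrite divr_gt0.
have [m [N1 H1]] := step2 _ e2; have [N2 H2] := step m _ e2.
exists (maxn N1 N2) => n; rewrite geq_max => /andP[n1 n2].
(* An upper bound for every set suffices: applied to the complement it is the lower bound. *)
have up S : measurable S -> pr (nu n) (pair_map theta @^-1` S) <= pr (nu n) S + e.
  move=> mS; rewrite (prID (nu n) (mT _ mS) (mD m)).
  have : pr (nu n) (pair_map theta @^-1` S `\` D m) <= pr (nu n) (~` D m).
    by apply: pr_le; [apply: measurableD => //; exact: mT|exact: measurableC|move=> z []].
  have : pr (nu n) (S `&` D' m) <= pr (nu n) S.
    by apply: pr_le => //; exact: measurableI.
  by have := H1 n n1; have := H2 n n2 _ mS; lra.
move=> S mS; have := up _ mS; have := up _ (measurableC mS).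
rewrite preimage_setC !prC//; last exact: mT.
by move=> h1 h2; rewrite ler_norml; apply/andP; split; lra.
Qed.

End convergence.

Lemma bmeas_half (R : realType) d (T : measurableType d) (A : set T) (h : T -> R) :
  measurable A -> measurable_fun setT h -> (forall x, 0 <= h x <= 1) ->
  bmeas (\1_A : T -> R) /\ bmeas h.
Proof. by move=> mA mh h01; split; [exact: bmeas_indic|exact: bmeas01]. Qed.

(** * From uniform near invariance on sets to total variation *)

Section total_variation.
Context (R : realType) d (T : measurableType d) (m : probability T R) (t : T -> T).
Hypothesis mt : measurable_fun setT t.
Variable e : R.
Hypothesis inv : forall S, measurable S -> `|pr m (t @^-1` S) - pr m S| <= e.

Let J (u : T -> R) := `|Int m (fun z => u (t z)) - Int m u|.

Let bt (u : T -> R) : bmeas u -> bmeas (fun z => u (t z)).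
Proof. by move=> [mu [C uC]]; split; [exact: measurableT_comp|exists C]. Qed.

Let e0 : 0 <= e.
Proof. by apply: (le_trans _ (inv measurableT)). Qed.

Lemma Int_translate_unit (h : T -> R) : measurable_fun setT h -> (forall x, 0 <= h x <= 1) ->
  J h <= e.
Proof.
move=> mh h01; apply: (@dyadic_le _ _ _ J 2) => //.
- move=> A h1 mA mh1 h101; have [bA bh] := bmeas_half mA mh1 h101.
  rewrite /J (@IntZ _ _ _ m 2^-1 (fun z => \1_A (t z) + h1 (t z))); last first.
    by apply: bmeasD; [exact: (bt bA)|exact: bt].
  rewrite (@IntZ _ _ _ m 2^-1 (fun z => \1_A z + h1 z)); last exact: bmeasD.
  rewrite (@IntD _ _ _ m (fun z => \1_A (t z)) (fun z => h1 (t z))); [|exact: (bt bA)|exact: bt].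
  rewrite IntD// -mulrBr normrM ger0_norm// ler_pM2l// opprD addrACA.
  exact: ler_normD.
- move=> h1 mh1 h101; have bh := bmeas01 mh1 h101.
  have := @Int01 _ _ _ m _ mh1 h101.
  have := @Int01 _ _ _ m _ (bt bh).1 (fun x => h101 (t x)).
  by rewrite /J ler_norml => /andP[? ?] /andP[? ?]; apply/andP; split; lra.
- move=> A mA; rewrite /J Int_indic//.
  have -> : (fun z => \1_A (t z)) = \1_(t @^-1` A) :> (T -> R).
    by apply/funext => z; rewrite !indicE.
  rewrite Int_indic//; first exact: inv.
  by rewrite -[X in measurable X]setTI; exact: mt.
Qed.

Lemma Int_translate (u : T -> R) : measurable_fun setT u -> (forall x, `|u x| <= 1) ->
  J u <= 2 * e.
Proof.
move=> mu u1; pose h x := 2^-1 * (u x + 1).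
have mh : measurable_fun setT h.
  by apply: measurable_funM => //; exact: measurable_funD.
have h01 x : 0 <= h x <= 1.
  by have := u1 x; rewrite /h ler_norml => /andP[? ?]; apply/andP; split; lra.
have bh := bmeas01 mh h01.
have uE (s : T -> T) : (fun x => u (s x)) = fun x => 2 * h (s x) - 1.
  by apply/funext => x; rewrite /h; lra.
have -> : J u = `|Int m (fun x => 2 * h (t x) - 1) - Int m (fun x => 2 * h x - 1)|.
  by rewrite /J (uE t) -(uE id).
rewrite IntB ?Int_cst; [|by apply: bmeasZ; exact: bt|exact: bmeas_cst].
rewrite IntB ?Int_cst; [|by apply: bmeasZ|exact: bmeas_cst].
rewrite (@IntZ _ _ _ m 2 (fun z => h (t z))); last exact: bt.
rewrite (@IntZ _ _ _ m 2 h bh) opprB addrA subrK -mulrBr normrM ger0_norm//.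
by rewrite ler_pM2l//; exact: Int_translate_unit.
Qed.

(** The bound e on sets persists for [0,1]-valued functions, doubles for values in [-1,1], and
    doubles again when real and imaginary parts are added. The lower bound comes from the test
    function 0. *)
Lemma tv_dist_translate : (0 <= tv_dist (pushforward m t) m <= (4 * e)%:E)%E.
Proof.
apply/andP; split.
  apply: ereal_sup_ubound; exists (cst 0).
    split; first exact: cmeasurable_cst.
    by move=> x; rewrite normc0.
  have z (m' : {measure set T -> \bar R}) : cintegral m' (cst 0) = 0 :> R[i].
    by rewrite /cintegral/= integral0.
  by rewrite (z m) (z (pushforward_meas m mt)) subrr normc0.
apply: ge_ereal_sup => _ [f [[mf1 mf2] f1] <-]; rewrite lee_fin.
have imE (u : T -> R) : measurable_fun setT u ->
    (\int[pushforward m t]_x (u x)%:E = \int[m]_x (u (t x))%:E)%E.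
  move=> mu; exact: (@integral_image _ _ _ _ _ m (pushforward_meas m mt) _ mt (fun A _ => erefl)
    _ (proj2 (measurable_EFinP _ _) mu)).
apply: (le_trans (normc_le _)).
have -> : re (cintegral (pushforward m t) f - cintegral m f) =
    Int m (fun z => re (f (t z))) - Int m (fun z => re (f z)).
  by rewrite /cintegral (imE (fun z => re (f z)))//.
have -> : im (cintegral (pushforward m t) f - cintegral m f) =
    Int m (fun z => im (f (t z))) - Int m (fun z => im (f z)).
  by rewrite /cintegral (imE (fun z => im (f z)))//.
have h1 := Int_translate mf1 (fun x => le_trans (re_le_normc (f x)) (f1 x)).
have h2 := Int_translate mf2 (fun x => le_trans (im_le_normc (f x)) (f1 x)).
by rewrite /J in h1 h2; lra.
Qed.

End total_variation.

(** * Convergence of integrals of products *)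

Section diagonal_limit.
Context (R : realType) d (X : measurableType d) (mu : probability X R).
Variable nu : nat -> probability (X * X)%type R.
Hypothesis nu1 : forall n A, measurable A -> pr (nu n) (fst @^-1` A) = pr mu A.
Hypothesis nu2 : forall n A, measurable A -> pr (nu n) (snd @^-1` A) = pr mu A.
Hypothesis nu_diag : forall A (e : R), measurable A -> 0 < e -> exists N, forall n, (N <= n)%N ->
  pr (nu n) (A `*` ~` A) <= e.

Let D n (h : X -> R) := Int (nu n) (fun z => `|h z.2 - h z.1|).

Let bD (h : X -> R) : bmeas h -> bmeas (fun z : X * X => `|h z.2 - h z.1|).
Proof. by move=> bh; apply/bmeas_norm/bmeasB; [exact: bmeas_snd|exact: bmeas_fst]. Qed.

Let D_indic n (A : set X) : measurable A -> D n \1_A = 2 * pr (nu n) (A `*` ~` A).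
Proof.
move=> mA; have mCA := measurableC mA.
have m1 : measurable (A `*` ~` A) by exact: measurableX.
have m2 : measurable (~` A `*` A) by exact: measurableX.
have -> : D n \1_A = Int (nu n) \1_(A `*` ~` A `|` ~` A `*` A).
  congr Int; apply/funext => -[x y] /=; rewrite !indicE.
  have [Ax|Ax] := pselect (A x); have [Ay|Ay] := pselect (A y).
  - rewrite (mem_set Ax) (mem_set Ay) subrr normr0 memNset//=.
    by case=> -[].
  - rewrite (mem_set Ax) (memNset Ay) sub0r normrN normr1 mem_set//=.
    by left.
  - rewrite (memNset Ax) (mem_set Ay) subr0 normr1 mem_set//=.
    by right.
  - rewrite (memNset Ax) (memNset Ay) subrr normr0 memNset//=.
    by case=> -[].
rewrite Int_indic; last exact: measurableU.
rewrite prU//; last by apply/seteqP; split=> // -[x y] /= [[? ?] [? ?]].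
by rewrite (pr_cross nu1 nu2 n mA) mulr_natl mulr2n.
Qed.

(** The digit sets are finitely many and independent of n, so the thresholds at which they become
    nearly diagonal have a common maximum. *)
Let D_unit (h : X -> R) (e : R) : measurable_fun setT h -> (forall x, 0 <= h x <= 1) -> 0 < e ->
  exists N, forall n, (N <= n)%N -> D n h <= e.
Proof.
move=> mh h01 e0; have e2 : 0 < e / 2 by rewrite divr_gt0.
have e4 : 0 < e / 4 by rewrite divr_gt0.
have p0 : 0 <= 2 / e by rewrite divr_ge0// ltW.
have := archi_boundP p0; set j := Num.bound _ => Hj.
have [s [ms Hs]] := dyadic_bound j mh h01.
have [N HN] : exists N, forall n, (N <= n)%N -> forall k, (k < j)%N ->
    pr (nu n) (s k `*` ~` s k) <= e / 4.
  elim: (j) => [|i [N1 H1]]; first by exists 0%N.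
  have [N2 H2] := nu_diag (ms i) e4; exists (maxn N1 N2) => n.
  rewrite geq_max => /andP[n1 n2] k; rewrite ltnS leq_eqVlt => /orP[/eqP->|]; first exact: H2.
  exact: H1.
exists N => n Nn.

have j2 : 2^-1 ^+ j <= e / 2 :> R.
  rewrite exprVn -[leRHS]invrK lef_pV2 ?posrE ?exprn_gt0 ?invr_gt0// invf_div.
  by apply: (le_trans (ltW Hj)); rewrite -natrX ler_nat ltnW// ltn_expl.
suff : D n h <= e / 2 + 2^-1 ^+ j * 1 by move: j2; set q := _ ^+ j; lra.
apply: Hs; first exact: ltW.
- move=> A h1 mA mh1 h101; have [bA bh] := bmeas_half mA mh1 h101.
  rewrite -(IntD (nu n) (bD bA) (bD bh)) -IntZ; last by apply: bmeasD; exact: bD.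
  apply: Int_le; [apply: (@bD (fun x => 2^-1 * (\1_A x + h1 x))); apply: bmeasZ; exact: bmeasD|by apply: bmeasZ; apply: bmeasD; exact: bD|].
  move=> z; rewrite -mulrBr normrM ger0_norm// ler_pM2l// opprD addrACA.
  exact: ler_normD.
- move=> h1 mh1 h101; have bh := bmeas01 mh1 h101.
  have /andP[_ //] : 0 <= D n h1 <= 1.
  apply: Int01; first by case: (bD bh).
  move=> z; rewrite normr_ge0/= ler_norml.
  have /andP[? ?] := h101 z.1; have /andP[? ?] := h101 z.2.
  by apply/andP; split; lra.
- by move=> k kj; rewrite D_indic//; have := HN n Nn k kj; lra.
Qed.

Let D_bmeas (h : X -> R) (e : R) : bmeas h -> 0 < e ->
  exists N, forall n, (N <= n)%N -> D n h <= e.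
Proof.
move=> [mh [C hC]] e0; pose K := `|C| + 1; have K0 : 0 < K by rewrite ltr_wpDl.
have hK x : `|h x| <= K.
  by apply: (le_trans (hC x)); apply: (le_trans (ler_norm _)); rewrite lerDl.
pose u x := (2 * K)^-1 * (h x + K).
have K2 : 0 < 2 * K by rewrite mulr_gt0.
have mu' : measurable_fun setT u by apply: measurable_funM => //; exact: measurable_funD.
have u01 x : 0 <= u x <= 1.
  have := hK x; rewrite ler_norml => /andP[? ?].
  rewrite /u mulrC; apply/andP; split; first by rewrite divr_ge0 ?(ltW K2)//; lra.
  by rewrite ler_pdivrMr// mul1r; lra.
have eK : 0 < e / (2 * K) by rewrite divr_gt0.
have [N HN] := D_unit mu' u01 eK; exists N => n Nn.
have := HN n Nn; rewrite ler_pdivlMr// mulrC -IntZ; last by apply: bD; exact: bmeas01.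
congr (_ <= _); congr Int; apply/funext => z.
have hE x : h x = 2 * K * u x - K by rewrite /u mulVKf ?gt_eqF// addrK.
rewrite !hE -[X in X * _](ger0_norm (ltW K2)) -normrM.
by congr (`|_|); ring.
Qed.

Lemma Int_fst n (f : X -> R) : bmeas f -> Int (nu n) (fun z => f z.1) = Int mu f.
Proof.
move=> bf; have := @density_Int _ _ _ mu _ _ (nu n) fst (fun=> 1) f measurable_fst (bmeas_cst X 1).
move=> ->//; first by congr Int; apply/funext => x; rewrite mulr1.
move=> A mA; rewrite nu1// -Int_indic//.
by congr Int; apply/funext => x; rewrite mulr1.
Qed.

(** Replacing g(y) by g(x) costs at most K times the mean of |g(y) - g(x)|, which tends to 0. After
    the replacement the integral is exactly that of f g, by the first marginal. *)
Lemma Int_product_cvg (f g : X -> R) (e : R) : bmeas f -> bmeas g -> 0 < e ->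
  exists N, forall n, (N <= n)%N ->
  `|Int (nu n) (fun z => f z.1 * g z.2) - Int mu (fun x => f x * g x)| <= e.
Proof.
move=> bf bg e0; have [_ [C fC]] := bf; pose K := `|C| + 1.
have K0 : 0 < K by rewrite ltr_wpDl.
have fK x : `|f x| <= K.
  by apply: (le_trans (fC x)); apply: (le_trans (ler_norm _)); rewrite lerDl.
have eK : 0 < e / K by rewrite divr_gt0.
have [N HN] := D_bmeas bg eK; exists N => n Nn.
have b1 := bmeas_fst bf; have b2 := bmeas_snd bg; have b3 := bmeas_fst bg.
rewrite -(@Int_fst n (fun x => f x * g x)); last exact: bmeasM.
rewrite -IntB; [|exact: bmeasM|exact: bmeasM].
apply: (le_trans (Int_norm _ _)); first by apply: bmeasB; exact: bmeasM.
apply: (@le_trans _ _ (Int (nu n) (fun z => K * `|g z.2 - g z.1|))).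
  apply: Int_le; [by apply: bmeas_norm; apply: bmeasB; exact: bmeasM|by apply: bmeasZ; exact: bD|].
  by move=> z; rewrite -mulrBr normrM ler_wpM2r.
rewrite IntZ; last exact: bD.
by have := HN n Nn; rewrite ler_pdivlMr// mulrC.
Qed.

Lemma ae_coordinates (P : X -> Prop) n : {ae mu, forall x, P x} ->
  {ae nu n, forall z, P z.1} /\ {ae nu n, forall z, P z.2}.
Proof.
move=> [N [mN N0 PN]].
have z (A : set (X * X)) : measurable A -> pr (nu n) A = pr mu N -> nu n A = 0%E.
  by move=> mA AN; rewrite prE// AN; rewrite [fine _](congr1 fine N0).
split; [exists (fst @^-1` N)|exists (snd @^-1` N)].
  have mfN := measurable_fst_preimage mN.
  by split=> //; [apply: z => //; exact: nu1|move=> x /= ?; exact: PN].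
have mfN := measurable_snd_preimage mN.
by split=> //; [apply: z => //; exact: nu2|move=> x /= ?; exact: PN].
Qed.

(** Elements of [Linfty] are bounded only almost everywhere. Clamping gives representatives bounded
    everywhere, equal to them almost everywhere for [mu] and hence, by the marginals, in each
    coordinate for every [nu n]. *)
Definition clamp (C : R) (f : X -> R) x := Num.max (- C) (Num.min C (f x)).

Lemma bmeas_clamp (C : R) (f : X -> R) : 0 <= C -> measurable_fun setT f -> bmeas (clamp C f).
Proof.
move=> C0 mf; split.
  by apply: measurable_maxr => //; exact: measurable_minr.
exists C => x; rewrite ler_norml /clamp le_max lexx/= ge_max ge_min lexx /= andbT.
by rewrite lerNl; lra.
Qed.

Lemma clamp_id (C : R) (f : X -> R) x : `|f x| <= C -> clamp C f x = f x.
Proof. by rewrite /clamp ler_norml => /andP[h1 h2]; rewrite min_r// max_r. Qed.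

Definition cclamp (C : R) (f : X -> R[i]) x := clamp C (fun y => re (f y)) x +i* clamp C (fun y => im (f y)) x.

Lemma Linfty_clamp (f : Linfty mu) : exists C : R, 0 <= C /\ {ae mu, forall x, f x = cclamp C f x}.
Proof.
have [C fC] := Linfty_bounded f; exists `|C|; split=> //.
apply: filterS fC => x fx; have fx' := le_trans fx (ler_norm C).
rewrite /cclamp !clamp_id; first by case: (f x).
  exact: le_trans (im_le_normc _) fx'.
exact: le_trans (re_le_normc _) fx'.
Qed.

Lemma cintegral_product_cvg (f g : Linfty mu) :
  (fun n => cintegral (nu n) (fun z => f z.1 * g z.2) : R[i]^o)
    @ \oo --> (cintegral mu (fun x => f x * g x) : R[i]^o).
Proof.
have [C [C0 fC]] := Linfty_clamp f; have [C' [C0' gC]] := Linfty_clamp g.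
pose f1 := clamp C (fun y => re (f y)); pose f2 := clamp C (fun y => im (f y)).
pose g1 := clamp C' (fun y => re (g y)); pose g2 := clamp C' (fun y => im (g y)).
have [mf1 mf2] := Linfty_measurable f; have [mg1 mg2] := Linfty_measurable g.
have bf1 : bmeas f1 by exact: bmeas_clamp.
have bf2 : bmeas f2 by exact: bmeas_clamp.
have bg1 : bmeas g1 by exact: bmeas_clamp.
have bg2 : bmeas g2 by exact: bmeas_clamp.
have mcf : cmeasurable (cclamp C f) by split; [case: bf1|case: bf2].
have mcg : cmeasurable (cclamp C' g) by split; [case: bg1|case: bg2].
have muE : cintegral mu (fun x => f x * g x) =
    (Int mu (fun x => f1 x * g1 x) - Int mu (fun x => f2 x * g2 x)) +i*
    (Int mu (fun x => f1 x * g2 x) + Int mu (fun x => f2 x * g1 x)).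
  rewrite (@ae_eq_cintegral _ _ _ mu _ (fun x => cclamp C f x * cclamp C' g x)).
  - rewrite -IntB; [|exact: bmeasM|exact: bmeasM].
    by rewrite -IntD; [|exact: bmeasM|exact: bmeasM].
  - by apply: cmeasurableM; exact: Linfty_measurable.
  - exact: cmeasurableM.
  - by apply: filterS2 fC gC => x -> ->.
have nuE n : cintegral (nu n) (fun z => f z.1 * g z.2) =
    (Int (nu n) (fun z => f1 z.1 * g1 z.2) - Int (nu n) (fun z => f2 z.1 * g2 z.2)) +i*
    (Int (nu n) (fun z => f1 z.1 * g2 z.2) + Int (nu n) (fun z => f2 z.1 * g1 z.2)).
  rewrite (@ae_eq_cintegral _ _ _ (nu n) _ (fun z => cclamp C f z.1 * cclamp C' g z.2)).
  - have b1 := bmeas_fst bf1; have b2 := bmeas_fst bf2.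
    have b3 := bmeas_snd bg1; have b4 := bmeas_snd bg2.
    rewrite -IntB; [|exact: bmeasM|exact: bmeasM].
    by rewrite -IntD; [|exact: bmeasM|exact: bmeasM].
  - by apply: cmeasurableM; apply: cmeasurable_comp => //; exact: Linfty_measurable.
  - by apply: cmeasurableM; apply: cmeasurable_comp.
  - have [h1 _] := ae_coordinates n fC; have [_ h2] := ae_coordinates n gC.
    by apply: filterS2 h1 h2 => z -> ->.
(* A positive element of [R[i]] is real, so the tolerance is a real number. It is divided among the
   four real products that make up the complex one. *)
apply/cvgrPdist_le => -[e e'] /=; rewrite ltcE/= => /andP[/eqP -> e0].
have e4 : 0 < e / 4 by rewrite divr_gt0.
have [N1 H1] := Int_product_cvg bf1 bg1 e4; have [N2 H2] := Int_product_cvg bf2 bg2 e4.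
have [N3 H3] := Int_product_cvg bf1 bg2 e4; have [N4 H4] := Int_product_cvg bf2 bg1 e4.
exists (maxn (maxn N1 N2) (maxn N3 N4)) => // n.
rewrite /= !geq_max => /andP[/andP[n1 n2] /andP[n3 n4]].
rewrite muE nuE; set z := (_ - _).
have -> : `|z| = (normc z)%:C by [].
rewrite lecR; apply: (le_trans (normc_le _)); rewrite /z/=.
have tri (p q p' q' : R) : `|p - q| <= e / 4 -> `|p' - q'| <= e / 4 ->
    `|q - q' - (p - p')| <= e / 2 /\ `|q + q' - (p + p')| <= e / 2.
  by rewrite !ler_norml => /andP[? ?] /andP[? ?]; split; apply/andP; split; lra.
have [h12 _] := tri _ _ _ _ (H1 n n1) (H2 n n2).
have [_ h34] := tri _ _ _ _ (H3 n n3) (H4 n n4).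
by rewrite [leRHS](splitr e); apply: lerD.
Qed.

End diagonal_limit.

(** * Measures obtained from a failure of rigidity *)

Section not_rigid.
Context (R : realType) d (X : measurableType d) (mu : probability X R) (E : set (X * X)).
Hypotheses (hX : standard_borel R X) (hE : cmp_relation mu E).
Variable th : nat -> full_group mu E.
Variable B : nat -> set X.
Hypothesis mB : forall k, measurable (B k).

Local Notation M := (@rel_algebra _ _ _ mu E hX hE).
Local Notation A0 := (@Linfty_algebra _ _ _ mu E hX hE).
Local Notation tau := (@rel_trace _ _ _ mu E hX hE).
Local Notation dotN := (@L2dot _ _ _ (rel_measure hX hE)).
Local Notation opT := (L2 (rel_measure hX hE) -> L2 (rel_measure hX hE)).
Local Notation hn K := (hnorm (hs_dot K)).

(** The failure is tested on the first [j] indicators and the first [j] group elements. A distance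
    to central vectors larger than [e] becomes mass at least e^2 off the diagonal, because the
    projected vector is central. *)
Lemma bad_bimodule_measure (e delta : R) (j : nat) : 0 < delta ->
  ~ (exists (F : set _) (delta : R), [/\ finite_set F, F `<=` M, 0 < delta &
      forall (K : hilbertSpace R) (l r : opT -> K -> K) (xi : K),
        bimodule dotN M l r ->
        hn K xi = 1 ->
        tracial M tau l r xi ->
        (forall x, F x -> hn K (l x xi - r x xi) <= delta) ->
        exists2 eta : K, central A0 l r eta & hn K (eta - xi) <= e]) ->
  exists lam : probability (X * X)%type R,
  [/\ forall A, measurable A -> lam (A `*` setT) = mu A /\ lam (setT `*` A) = mu A,
      forall k, (k < j)%N -> pr lam (B k `*` ~` B k) <= delta ^+ 2,
      forall k, (k < j)%N -> forall S, measurable S ->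
        `|pr lam (pair_map (th k) @^-1` S) - pr lam S| <= 2 * delta &
      0 <= e -> e ^+ 2 <= pr lam (~` diagonal)].
Proof.
move=> d0 bad.
pose F : set opT :=
  [set L2mul hX hE (Linfty_indic mu (B k)) | k in `I_j] `|`
  [set L2translate hX hE (th k) | k in `I_j].
have [K [l [r [xi [hb xi1 htr Fxi Neta]]]]] : exists K : hilbertSpace R,
    exists (l r : opT -> K -> K) (xi : K),
    [/\ bimodule dotN M l r,
        hn K xi = 1,
        tracial M tau l r xi,
        (forall x, F x -> hn K (l x xi - r x xi) <= delta) &
        ~ exists2 eta : K, central A0 l r eta &
          hn K (eta - xi) <= e].
  apply: contrapT => good; apply: bad; exists F, delta; split=> //.
  - by rewrite finite_setU; split; apply: finite_image; exact: finite_II.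
  - by move=> _ [[k _ <-]|[k _ <-]]; [exact: rel_algebra_mul|exact: rel_algebra_translate].
  - move=> K l r xi hb xi1 htr Fxi; apply: contrapT => Neta.
    by apply: good; exists K, l, r, xi.
have [lam [lam12 lamB lamT [eta ceta eta_xi]]] := bimodule_measure hb xi1 htr.
exists lam; split=> //.
- move=> k kj; apply: (le_trans (lamB _ (mB k))).
  rewrite lerXn2r// ?nnegrE ?hnorm_ge0 ?(ltW d0)//.
  by apply: Fxi; left; exists k.
- move=> k kj S mS; apply: (le_trans (lamT (th k) S mS)).
  by rewrite ler_pM2l//; apply: Fxi; right; exists k.
- move=> e0; apply: le_trans eta_xi.
  rewrite lerXn2r// ?nnegrE ?hnorm_ge0//.
  have [H|H] := leP (hn K (eta - xi)) e; last exact: ltW.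
  by case: Neta; exists eta.
Qed.

End not_rigid.

(** * Rigidity of the relation *)

Theorem proposition0p2 (R : realType) (d : measure_display)
    (X : measurableType d) (mu : probability X R) (E : set (X * X))
    (hX : standard_borel R X) (hmu : nonatomic mu)
    (hE : cmp_relation mu E) (hErg : ergodic mu E) :
  ~ (exists nu : nat -> probability (X * X)%type R,
      [/\ forall n, nu n diagonal = 0%E,
          forall n A, measurable A ->
            pushforward (nu n) fst A = mu A /\ pushforward (nu n) snd A = mu A,
          forall f1 f2 : Linfty mu,
            (fun n => cintegral (nu n) (fun z => f1 z.1 * f2 z.2) : R[i]^o)
              @ \oo --> (cintegral mu (fun x => f1 x * f2 x) : R[i]^o) &
          forall theta : full_group mu E,
            (fun n => tv_dist
               (pushforward (nu n) (fun z => (theta z.1, theta z.2))) (nu n))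
              @ \oo --> 0%E]) ->
  rigid_relation hX hE.
Proof.
move=> Nseq e e0; apply: contrapT => bad; apply: Nseq.
have [th thE] := full_group_enum hE.
have [B [mB genB _]] := standard_borel_generator hX.
(* Stage n uses n generators at tolerance 1/(n+1), so a fixed generator of index k is controlled
   from stage k+1 on. *)
pose delta n : R := n.+1%:R^-1.
have d0 n : 0 < delta n by rewrite invr_gt0 ltr0n.
have [lam lamP] := choice (fun n => bad_bimodule_measure th mB n (d0 n) bad).
have small (c : R) : 0 < c -> exists N, forall n, (N <= n)%N -> delta n <= c.
  move=> c0; have ci : 0 <= c^-1 by rewrite invr_ge0 ltW.
  have := archi_boundP ci; set N := Num.bound _ => HN; exists N => n Nn.
  rewrite /delta -[leRHS]invrK lef_pV2 ?posrE ?invr_gt0 ?ltr0n//.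
  by apply: (le_trans (ltW HN)); rewrite ler_nat (leq_trans Nn).
have lam1 n A : measurable A -> pr (lam n) (fst @^-1` A) = pr mu A.
  move=> mA; case: (lamP n) => /(_ _ mA)[<- _] _ _ _; congr (fine (lam n _)).
  by apply/seteqP; split=> -[x y] //= [].
have lam2 n A : measurable A -> pr (lam n) (snd @^-1` A) = pr mu A.
  move=> mA; case: (lamP n) => /(_ _ mA)[_ <-] _ _ _; congr (fine (lam n _)).
  by apply/seteqP; split=> -[x y] //= [].
have lam_inv k (c : R) : 0 < c -> exists N, forall n, (N <= n)%N -> forall S, measurable S ->
    `|pr (lam n) (pair_map (th k) @^-1` S) - pr (lam n) S| <= c.
  move=> c0; have c2 : 0 < c / 2 by rewrite divr_gt0.
  have [N HN] := small _ c2; exists (maxn N k.+1) => n; rewrite geq_max => /andP[n1 n2] S mS.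
  case: (lamP n) => _ _ /(_ k n2 S mS) H _; apply: (le_trans H).
  by have := HN n n1; lra.
have lam_B k (c : R) : 0 < c -> exists N, forall n, (N <= n)%N -> pr (lam n) (B k `*` ~` B k) <= c.
  move=> c0; have [N HN] := small _ c0; exists (maxn N k.+1) => n.
  rewrite geq_max => /andP[n1 n2]; case: (lamP n) => _ /(_ k n2) H _ _.
  apply: (le_trans H); apply: le_trans (HN n n1); rewrite expr2 ger_pMl//.
  by rewrite /delta invf_le1 ?ler1n ?ltr0n.
have e2 : 0 < e ^+ 2 by rewrite exprn_gt0.
have lam_off n : e ^+ 2 <= pr (lam n) (~` diagonal).
  by case: (lamP n) => _ _ _; apply; exact: ltW.
have [nu [nuD nuM nuI nuB]] :=
  off_diagonal_sequence hX hmu hE hErg thE lam1 lam2 lam_inv mB lam_B e2 lam_off.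
have nu1 n A : measurable A -> pr (nu n) (fst @^-1` A) = pr mu A by move=> /(nuM n)[].
have nu2 n A : measurable A -> pr (nu n) (snd @^-1` A) = pr mu A by move=> /(nuM n)[].
exists nu; split.
- move=> n; have mD := measurable_diagonal hX.
  by rewrite (prE (nu n) mD) nuD.
- move=> n A mA; have mf := measurable_fst_preimage mA; have ms := measurable_snd_preimage mA.
  split; rewrite (prE mu mA) -1?(nu1 n A mA).
    exact: (prE (nu n) mf).
  by rewrite (nu1 n A mA) -(nu2 n A mA); exact: (prE (nu n) ms).
- have nuA := asymptotically_diagonal nu1 nu2 mB genB nuB.
  by move=> f1 f2; apply: cintegral_product_cvg => // A c mA; exact: nuA.
- move=> theta; have inv (c : R) : 0 < c -> exists N, forall n, (N <= n)%N ->
      (0 <= tv_dist (pushforward (nu n) (pair_map theta)) (nu n) <= (4 * c)%:E)%E.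
    move=> c0; have [N HN] := asymptotically_invariant hX thE nu1 nu2 nuI mB genB nuB theta c0.
    exists N => n Nn; apply: tv_dist_translate; last by move=> S mS; exact: HN.
    by apply: measurable_pair_map; exact: fg_measurable.
  (* The distance is an extended real; the bound with c = 1 makes it finite from some index on. *)
  apply/fine_cvgP; split.
    have [N HN] := inv 1 ltr01; exists N => // n /= Nn.
    have /andP[h0 h1] := HN n Nn.
    by rewrite fin_numElt (lt_le_trans _ h0) ?ltNyr// (le_lt_trans h1)// ltry.
  apply/cvgrPdist_le => c c0; have c4 : 0 < c / 4 by rewrite divr_gt0.
  have [N HN] := inv _ c4; exists N => // n /= Nn; have /andP[h0 h1] := HN n Nn.
  rewrite sub0r normrN ger0_norm ?fine_ge0//.
  rewrite -lee_fin fineK ?fin_numElt ?(lt_le_trans _ h0) ?ltNyr ?(le_lt_trans h1) ?ltry//.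
  by apply: (le_trans h1); rewrite lee_fin mulrC divfK.
Qed.
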